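(* Let $G$ be a finite group and $\mathbb{k}$ a commutative ring. There exists a commutative diagram of algebras $$\begin{array}{ccccc} B^{\mathrm c}_{\mathbb{k}}(G)&\xrightarrow{\ \zeta_{\mathbb{k}}\ }&Z\mu_{\mathbb{k}}(G)&\xrightarrow{\ \beta\ }&Z\,\mathbb{k}b(\Omega_G\times\Omega_G)\\ {\scriptstyle\varphi_1^{\mathbb{k}}}\downarrow&&{\scriptstyle p'_{\mathbb{k}}}\downarrow&&\downarrow{\scriptstyle p_L}\\ Z\mathbb{k}G&\xrightarrow{\ \iota_{\mathbb{k}}\ }&Z\,co\mu_{\mathbb{k}}(G)&\xrightarrow{\ \phi\ }&ZY_{\mathbb{k}}(G) \end{array}$$ that is, $p'_{\mathbb{k}}\circ\zeta_{\mathbb{k}}=\iota_{\mathbb{k}}\circ\varphi^{\mathbb{k}}_1$ and $p_L\circ\beta=\phi\circ p'_{\mathbb{k}}$.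
   Context: Crossed Burnside ring. $B^{\mathrm c}_{\mathbb{k}}(G)$ is $\mathbb{k}\otimes$ the Grothendieck group of crossed $G$-sets $(X,\alpha)$ ($X$ a finite $G$-set, $\alpha$ a $G$-map from $X$ to $G$ with conjugation action), with product $(X,\alpha)(Y,\beta)=(X\times Y,(x,y)\mapsto\alpha(x)\beta(y))$. It has basis $[L,a]_G$, the class of $(G/L,gL\mapsto gag^{-1})$, $L\le G$, $a\in C_G(L)$ up to conjugacy. $\varphi_1^{\mathbb{k}}([L,a]_G)=\sum_{x\in[G/L]}xax^{-1}\in Z\mathbb{k}G$. Mackey algebras. $\mu_{\mathbb{k}}(G)$ is the $\mathbb{k}$-algebra generated by $t^H_K,r^H_K$ ($K\le H\le G$), $c_{g,H}$ ($g\in G,H\le G$) with relations (${}^gH=gHg^{-1}$, $H^g=g^{-1}Hg$): $t^H_H=r^H_H=c_{h,H}$ for $h\in H$; $t^H_Kt^K_L=t^H_L$, $r^K_Lr^H_K=r^H_L$; $c_{g',{}^gH}c_{g,H}=c_{g'g,H}$; $c_{g,H}t^H_K=t^{{}^gH}_{{}^gK}c_{g,K}$, $c_{g,K}r^H_K=r^{{}^gH}_{{}^gK}c_{g,H}$; $r^H_Jt^H_K=\sum_{x\in[J\backslash H/K]}t^J_{J\cap{}^xK}c_{x,J^x\cap K}r^K_{J^x\cap K}$; $\sum_Ht^H_H=1$; all other products of generators are zero. $co\mu_{\mathbb{k}}(G)$ is the quotient of $\mu_{\mathbb{k}}(G)$ by the relations $t^H_Kr^H_K=|H:K|\,t^H_H$;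 an overline denotes the class in the quotient. $p'_{\mathbb{k}}$ is the map on centers induced by the quotient map. The map $\zeta_{\mathbb{k}}$ (Bouc): $[L,a]_G\mapsto\sum_{U\le G}\sum_{w\in[L\backslash G/U]}t^U_{L^w\cap U}\,c_{w^{-1}aw,\,L^w\cap U}\,r^U_{L^w\cap U}$. The isomorphism $\iota_{\mathbb{k}}$ (Bouc, Rognerud): $\sum_{x\in G}\lambda_xx\mapsto\sum_{H\le G}\sum_{g\in[H\backslash G/H]}\left(\sum_{x\in H}\lambda_{gx}\right)\overline{t^H_{H\cap{}^gH}c_{g,H\cap H^g}r^H_{H\cap H^g}}$. Remaining objects. $\Omega_G=\coprod_{H\le G}G/H$; $Y_{\mathbb{k}}(G)=\mathrm{End}_{\mathbb{k}G}(\mathbb{k}\Omega_G)$. $\mathbb{k}b(\Omega_G\times\Omega_G)$ is $\mathbb{k}\otimes$ the Grothendieck group of finite $G$-sets over $\Omega_G\times\Omega_G$, with multiplication $(X,(f,g))\cdot(Y,(f',g'))=(X\times_{g,\Omega_G,f'}Y,\ (f,g'))$. The map $\beta$ is the restriction to centers of Bouc's algebra isomorphism $\mu_{\mathbb{k}}(G)\to\mathbb{k}b(\Omega_G\times\Omega_G)$ given on generators as follows: $t^H_K\mapsto(G/K,\ xK\mapsto(xH,xK))$, $r^H_K\mapsto(G/K,\ xK\mapsto(xK,xH))$, $c_{g,H}\mapsto(G/H,\ xH\mapsto(xg^{-1}\,{}^gH,\,xH))$. The map $p_L$ is induced on centers by the algebra map $\mathbb{k}b(\Omega_G\times\Omega_G)\to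 Y_{\mathbb{k}}(G)$ sending $(X,(f,g))$ to $\omega\mapsto\sum_{x\in g^{-1}(\omega)}f(x)$. The map $\phi$ is induced on centers by the algebra isomorphism $co\mu_{\mathbb{k}}(G)\to Y_{\mathbb{k}}(G)$ sending $\overline{t^H_K}$ to $xK\mapsto xH$, $\overline{r^H_K}$ to $xH\mapsto\sum_{h\in[H/K]}xhK$, and $\overline{c_{g,H}}$ to $xH\mapsto xg^{-1}\,{}^gH$, each extended by zero on the other summands of $\mathbb{k}\Omega_G$. *)

(* Defs.v *)
From HB Require Import structures.
Set Warnings "-notation-overridden,-ambiguous-paths".
From mathcomp Require Import all_boot all_order all_algebra.
From mathcomp Require Import boolp.

Set Implicit Arguments.
Unset Strict Implicit.
Unset Printing Implicit Defensive.

Import GRing.Theory.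
Local Open Scope ring_scope.
Local Open Scope quotient_scope.

(* The library's algType excludes the zero ring, and its hierarchy cannot be *)
(* extended afterwards by algebras over the possibly trivial rings *)
(* (pzRingType).  An algebra over an arbitrary commutative ring k is *)
(* therefore given by its structure map, a unital ring morphism from k to the *)
(* center; scalars act by a . x = inK a * x. *)

HB.mixin Record isKAlg (k : comPzRingType) A of GRing.PzRing A := {
  inK : k -> A;
  inKD : {morph inK : a b / a + b};
  inKM : {morph inK : a b / a * b};
  inK1 : inK 1 = 1;
  inKC : forall a (x : A), inK a * x = x * inK a
}.

#[short(type="kalgType")]
HB.structure Definition KAlg (k : comPzRingType) :=
  {A of GRing.PzRing A & isKAlg k A}.

HB.mixin Record isKMorphism (k : comPzRingType) (A B : kalgType k)
    (f : A -> B) := {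
  kmorphK : forall a : k, f (inK a) = inK a
}.

HB.structure Definition KAlgMorphism (k : comPzRingType) (A B : kalgType k) :=
  {f of @GRing.RMorphism A B f & isKMorphism k A B f}.

Notation "{ 'kalg' A -> B }" := (@KAlgMorphism.type _ A%type B%type)
  (at level 0, A at level 98, B at level 99, format "{ 'kalg'  A  ->  B }")
  : type_scope.

Section PropQuotient.
Variables (T : choiceType) (R : T -> T -> Prop).
Hypotheses (Rr : forall x, R x x) (Rs : forall x y, R x y -> R y x).
Hypothesis (Rt : forall x y z, R x y -> R y z -> R x z).

Definition relb (x y : T) : bool := `[< R x y >].

Lemma relb_equiv : equiv_class_of relb.
Proof.
split.
- by move=> x; apply/asboolP.
- by move=> x y; apply/asboolP/asboolP => /Rs.
- by move=> y x z /asboolP xy /asboolP yz; apply/asboolP; apply: Rt yz.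
Qed.

Definition prop_equiv : equiv_rel T := EquivRelPack relb_equiv.

Lemma prop_quotP x y :
  \pi_({eq_quot prop_equiv}) x = \pi_({eq_quot prop_equiv}) y <-> R x y.
Proof. by split=> [/eqmodP/asboolP|xy] //; apply/eqmodP/asboolP. Qed.

Lemma prop_quot_repr x : R (repr (\pi_({eq_quot prop_equiv}) x)) x.
Proof. by apply/prop_quotP; rewrite reprK. Qed.
End PropQuotient.

(* The congruence below is congruence modulo the two-sided ideal generated by *)
(* the differences x - y with r x y; compatibility with scalars follows from *)
(* the product with inK a. *)
Section AlgebraQuotient.
Variables (k : comPzRingType) (A : kalgType k) (r : A -> A -> Prop).

Inductive cong : A -> A -> Prop :=
| CongBase x y of r x y : cong x y
| CongRefl x : cong x x
| CongSym x y of cong x y : cong y x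
| CongTrans y x z of cong x y & cong y z : cong x z
| CongAdd x x' y y' of cong x x' & cong y y' : cong (x + y) (x' + y')
| CongMul x x' y y' of cong x x' & cong y y' : cong (x * y) (x' * y').

Lemma congT x y z : cong x y -> cong y z -> cong x z.
Proof. exact: CongTrans. Qed.

Definition algquot := {eq_quot (prop_equiv CongRefl CongSym congT)}.
HB.instance Definition _ := Choice.on algquot.
HB.instance Definition _ := EqQuotient.on algquot.

Definition quot (x : A) : algquot := \pi_algquot x.

Lemma algquotP x y : quot x = quot y <-> cong x y.
Proof. exact: prop_quotP. Qed.

Lemma quot_repr x : cong (repr (quot x)) x.
Proof. exact: prop_quot_repr. Qed.

Lemma quot_surj (x : algquot) : quot (repr x) = x.
Proof. exact: reprK. Qed.

Definition aq_add (x y : algquot) := quot (repr x + repr y).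
Definition aq_mul (x y : algquot) := quot (repr x * repr y).
Definition aq_opp (x : algquot) := quot (- repr x).

Lemma aq_addE x y : aq_add (quot x) (quot y) = quot (x + y).
Proof. by apply/algquotP; apply: CongAdd; apply: quot_repr. Qed.

Lemma aq_mulE x y : aq_mul (quot x) (quot y) = quot (x * y).
Proof. by apply/algquotP; apply: CongMul; apply: quot_repr. Qed.

Lemma aq_oppE x : aq_opp (quot x) = quot (- x).
Proof.
apply/algquotP; rewrite -(mulN1r x) -[- repr _]mulN1r; apply: CongMul; first exact: CongRefl.
exact: quot_repr.
Qed.

Lemma aq_ind (P : algquot -> Prop) : (forall x, P (quot x)) -> forall x, P x.
Proof. by move=> PP x; rewrite -(quot_surj x). Qed.

Lemma aq_addA : associative aq_add.
Proof.
by elim/aq_ind=> x; elim/aq_ind=> y; elim/aq_ind=> z; rewrite !aq_addE addrA.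
Qed.
Lemma aq_addC : commutative aq_add.
Proof. by elim/aq_ind=> x; elim/aq_ind=> y; rewrite !aq_addE addrC. Qed.
Lemma aq_add0 : left_id (quot 0) aq_add.
Proof. by elim/aq_ind=> x; rewrite aq_addE add0r. Qed.
Lemma aq_addN : left_inverse (quot 0) aq_opp aq_add.
Proof. by elim/aq_ind=> x; rewrite aq_oppE aq_addE addNr. Qed.
HB.instance Definition _ :=
  GRing.isZmodule.Build algquot aq_addA aq_addC aq_add0 aq_addN.

Lemma aq_plusE x y : quot x + quot y = quot (x + y).
Proof. exact: aq_addE. Qed.

Lemma aq_mulA : associative aq_mul.
Proof.
by elim/aq_ind=> x; elim/aq_ind=> y; elim/aq_ind=> z; rewrite !aq_mulE mulrA.
Qed.
Lemma aq_mul1 : left_id (quot 1) aq_mul.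
Proof. by elim/aq_ind=> x; rewrite aq_mulE mul1r. Qed.
Lemma aq_1mul : right_id (quot 1) aq_mul.
Proof. by elim/aq_ind=> x; rewrite aq_mulE mulr1. Qed.
Lemma aq_mulDl : left_distributive aq_mul +%R.
Proof.
elim/aq_ind=> x; elim/aq_ind=> y; elim/aq_ind=> z.
by rewrite !(aq_mulE, aq_plusE) mulrDl.
Qed.
Lemma aq_mulDr : right_distributive aq_mul +%R.
Proof.
elim/aq_ind=> x; elim/aq_ind=> y; elim/aq_ind=> z.
by rewrite !(aq_mulE, aq_plusE) mulrDr.
Qed.
HB.instance Definition _ := GRing.Zmodule_isPzRing.Build algquot
  aq_mulA aq_mul1 aq_1mul aq_mulDl aq_mulDr.

Definition aq_inK (a : k) : algquot := quot (inK a).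
Lemma aq_inKD : {morph aq_inK : a b / a + b}.
Proof. by move=> a b; rewrite /aq_inK inKD -aq_plusE. Qed.
Lemma aq_inKM : {morph aq_inK : a b / a * b}.
Proof. by move=> a b; rewrite /aq_inK inKM -aq_mulE. Qed.
Lemma aq_inK1 : aq_inK 1 = 1.
Proof. by rewrite /aq_inK inK1. Qed.
Lemma aq_inKC a x : aq_inK a * x = x * aq_inK a.
Proof.
elim/aq_ind: x => x; rewrite /aq_inK; change (aq_mul (quot (inK a)) (quot x) =
  aq_mul (quot x) (quot (inK a))).
by rewrite !aq_mulE inKC.
Qed.
HB.instance Definition _ := isKAlg.Build k algquot
  aq_inKD aq_inKM aq_inK1 aq_inKC.

Lemma quot_zmod : zmod_morphism quot.
Proof.
move=> x y; change (quot (x - y) = aq_add (quot x) (aq_opp (quot y))).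
by rewrite aq_oppE aq_addE.
Qed.
Lemma quot_monoid : monoid_morphism quot.
Proof.
split=> // x y; change (quot (x * y) = aq_mul (quot x) (quot y)).
by rewrite aq_mulE.
Qed.
Lemma quot_inK (a : k) : quot (inK a) = inK a. Proof. by []. Qed.
HB.instance Definition _ := GRing.isZmodMorphism.Build A algquot quot quot_zmod.
HB.instance Definition _ :=
  GRing.isMonoidMorphism.Build A algquot quot quot_monoid.
HB.instance Definition _ := isKMorphism.Build k A algquot quot quot_inK.
End AlgebraQuotient.

(* The free k-algebra on I, as formal expressions modulo the algebra axioms. *)
Section FreeAlgebra.
Variables (k : comPzRingType) (I : Type).

Inductive aexp :=
| AGen of I | AConst of k | AAdd of aexp & aexp | AMul of aexp & aexp.

HB.instance Definition _ := gen_eqMixin aexp.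
HB.instance Definition _ := gen_choiceMixin aexp.

Inductive aeq : aexp -> aexp -> Prop :=
| AeqRefl x : aeq x x
| AeqSym x y of aeq x y : aeq y x
| AeqTrans y x z of aeq x y & aeq y z : aeq x z
| AeqAdd x x' y y' of aeq x x' & aeq y y' : aeq (AAdd x y) (AAdd x' y')
| AeqMul x x' y y' of aeq x x' & aeq y y' : aeq (AMul x y) (AMul x' y')
| AeqAddA x y z : aeq (AAdd x (AAdd y z)) (AAdd (AAdd x y) z)
| AeqAddC x y : aeq (AAdd x y) (AAdd y x)
| AeqAdd0 x : aeq (AAdd (AConst 0) x) x
| AeqAddN x : aeq (AAdd (AMul (AConst (-1)) x) x) (AConst 0)
| AeqMulA x y z : aeq (AMul x (AMul y z)) (AMul (AMul x y) z)
| AeqMul1 x : aeq (AMul (AConst 1) x) x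
| AeqMulDl x y z : aeq (AMul (AAdd x y) z) (AAdd (AMul x z) (AMul y z))
| AeqMulDr x y z : aeq (AMul x (AAdd y z)) (AAdd (AMul x y) (AMul x z))
| AeqConstD a b : aeq (AConst (a + b)) (AAdd (AConst a) (AConst b))
| AeqConstM a b : aeq (AConst (a * b)) (AMul (AConst a) (AConst b))
| AeqConstC a x : aeq (AMul (AConst a) x) (AMul x (AConst a)).

Lemma aeqT x y z : aeq x y -> aeq y z -> aeq x z.
Proof. exact: AeqTrans. Qed.

Definition freealg := {eq_quot (prop_equiv AeqRefl AeqSym aeqT)}.
HB.instance Definition _ := Choice.on freealg.
HB.instance Definition _ := EqQuotient.on freealg.

Definition facls (x : aexp) : freealg := \pi_freealg x.
Definition fgen (i : I) : freealg := facls (AGen i).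

Lemma faclsP x y : facls x = facls y <-> aeq x y.
Proof. exact: prop_quotP. Qed.
Lemma facls_repr x : aeq (repr (facls x)) x.
Proof. exact: prop_quot_repr. Qed.
Lemma facls_surj (x : freealg) : facls (repr x) = x.
Proof. exact: reprK. Qed.
Lemma fa_ind (P : freealg -> Prop) : (forall x, P (facls x)) -> forall x, P x.
Proof. by move=> PP x; rewrite -(facls_surj x). Qed.

Definition fa_add (x y : freealg) := facls (AAdd (repr x) (repr y)).
Definition fa_mul (x y : freealg) := facls (AMul (repr x) (repr y)).
Definition fa_inK (a : k) : freealg := facls (AConst a).
Definition fa_opp (x : freealg) := fa_mul (fa_inK (-1)) x.

Lemma fa_addE x y : fa_add (facls x) (facls y) = facls (AAdd x y).
Proof. by apply/faclsP; apply: AeqAdd; apply: facls_repr. Qed.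
Lemma fa_mulE x y : fa_mul (facls x) (facls y) = facls (AMul x y).
Proof. by apply/faclsP; apply: AeqMul; apply: facls_repr. Qed.

Lemma fa_addA : associative fa_add.
Proof.
elim/fa_ind=> x; elim/fa_ind=> y; elim/fa_ind=> z.
by rewrite !fa_addE; apply/faclsP/AeqAddA.
Qed.
Lemma fa_addC : commutative fa_add.
Proof.
by elim/fa_ind=> x; elim/fa_ind=> y; rewrite !fa_addE; apply/faclsP/AeqAddC.
Qed.
Lemma fa_add0 : left_id (fa_inK 0) fa_add.
Proof. by elim/fa_ind=> x; rewrite !fa_addE; apply/faclsP/AeqAdd0. Qed.
Lemma fa_addN : left_inverse (fa_inK 0) fa_opp fa_add.
Proof.
by elim/fa_ind=> x; rewrite /fa_opp fa_mulE fa_addE; apply/faclsP/AeqAddN.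
Qed.
HB.instance Definition _ :=
  GRing.isZmodule.Build freealg fa_addA fa_addC fa_add0 fa_addN.

Lemma fa_plusE x y : facls x + facls y = facls (AAdd x y).
Proof. exact: fa_addE. Qed.

Lemma fa_mulA : associative fa_mul.
Proof.
elim/fa_ind=> x; elim/fa_ind=> y; elim/fa_ind=> z.
by rewrite !fa_mulE; apply/faclsP/AeqMulA.
Qed.
Lemma fa_inKC a x : fa_mul (fa_inK a) x = fa_mul x (fa_inK a).
Proof. by elim/fa_ind: x => x; rewrite !fa_mulE; apply/faclsP/AeqConstC. Qed.
Lemma fa_mul1 : left_id (fa_inK 1) fa_mul.
Proof. by elim/fa_ind=> x; rewrite !fa_mulE; apply/faclsP/AeqMul1. Qed.
Lemma fa_1mul : right_id (fa_inK 1) fa_mul.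
Proof. by move=> x; rewrite -fa_inKC fa_mul1. Qed.
Lemma fa_mulDl : left_distributive fa_mul +%R.
Proof.
elim/fa_ind=> x; elim/fa_ind=> y; elim/fa_ind=> z.
by rewrite !(fa_mulE, fa_plusE); apply/faclsP/AeqMulDl.
Qed.
Lemma fa_mulDr : right_distributive fa_mul +%R.
Proof.
elim/fa_ind=> x; elim/fa_ind=> y; elim/fa_ind=> z.
by rewrite !(fa_mulE, fa_plusE); apply/faclsP/AeqMulDr.
Qed.
HB.instance Definition _ := GRing.Zmodule_isPzRing.Build freealg
  fa_mulA fa_mul1 fa_1mul fa_mulDl fa_mulDr.

Lemma fa_inKD : {morph fa_inK : a b / a + b}.
Proof.
move=> a b; rewrite fa_plusE; apply/faclsP; exact: AeqConstD.
Qed.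
Lemma fa_inKM : {morph fa_inK : a b / a * b}.
Proof.
move=> a b; change (fa_inK (a * b) = fa_mul (fa_inK a) (fa_inK b)).
rewrite fa_mulE; apply/faclsP; exact: AeqConstM.
Qed.
HB.instance Definition _ := isKAlg.Build k freealg
  fa_inKD fa_inKM erefl fa_inKC.
End FreeAlgebra.

Section Center.
Variables (k : comPzRingType) (A : kalgType k).

Definition central : {pred A} := fun x => `[< forall y, x * y = y * x >].

Lemma centralP x : reflect (forall y, x * y = y * x) (x \in central).
Proof. exact: asboolP. Qed.

Record alg_center := AlgCenter { center_val : A; _ : center_val \in central }.
HB.instance Definition _ := [isSub for center_val].
HB.instance Definition _ := [Choice of alg_center by <:].

Lemma central_subring : subring_closed central.
Proof.
split=> [|x y /centralP xc /centralP yc|x y /centralP xc /centralP yc];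
  apply/centralP => z.
- by rewrite mul1r mulr1.
- by rewrite mulrBl mulrBr xc yc.
- by rewrite -mulrA yc mulrA xc mulrA.
Qed.
HB.instance Definition _ := GRing.SubChoice_isSubPzRing.Build A central alg_center
  central_subring.

Lemma inK_central (a : k) : (inK a : A) \in central.
Proof. by apply/centralP => x; rewrite inKC. Qed.

Definition ct_inK (a : k) : alg_center := AlgCenter (inK_central a).
Lemma ct_inKD : {morph ct_inK : a b / a + b}.
Proof. by move=> a b; apply: val_inj; rewrite /= inKD. Qed.
Lemma ct_inKM : {morph ct_inK : a b / a * b}.
Proof. by move=> a b; apply: val_inj; rewrite /= inKM. Qed.
Lemma ct_inK1 : ct_inK 1 = 1.
Proof. by apply: val_inj; rewrite /= inK1. Qed.
Lemma ct_inKC a x : ct_inK a * x = x * ct_inK a.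
Proof. by apply: val_inj; rewrite /= inKC. Qed.
HB.instance Definition _ := isKAlg.Build k alg_center ct_inKD ct_inKM ct_inK1 ct_inKC.
End Center.

Definition induced_on_centers (k : comPzRingType) (A B : kalgType k)
    (f : A -> B) (f' : alg_center A -> alg_center B) : Prop :=
  forall z, val (f' z) = f (val z).

(* k acts on A-linear endomorphisms through the center of A. *)
Section EndAlgebra.
Variables (k : comPzRingType) (A : kalgType k) (M : lmodType A).

Definition endalg := {linear M -> M}.
HB.instance Definition _ := gen_eqMixin endalg.
HB.instance Definition _ := gen_choiceMixin endalg.

Definition endfun (f : endalg) (m : M) : M := (f : {linear M -> M}) m.

Lemma endP (f g : endalg) : (forall m, endfun f m = endfun g m) -> f = g.
Proof.
rewrite /endfun; case: f g => [f [[cf] [df]]] [g [[cg] [dg]]] /= /funext efg.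
subst g; congr (GRing.Linear.Pack (GRing.Linear.Class _ _)).
  by congr GRing.isNmodMorphism.Axioms_; case: cf cg => [? ?] [? ?];
    congr pair; exact: Prop_irrelevance.
by congr GRing.isScalable.Axioms_; exact: Prop_irrelevance.
Qed.
End EndAlgebra.

Section EndAlgebraOps.
Variables (k : comPzRingType) (A : kalgType k) (M : lmodType A).
Local Notation E := (endalg M).
Implicit Types f g h : E.

Definition en_add f g : E := (f \+ g : {linear M -> M}).
Definition en_opp f : E := (\- f : {linear M -> M}).
Definition en_zero : E := (\0 : {linear M -> M}).
Definition en_one : E := (idfun : {linear M -> M}).
Definition en_mul f g : E := (f \o g : {linear M -> M}).

Definition homothety (a : k) (m : M) : M := (inK a : A) *: m.
Lemma homothety_linear a : linear (homothety a).
Proof. by move=> b u v; rewrite /homothety scalerDr !scalerA inKC. Qed.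
HB.instance Definition _ a :=
  GRing.isLinear.Build A M M *:%R (homothety a) (homothety_linear a).
Definition en_inK (a : k) : E := (homothety a : {linear M -> M}).

Lemma en_addA : associative en_add.
Proof. by move=> f g h; apply: endP => m; apply: addrA. Qed.
Lemma en_addC : commutative en_add.
Proof. by move=> f g; apply: endP => m; apply: addrC. Qed.
Lemma en_add0 : left_id en_zero en_add.
Proof. by move=> f; apply: endP => m; apply: add0r. Qed.
Lemma en_addN : left_inverse en_zero en_opp en_add.
Proof. by move=> f; apply: endP => m; apply: addNr. Qed.
HB.instance Definition _ := GRing.isZmodule.Build E
  en_addA en_addC en_add0 en_addN.

Lemma en_mulA : associative en_mul.
Proof. by move=> f g h; apply: endP. Qed.
Lemma en_mul1 : left_id en_one en_mul.
Proof. by move=> f; apply: endP. Qed.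
Lemma en_1mul : right_id en_one en_mul.
Proof. by move=> f; apply: endP. Qed.
Lemma en_mulDl : left_distributive en_mul +%R.
Proof. by move=> f g h; apply: endP. Qed.
Lemma en_mulDr : right_distributive en_mul +%R.
Proof. by move=> f g h; apply: endP => m; apply: raddfD. Qed.
HB.instance Definition _ := GRing.Zmodule_isPzRing.Build E
  en_mulA en_mul1 en_1mul en_mulDl en_mulDr.

Lemma en_inKD : {morph en_inK : a b / a + b}.
Proof.
by move=> a b; apply: endP => m; rewrite /endfun /= /homothety inKD scalerDl.
Qed.
Lemma en_inKM : {morph en_inK : a b / a * b}.
Proof.
by move=> a b; apply: endP => m; rewrite /endfun /= /homothety inKM scalerA.
Qed.
Lemma en_inK1 : en_inK 1 = 1.
Proof.
by apply: endP => m; rewrite /endfun /= /homothety inK1 scale1r.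
Qed.
Lemma en_inKC a f : en_inK a * f = f * en_inK a.
Proof. by apply: endP => m; apply: esym; apply: linearZ. Qed.
HB.instance Definition _ := isKAlg.Build k E en_inKD en_inKM en_inK1 en_inKC.
End EndAlgebraOps.

(* Not imported earlier, as the repr of fingroup hides that of quotient types. *)
From mathcomp Require Import all_fingroup.

Section GSets.
Variable gT : finGroupType.
Implicit Types g h : gT.

(* Finite left G-sets, for G the whole group gT. *)
Record gset := GSet {
  gset_sort :> finType;
  gsact : gT -> gset_sort -> gset_sort;
  gsact1 : forall x, gsact 1%g x = x;
  gsactM : forall g h x, gsact (g * h)%g x = gsact g (gsact h x)
}.

Lemma gsactK (X : gset) g : cancel (@gsact X g) (@gsact X g^-1%g).
Proof. by move=> x; rewrite -gsactM mulVg gsact1. Qed.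
Lemma gsactKV (X : gset) g : cancel (@gsact X g^-1%g) (@gsact X g).
Proof. by move=> x; rewrite -gsactM mulgV gsact1. Qed.

Definition conjL g x := (g * x * g^-1)%g.
Lemma conjL1 x : conjL 1 x = x.
Proof. by rewrite /conjL mul1g invg1 mulg1. Qed.
Lemma conjLM g h x : conjL (g * h) x = conjL g (conjL h x).
Proof. by rewrite /conjL invMg !mulgA. Qed.
Definition conj_gset := GSet conjL1 conjLM.

Definition point_gset := @GSet unit (fun _ x => x) (fun _ => erefl)
  (fun _ _ _ => erefl).

Section Pairs.
Variables X Y : gset.
Definition pact g (p : X * Y) := (gsact g p.1, gsact g p.2).
Lemma pact1 p : pact 1 p = p.
Proof. by case: p => x y; rewrite /pact !gsact1. Qed.
Lemma pactM g h p : pact (g * h) p = pact g (pact h p).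
Proof. by rewrite /pact !gsactM. Qed.
Definition prod_gset := GSet pact1 pactM.

Definition uact g (p : X + Y) : X + Y :=
  match p with inl x => inl (gsact g x) | inr y => inr (gsact g y) end.
Lemma uact1 p : uact 1 p = p.
Proof. by case: p => x; rewrite /uact !gsact1. Qed.
Lemma uactM g h p : uact (g * h) p = uact g (uact h p).
Proof. by case: p => x; rewrite /uact !gsactM. Qed.
Definition sum_gset := GSet uact1 uactM.
End Pairs.

Section SubGSet.
Variables (X : gset) (P : pred X).
Hypothesis PJ : forall g x, P x -> P (gsact g x).
Definition sub_act g (u : {x | P x}) : {x | P x} :=
  exist _ (gsact g (val u)) (PJ g (valP u)).
Lemma sub_act1 u : sub_act 1 u = u.
Proof. by apply: val_inj; rewrite /= gsact1. Qed.
Lemma sub_actM g h u : sub_act (g * h) u = sub_act g (sub_act h u).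
Proof. by apply: val_inj; rewrite /= gsactM. Qed.
Definition sub_gset := GSet sub_act1 sub_actM.
End SubGSet.

Section Cosets.
Variable L : {group gT}.
Definition coset_type := {C : {set gT} | C \in lcosets L [set: gT]}.

Lemma lcoset_in x : (x *: L)%g \in lcosets L [set: gT].
Proof. by apply/lcosetsP; exists x; rewrite ?inE. Qed.
Definition coset_pt x : coset_type := exist _ (x *: L)%g (lcoset_in x).

Lemma coset_act_in g (C : coset_type) : (g *: val C)%g \in lcosets L [set: gT].
Proof.
case: C => C /= /lcosetsP[x _ ->]; rewrite -lcosetM; exact: lcoset_in.
Qed.
Definition coset_act g (C : coset_type) : coset_type :=
  exist _ (g *: val C)%g (coset_act_in g C).
Lemma coset_act1 C : coset_act 1 C = C.
Proof. by apply: val_inj; rewrite /= lcoset1. Qed.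
Lemma coset_actM g h C : coset_act (g * h) C = coset_act g (coset_act h C).
Proof. by apply: val_inj; rewrite /= lcosetM. Qed.
Definition coset_gset := GSet coset_act1 coset_actM.

Lemma coset_ptP (C : coset_type) : exists x, C = coset_pt x.
Proof.
by case: (lcosetsP (valP C)) => x _ Cx; exists x; apply: val_inj.
Qed.
Lemma coset_repr (C : coset_type) : val C = (repr (val C) *: L)%g.
Proof.
case: (coset_ptP C) => x ->; rewrite /=.
have: repr (x *: L)%g \in (x *: L)%g by apply: (mem_repr x); rewrite lcoset_refl.
by move/lcoset_eqP.
Qed.
Lemma coset_act_pt g x : coset_act g (coset_pt x) = coset_pt (g * x)%g.
Proof. by apply: val_inj; rewrite /= lcosetM. Qed.
End Cosets.

(* Omega_G, the disjoint union of the G-sets G/H over the subgroups H. *)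
Definition omega_type := {H : {group gT} & coset_gset H}.
Definition om_act g (w : omega_type) : omega_type :=
  Tagged (fun H => coset_gset H : Type) (gsact g (tagged w)).
Lemma om_act1 w : om_act 1 w = w.
Proof. by case: w => H C; rewrite /om_act /= coset_act1. Qed.
Lemma om_actM g h w : om_act (g * h) w = om_act g (om_act h w).
Proof. by case: w => H C; rewrite /om_act /= coset_actM. Qed.
Definition omega := GSet om_act1 om_actM.

(* The element xH of the component G/H. *)
Definition om (H : {group gT}) (x : gT) : omega :=
  Tagged (fun H => coset_gset H : Type) (coset_pt H x).

Lemma om_actE g H x : gsact g (om H x) = om H (g * x)%g.
Proof. by rewrite /om /= /om_act /= coset_act_pt. Qed.

(* Finite G-sets over a G-set S. *)
Record gset_over (S : gset) := GSetOver {
  over_src :> gset;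
  omap : over_src -> S;
  omapJ : forall g x, omap (gsact g x) = gsact g (omap x)
}.

Definition over_iso (S : gset) (X Y : gset_over S) : Prop :=
  exists f : X -> Y, [/\ bijective f,
    forall g x, f (gsact g x) = gsact g (f x) & forall x, omap (f x) = omap x].

Section OverIso.
Variable S : gset.
Implicit Types X Y Z : gset_over S.

Lemma over_iso_refl X : over_iso X X.
Proof. by exists id; split=> //; exists id. Qed.
Lemma over_iso_sym X Y : over_iso X Y -> over_iso Y X.
Proof.
case=> f [[f' fK f'K] fJ fo]; exists f'; split; first by exists f.
- by move=> g x; apply: (can_inj fK); rewrite fJ !f'K.
- by move=> x; rewrite -fo f'K.
Qed.
Lemma over_iso_trans Y X Z : over_iso X Y -> over_iso Y Z -> over_iso X Z.
Proof.
case=> f [fb fJ fo] [f' [f'b f'J f'o]]; exists (f' \o f); split.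
- exact: bij_comp.
- by move=> g x; rewrite /= fJ f'J.
- by move=> x; rewrite /= f'o fo.
Qed.

Section Sum.
Variables X Y : gset_over S.
Definition sum_map (p : sum_gset X Y) : S :=
  match p with inl x => omap x | inr y => omap y end.
Lemma sum_mapJ g p : sum_map (gsact g p) = gsact g (sum_map p).
Proof. by case: p => x /=; rewrite omapJ. Qed.
Definition sum_over := GSetOver sum_mapJ.
End Sum.

Lemma sum_over_iso X X' Y Y' :
  over_iso X X' -> over_iso Y Y' -> over_iso (sum_over X Y) (sum_over X' Y').
Proof.
case=> f [[f1 fK f1K] fJ fo] [h [[h1 hK h1K] hJ ho]].
exists (fun p : X + Y => match p with inl x => inl (f x) | inr y => inr (h y) end).
split.
- exists (fun p : X' + Y' =>
    match p with inl x => inl (f1 x) | inr y => inr (h1 y) end).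
  + by case=> x; rewrite ?fK ?hK.
  + by case=> x; rewrite ?f1K ?h1K.
- by move=> g [x|y] /=; rewrite ?fJ ?hJ.
- by case=> x /=; rewrite ?fo ?ho.
Qed.

(* Finite G-sets over S form too large a type to generate a group.  Each has a *)
(* copy whose points are the elements of some 'I_n (to_small below), and these *)
(* copies form a small type. *)
Record small_over := SmallOver {
  small_card : nat;
  small_act : gT -> 'I_small_card -> 'I_small_card;
  small_map : 'I_small_card -> S;
  small_act1 : forall x, small_act 1%g x = x;
  small_actM : forall g h x,
    small_act (g * h)%g x = small_act g (small_act h x);
  small_mapJ : forall g x, small_map (small_act g x) = gsact g (small_map x)
}.

Definition small_gset (X : small_over) : gset :=
  GSet (@small_act1 X) (@small_actM X).
Definition of_small (X : small_over) : gset_over S :=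
  @GSetOver S (small_gset X) (@small_map X) (@small_mapJ X).

Section ToSmall.
Variable X : gset_over S.
Definition ts_act g (i : 'I_#|X|) := enum_rank (gsact g (enum_val i)).
Definition ts_map (i : 'I_#|X|) : S := omap (enum_val i).
Lemma ts_act1 x : ts_act 1 x = x.
Proof. by rewrite /ts_act gsact1 enum_valK. Qed.
Lemma ts_actM g h x : ts_act (g * h) x = ts_act g (ts_act h x).
Proof. by rewrite /ts_act enum_rankK gsactM. Qed.
Lemma ts_mapJ g x : ts_map (ts_act g x) = gsact g (ts_map x).
Proof. by rewrite /ts_map enum_rankK omapJ. Qed.
Definition to_small : small_over := SmallOver ts_act1 ts_actM ts_mapJ.

Lemma to_small_iso : over_iso (of_small to_small) X.
Proof.
exists (fun i : 'I_#|X| => enum_val i : X); split=> //.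
- by exists (fun x : X => enum_rank x) => x; rewrite ?enum_valK ?enum_rankK.
- by move=> g x; rewrite /= /ts_act enum_rankK.
Qed.
End ToSmall.
End OverIso.
End GSets.

(* k tensored with the Grothendieck group (for disjoint union) of finite *)
(* G-sets over S: the k-module generated by the G-sets over S, modulo *)
(* [X] = [Y] for isomorphic X and Y, and [X + Y] = [X] + [Y]. *)
Section Grothendieck.
Variables (gT : finGroupType) (k : comPzRingType) (S : gset gT).

Inductive lexp :=
| LGen of small_over S | LZero | LAdd of lexp & lexp | LScale of k & lexp.

HB.instance Definition _ := gen_eqMixin lexp.
HB.instance Definition _ := gen_choiceMixin lexp.

Inductive leq_exp : lexp -> lexp -> Prop :=
| LeqIso X Y of over_iso (of_small X) (of_small Y) : leq_exp (LGen X) (LGen Y)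
| LeqSum X Y : leq_exp (LGen (to_small (sum_over (of_small X) (of_small Y))))
    (LAdd (LGen X) (LGen Y))
| LeqRefl x : leq_exp x x
| LeqSym x y of leq_exp x y : leq_exp y x
| LeqTrans y x z of leq_exp x y & leq_exp y z : leq_exp x z
| LeqAdd x x' y y' of leq_exp x x' & leq_exp y y' :
    leq_exp (LAdd x y) (LAdd x' y')
| LeqScale a x y of leq_exp x y : leq_exp (LScale a x) (LScale a y)
| LeqAddA x y z : leq_exp (LAdd x (LAdd y z)) (LAdd (LAdd x y) z)
| LeqAddC x y : leq_exp (LAdd x y) (LAdd y x)
| LeqAdd0 x : leq_exp (LAdd LZero x) x
| LeqScale0 x : leq_exp (LScale 0 x) LZero
| LeqScale1 x : leq_exp (LScale 1 x) x
| LeqScaleA a b x : leq_exp (LScale a (LScale b x)) (LScale (a * b) x)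
| LeqScaleDr a x y : leq_exp (LScale a (LAdd x y)) (LAdd (LScale a x) (LScale a y))
| LeqScaleDl a b x : leq_exp (LScale (a + b) x) (LAdd (LScale a x) (LScale b x)).

Lemma leq_expT x y z : leq_exp x y -> leq_exp y z -> leq_exp x z.
Proof. exact: LeqTrans. Qed.

Definition groth := {eq_quot (prop_equiv LeqRefl LeqSym leq_expT)}.
HB.instance Definition _ := Choice.on groth.
HB.instance Definition _ := EqQuotient.on groth.

Definition lcls (x : lexp) : groth := \pi_groth x.
Lemma lclsP x y : lcls x = lcls y <-> leq_exp x y.
Proof. exact: prop_quotP. Qed.
Lemma lcls_repr x : leq_exp (generic_quotient.repr (lcls x)) x.
Proof. exact: prop_quot_repr. Qed.
Lemma lcls_surj (x : groth) : lcls (generic_quotient.repr x) = x.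
Proof. exact: reprK. Qed.
Lemma gr_ind (P : groth -> Prop) : (forall x, P (lcls x)) -> forall x, P x.
Proof. by move=> PP x; rewrite -(lcls_surj x). Qed.

Definition gr_add (x y : groth) :=
  lcls (LAdd (generic_quotient.repr x) (generic_quotient.repr y)).
Definition gr_scale (a : k) (x : groth) :=
  lcls (LScale a (generic_quotient.repr x)).
Definition gr_zero := lcls LZero.
Definition gr_opp := gr_scale (-1).

Lemma gr_addE x y : gr_add (lcls x) (lcls y) = lcls (LAdd x y).
Proof. by apply/lclsP; apply: LeqAdd; apply: lcls_repr. Qed.
Lemma gr_scaleE a x : gr_scale a (lcls x) = lcls (LScale a x).
Proof. by apply/lclsP; apply: LeqScale; apply: lcls_repr. Qed.

Lemma gr_addA : associative gr_add.
Proof.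
elim/gr_ind=> x; elim/gr_ind=> y; elim/gr_ind=> z.
by rewrite !gr_addE; apply/lclsP/LeqAddA.
Qed.
Lemma gr_addC : commutative gr_add.
Proof.
by elim/gr_ind=> x; elim/gr_ind=> y; rewrite !gr_addE; apply/lclsP/LeqAddC.
Qed.
Lemma gr_add0 : left_id gr_zero gr_add.
Proof. by elim/gr_ind=> x; rewrite !gr_addE; apply/lclsP/LeqAdd0. Qed.
Lemma gr_scaleDl x : {morph gr_scale^~ x : a b / a + b >-> gr_add a b}.
Proof.
move=> a b; elim/gr_ind: x => x.
by rewrite !gr_scaleE gr_addE; apply/lclsP/LeqScaleDl.
Qed.
Lemma gr_scale1 : left_id 1 gr_scale.
Proof. by elim/gr_ind=> x; rewrite gr_scaleE; apply/lclsP/LeqScale1. Qed.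
Lemma gr_addN : left_inverse gr_zero gr_opp gr_add.
Proof.
move=> x; rewrite -{2}(gr_scale1 x) -gr_scaleDl addNr.
by elim/gr_ind: x => x; rewrite gr_scaleE; apply/lclsP/LeqScale0.
Qed.
HB.instance Definition _ :=
  GRing.isZmodule.Build groth gr_addA gr_addC gr_add0 gr_addN.

Lemma gr_plusE x y : lcls x + lcls y = lcls (LAdd x y).
Proof. exact: gr_addE. Qed.

Lemma gr_scaleA a b x : gr_scale a (gr_scale b x) = gr_scale (a * b) x.
Proof.
by elim/gr_ind: x => x; rewrite !gr_scaleE; apply/lclsP/LeqScaleA.
Qed.
Lemma gr_scaleDr : right_distributive gr_scale +%R.
Proof.
move=> a; elim/gr_ind=> x; elim/gr_ind=> y.
by rewrite !(gr_plusE, gr_scaleE); apply/lclsP/LeqScaleDr.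
Qed.
HB.instance Definition _ := GRing.Zmodule_isLmodule.Build k groth
  gr_scaleA gr_scale1 gr_scaleDr gr_scaleDl.

Definition gcls (X : gset_over S) : groth := lcls (LGen (to_small X)).

Lemma gcls_iso X Y : over_iso X Y -> gcls X = gcls Y.
Proof.
move=> XY; apply/lclsP/LeqIso; apply: over_iso_trans (to_small_iso X) _.
by apply: over_iso_trans XY _; apply/over_iso_sym/to_small_iso.
Qed.
Lemma gcls_small X : gcls (of_small X) = lcls (LGen X).
Proof. exact/lclsP/LeqIso/to_small_iso. Qed.
Lemma gcls_sum X Y : gcls (sum_over X Y) = gcls X + gcls Y.
Proof.
rewrite /gcls gr_plusE; have /lclsP <- := LeqSum (to_small X) (to_small Y).
by apply/gcls_iso; apply: sum_over_iso; apply/over_iso_sym/to_small_iso.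
Qed.

Lemma groth_ind (P : groth -> Prop) :
    (forall X, P (gcls X)) -> P 0 -> (forall x y, P x -> P y -> P (x + y)) ->
    (forall a x, P x -> P (a *: x)) -> forall x, P x.
Proof.
move=> Pg P0 PD PZ; elim/gr_ind; elim=> [X||x Px y Py|a x Px].
- by rewrite -gcls_small.
- exact: P0.
- by rewrite -gr_plusE; apply: PD.
- by rewrite -gr_scaleE; apply: PZ.
Qed.

(* Maps on G-sets over S that are invariant and additive extend k-linearly; *)
(* glift is only meaningful for those. *)
Section Lift.
Variables (V : lmodType k) (F : gset_over S -> V).

Fixpoint leval (x : lexp) : V :=
  match x with
  | LGen X => F (of_small X)
  | LZero => 0
  | LAdd y z => leval y + leval z
  | LScale a y => a *: leval y
  end.
Definition glift (x : groth) : V := leval (generic_quotient.repr x).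

Hypothesis F_iso : forall X Y, over_iso X Y -> F X = F Y.
Hypothesis F_sum : forall X Y, F (sum_over X Y) = F X + F Y.

Lemma leval_eq x y : leq_exp x y -> leval x = leval y.
Proof.
elim=> {x y} //=.
- by move=> X Y; apply: F_iso.
- by move=> X Y; rewrite -F_sum; apply/F_iso/to_small_iso.
- by move=> y x z _ -> _.
- by move=> x x' y y' _ -> _ ->.
- by move=> a x y _ ->.
- by move=> x y z; rewrite addrA.
- by move=> x y; rewrite addrC.
- by move=> x; rewrite add0r.
- by move=> x; rewrite scale0r.
- by move=> x; rewrite scale1r.
- by move=> a b x; rewrite scalerA.
- by move=> a x y; rewrite scalerDr.
- by move=> a b x; rewrite scalerDl.
Qed.

Lemma glift_lcls x : glift (lcls x) = leval x.
Proof. exact/leval_eq/lcls_repr. Qed.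
Lemma glift_gcls X : glift (gcls X) = F X.
Proof. by rewrite glift_lcls; apply/F_iso/to_small_iso. Qed.
Lemma glift0 : glift 0 = 0.
Proof. exact: glift_lcls. Qed.
Lemma gliftD x y : glift (x + y) = glift x + glift y.
Proof.
by elim/gr_ind: x => x; elim/gr_ind: y => y; rewrite gr_plusE !glift_lcls.
Qed.
Lemma gliftZ a x : glift (a *: x) = a *: glift x.
Proof.
elim/gr_ind: x => x; change (glift (gr_scale a (lcls x)) = a *: glift (lcls x)).
by rewrite gr_scaleE !glift_lcls.
Qed.
End Lift.

(* A product of G-sets over S, associative, unital and distributive over *)
(* disjoint unions up to isomorphism. *)
Record over_product := OverProduct {
  oprod : gset_over S -> gset_over S -> gset_over S;
  oone : gset_over S;
  oprod_iso : forall X X' Y Y', over_iso X X' -> over_iso Y Y' ->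
    over_iso (oprod X Y) (oprod X' Y');
  oprodA : forall X Y Z,
    over_iso (oprod X (oprod Y Z)) (oprod (oprod X Y) Z);
  oprod1l : forall X, over_iso (oprod oone X) X;
  oprod1r : forall X, over_iso (oprod X oone) X;
  oprodDl : forall X Y Z,
    over_iso (oprod (sum_over X Y) Z) (sum_over (oprod X Z) (oprod Y Z));
  oprodDr : forall X Y Z,
    over_iso (oprod X (sum_over Y Z)) (sum_over (oprod X Y) (oprod X Z))
}.

Section Ring.
Variable M : over_product.

(* The k-algebra structure extending the product M k-bilinearly. *)
Definition groth_alg (_ : over_product) : Type := groth.
Local Notation GA := (groth_alg M).
HB.instance Definition _ := GRing.Zmodule.on GA.

Definition ga_mulr (X : gset_over S) (y : groth) : groth :=
  glift (fun Y => gcls (oprod M X Y)) y.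
Definition ga_mul (x y : GA) : GA := glift (fun X => ga_mulr X y) x.

Lemma mulr_iso X Y Y' : over_iso Y Y' ->
  gcls (oprod M X Y) = gcls (oprod M X Y').
Proof.
by move=> YY'; apply/gcls_iso/oprod_iso => //; apply: over_iso_refl.
Qed.
Lemma mulr_sum X Y Y' :
  gcls (oprod M X (sum_over Y Y')) = gcls (oprod M X Y) + gcls (oprod M X Y').
Proof. by rewrite -gcls_sum; apply/gcls_iso/oprodDr. Qed.

Lemma ga_mulrg X Y : ga_mulr X (gcls Y) = gcls (oprod M X Y).
Proof. exact: (glift_gcls (@mulr_iso X) (@mulr_sum X)). Qed.
Lemma ga_mulr0 X : ga_mulr X 0 = 0.
Proof. exact: (glift0 (@mulr_iso X) (@mulr_sum X)). Qed.
Lemma ga_mulrD X y z : ga_mulr X (y + z) = ga_mulr X y + ga_mulr X z.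
Proof. exact: (gliftD (@mulr_iso X) (@mulr_sum X)). Qed.
Lemma ga_mulrZ X a y : ga_mulr X (a *: y) = a *: ga_mulr X y.
Proof. exact: (gliftZ (@mulr_iso X) (@mulr_sum X)). Qed.

Lemma mull_iso y X X' : over_iso X X' -> ga_mulr X y = ga_mulr X' y.
Proof.
move=> XX'; elim/groth_ind: y => [Y||y z Hy Hz|a y Hy].
- by rewrite !ga_mulrg; apply/gcls_iso/oprod_iso => //; apply: over_iso_refl.
- by rewrite !ga_mulr0.
- by rewrite !ga_mulrD Hy Hz.
- by rewrite !ga_mulrZ Hy.
Qed.
Lemma mull_sum y X X' : ga_mulr (sum_over X X') y = ga_mulr X y + ga_mulr X' y.
Proof.
elim/groth_ind: y => [Y||y z Hy Hz|a y Hy].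
- by rewrite !ga_mulrg -gcls_sum; apply/gcls_iso/oprodDl.
- by rewrite !ga_mulr0 addr0.
- by rewrite !ga_mulrD Hy Hz addrACA.
- by rewrite !ga_mulrZ Hy scalerDr.
Qed.

Lemma ga_mulgr X y : ga_mul (gcls X) y = ga_mulr X y.
Proof. exact: (glift_gcls (@mull_iso y) (@mull_sum y)). Qed.
Lemma ga_mulgg X Y : ga_mul (gcls X) (gcls Y) = gcls (oprod M X Y).
Proof. by rewrite ga_mulgr ga_mulrg. Qed.
Lemma ga_mul0l y : ga_mul (0 : groth) y = 0.
Proof. exact: (glift0 (@mull_iso y) (@mull_sum y)). Qed.
Lemma ga_mulDl (x y z : groth) : ga_mul (x + y) z = ga_mul x z + ga_mul y z.
Proof. exact: (gliftD (@mull_iso z) (@mull_sum z)). Qed.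
Lemma ga_mulZl a (x z : groth) : ga_mul (a *: x) z = a *: (ga_mul x z : groth).
Proof. exact: (gliftZ (@mull_iso z) (@mull_sum z)). Qed.
Lemma ga_mulDr (x y z : groth) : ga_mul x (y + z) = ga_mul x y + ga_mul x z.
Proof.
elim/groth_ind: x => [X||x x' Hx Hx'|a x Hx].
- by rewrite !ga_mulgr ga_mulrD.
- by rewrite !ga_mul0l addr0.
- by rewrite !ga_mulDl Hx Hx' addrACA.
- by rewrite !ga_mulZl Hx scalerDr.
Qed.
Lemma ga_mul0r (x : groth) : ga_mul x (0 : groth) = 0.
Proof. by apply: (addrI (ga_mul x 0)); rewrite -ga_mulDr !addr0. Qed.
Lemma ga_mulZr a (x y : groth) : ga_mul x (a *: y) = a *: (ga_mul x y : groth).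
Proof.
elim/groth_ind: x => [X||x x' Hx Hx'|b x Hx].
- by rewrite !ga_mulgr ga_mulrZ.
- by rewrite !ga_mul0l scaler0.
- by rewrite !ga_mulDl Hx Hx' scalerDr.
- by rewrite !ga_mulZl Hx !scalerA mulrC.
Qed.

Lemma ga_mulA : associative ga_mul.
Proof.
elim/groth_ind=> [X||x x' Hx Hx'|a x Hx] y z.
- elim/groth_ind: y => [Y||y y' Hy Hy'|a y Hy].
  + elim/groth_ind: z => [Z||z z' Hz Hz'|a z Hz].
    * by rewrite !ga_mulgg; apply/gcls_iso/oprodA.
    * by rewrite !ga_mul0r.
    * by rewrite !ga_mulDr Hz Hz'.
    * by rewrite !ga_mulZr Hz.
  + by rewrite ga_mul0l !ga_mul0r ga_mul0l.
  + by rewrite ga_mulDl !ga_mulDr ga_mulDl Hy Hy'.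
  + by rewrite ga_mulZl !ga_mulZr ga_mulZl Hy.
- by rewrite !ga_mul0l.
- by rewrite !ga_mulDl Hx Hx'.
- by rewrite !ga_mulZl Hx.
Qed.
Definition ga_one : GA := gcls (oone M).
Lemma ga_mul1 : left_id ga_one ga_mul.
Proof.
elim/groth_ind=> [X||x x' Hx Hx'|a x Hx].
- by rewrite ga_mulgg; apply/gcls_iso/oprod1l.
- by rewrite ga_mul0r.
- by rewrite ga_mulDr Hx Hx'.
- by rewrite ga_mulZr Hx.
Qed.
Lemma ga_1mul : right_id ga_one ga_mul.
Proof.
elim/groth_ind=> [X||x x' Hx Hx'|a x Hx].
- by rewrite ga_mulgg; apply/gcls_iso/oprod1r.
- by rewrite ga_mul0l.
- by rewrite ga_mulDl Hx Hx'.
- by rewrite ga_mulZl Hx.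
Qed.
HB.instance Definition _ := GRing.Zmodule_isPzRing.Build GA
  ga_mulA ga_mul1 ga_1mul ga_mulDl ga_mulDr.

Definition ga_inK (a : k) : GA := a *: (ga_one : groth).
Lemma ga_inKD : {morph ga_inK : a b / a + b}.
Proof. by move=> a b; apply: scalerDl. Qed.
Lemma ga_inKE a (x : GA) : ga_inK a * x = a *: (x : groth).
Proof.
change (ga_mul (a *: (ga_one : groth)) x = a *: (x : groth)).
by rewrite ga_mulZl ga_mul1.
Qed.
Lemma ga_inKM : {morph ga_inK : a b / a * b}.
Proof. by move=> a b; rewrite ga_inKE scalerA. Qed.
Lemma ga_inK1 : ga_inK 1 = 1.
Proof. exact: scale1r. Qed.
Lemma ga_inKC a (x : GA) : ga_inK a * x = x * ga_inK a.
Proof.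
rewrite ga_inKE; change (a *: (x : groth) = ga_mul x (a *: (ga_one : groth))).
by rewrite ga_mulZr ga_1mul.
Qed.
HB.instance Definition _ := isKAlg.Build k GA ga_inKD ga_inKM ga_inK1 ga_inKC.

Definition cls (X : gset_over S) : GA := gcls X.
End Ring.
End Grothendieck.

(* Crossed G-sets are the G-sets over G, acting on itself by conjugation. *)
Section CrossedBurnside.
Variable gT : finGroupType.
Notation Gc := (conj_gset gT).

Section Product.
Variables X Y : gset_over Gc.
Definition crossed_map (p : prod_gset X Y) : Gc := (omap p.1 * omap p.2)%g.
Lemma crossed_mapJ g p : crossed_map (gsact g p) = gsact g (crossed_map p).
Proof.
rewrite /crossed_map /= !omapJ /= /conjL.
by rewrite -!mulgA mulKg.
Qed.
Definition crossed_prod := GSetOver crossed_mapJ.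
End Product.

Lemma crossed_one_subproof g x :
  (fun _ : point_gset gT => 1%g : Gc) (gsact g x) = gsact g (1%g : Gc).
Proof. by rewrite /= /conjL mulg1 mulgV. Qed.
Definition crossed_one : gset_over Gc := GSetOver crossed_one_subproof.

Lemma crossed_prod_iso X X' Y Y' : over_iso X X' -> over_iso Y Y' ->
  over_iso (crossed_prod X Y) (crossed_prod X' Y').
Proof.
case=> f [[f1 fK f1K] fJ fo] [h [[h1 hK h1K] hJ ho]].
exists (fun p : X * Y => (f p.1, h p.2)); split.
- exists (fun p : X' * Y' => (f1 p.1, h1 p.2)) => -[x y] /=.
    by rewrite fK hK.
  by rewrite f1K h1K.
- by move=> g [x y]; rewrite /= /pact /= fJ hJ.
- by case=> x y; rewrite /= /crossed_map /= fo ho.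
Qed.
Lemma crossed_prodA X Y Z : over_iso (crossed_prod X (crossed_prod Y Z))
  (crossed_prod (crossed_prod X Y) Z).
Proof.
exists (fun p : X * (Y * Z) => ((p.1, p.2.1), p.2.2)); split=> //.
- by exists (fun p : X * Y * Z => (p.1.1, (p.1.2, p.2))); [case=> ? []|case=> -[]].
- by case=> x [y z]; rewrite /= /crossed_map /= /crossed_map /= mulgA.
Qed.
Lemma crossed_prod1l X : over_iso (crossed_prod crossed_one X) X.
Proof.
exists (fun p : unit * X => p.2); split=> //.
- by exists (fun x : X => (tt, x)); [case=> -[]|].
- by case=> -[] x; rewrite /= /crossed_map /= mul1g.
Qed.
Lemma crossed_prod1r X : over_iso (crossed_prod X crossed_one) X.
Proof.
exists (fun p : X * unit => p.1); split=> //.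
- by exists (fun x : X => (x, tt)); [case=> ? []|].
- by case=> x []; rewrite /= /crossed_map /= mulg1.
Qed.
Lemma crossed_prodDl X Y Z : over_iso (crossed_prod (sum_over X Y) Z)
  (sum_over (crossed_prod X Z) (crossed_prod Y Z)).
Proof.
exists (fun p : (X + Y) * Z =>
  match p.1 with inl x => inl (x, p.2) | inr y => inr (y, p.2) end); split.
- exists (fun q : (X * Z) + (Y * Z) => match q with
    inl p => (inl p.1, p.2) | inr p => (inr p.1, p.2) end).
    by case=> -[].
  by case=> -[].
- by move=> g [[x|y] z].
- by case=> [[x|y] z].
Qed.
Lemma crossed_prodDr X Y Z : over_iso (crossed_prod X (sum_over Y Z))
  (sum_over (crossed_prod X Y) (crossed_prod X Z)).
Proof.
exists (fun p : X * (Y + Z) =>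
  match p.2 with inl y => inl (p.1, y) | inr z => inr (p.1, z) end); split.
- exists (fun q : (X * Y) + (X * Z) => match q with
    inl p => (p.1, inl p.2) | inr p => (p.1, inr p.2) end).
    by case=> x [].
  by case=> -[].
- by move=> g [x [y|z]].
- by case=> [x [y|z]].
Qed.

Definition crossed_product : over_product Gc :=
  OverProduct crossed_prod_iso crossed_prodA crossed_prod1l crossed_prod1r
    crossed_prodDl crossed_prodDr.

Definition crossed_burnside (k : comPzRingType) := groth_alg k crossed_product.

(* The crossed G-set (G/L, gL |-> g a g^-1). *)
Section Transitive.
Variables (L : {group gT}) (a : gT).
Hypothesis aL : a \in 'C(L)%g.
Definition trans_map (C : coset_gset L) : Gc := conjL (repr (val C)) a.
Lemma trans_map_pt x : trans_map (coset_pt L x) = conjL x a.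
Proof.
rewrite /trans_map /=; have: repr (x *: L)%g \in (x *: L)%g.
  by apply: (mem_repr x); rewrite lcoset_refl.
case/lcosetP=> l lL ->; rewrite conjLM; congr conjL.
by rewrite /conjL -(centP aL l lL) mulgK.
Qed.
Lemma trans_mapJ g C : trans_map (gsact g C) = gsact g (trans_map C).
Proof.
case: (coset_ptP C) => x ->; rewrite [gsact g _]coset_act_pt !trans_map_pt.
exact: conjLM.
Qed.
Definition crossed_coset : gset_over Gc := GSetOver trans_mapJ.
End Transitive.
End CrossedBurnside.

(* G-sets over T * T, with the product (X,(f,g)).(Y,(f',g')) = *)
(* (X x_(g,f') Y,(f,g')). *)
Section Spans.
Variables (gT : finGroupType) (T : gset gT).
Notation TT := (prod_gset T T).
Implicit Types X Y Z : gset_over TT.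

Definition oleft X (x : X) : T := (omap x).1.
Definition oright X (x : X) : T := (omap x).2.
Lemma oleftJ X g (x : X) : oleft (gsact g x) = gsact g (oleft x).
Proof. by rewrite /oleft omapJ. Qed.
Lemma orightJ X g (x : X) : oright (gsact g x) = gsact g (oright x).
Proof. by rewrite /oright omapJ. Qed.

Section Product.
Variables X Y : gset_over TT.
Definition fibered (p : X * Y) : bool := oright p.1 == oleft p.2.
Lemma fiberedJ g (p : prod_gset X Y) : fibered p -> fibered (gsact g p).
Proof. by rewrite /fibered /= oleftJ orightJ => /eqP ->. Qed.
Definition pullback := @sub_gset gT (prod_gset X Y) fibered fiberedJ.
Definition pullback_map (p : pullback) : TT :=
  (oleft (val p).1, oright (val p).2).
Lemma pullback_mapJ g p : pullback_map (gsact g p) = gsact g (pullback_map p).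
Proof. by rewrite /pullback_map /= oleftJ orightJ. Qed.
Definition span_prod := GSetOver pullback_mapJ.
End Product.

Definition mk_pullback X Y (p : X * Y) (e : fibered p) : span_prod X Y :=
  exist _ p e.

Definition span_one : gset_over TT :=
  @GSetOver gT TT T (fun w => (w, w)) (fun _ _ => erefl).

Lemma oleft_iso X Y (f : X -> Y) :
  (forall x, omap (f x) = omap x) -> forall x, oleft (f x) = oleft x.
Proof. by move=> fo x; rewrite /oleft fo. Qed.
Lemma oright_iso X Y (f : X -> Y) :
  (forall x, omap (f x) = omap x) -> forall x, oright (f x) = oright x.
Proof. by move=> fo x; rewrite /oright fo. Qed.

Lemma span_prod_iso X X' Y Y' : over_iso X X' -> over_iso Y Y' ->
  over_iso (span_prod X Y) (span_prod X' Y').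
Proof.
case=> f [[f1 fK f1K] fJ fo] [h [[h1 hK h1K] hJ ho]].
have f1o x : omap (f1 x) = omap x by rewrite -fo f1K.
have h1o x : omap (h1 x) = omap x by rewrite -ho h1K.
have FP (p : {p : X * Y | fibered p}) : fibered (f (val p).1, h (val p).2).
  by case: p => -[x y] /=; rewrite /fibered /= (oleft_iso ho) (oright_iso fo).
have GP (p : {p : X' * Y' | fibered p}) : fibered (f1 (val p).1, h1 (val p).2).
  by case: p => -[x y] /=; rewrite /fibered /= (oleft_iso h1o) (oright_iso f1o).
exists (fun p : {p : X * Y | fibered p} => mk_pullback (FP p)); split.
- exists (fun p : {p : X' * Y' | fibered p} => mk_pullback (GP p)).
    by case=> -[x y] xy; apply: val_inj; rewrite /= fK hK.
  by case=> -[x y] xy; apply: val_inj; rewrite /= f1K h1K.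
- by move=> g [[x y] xy]; apply: val_inj; rewrite /= /pact /= fJ hJ.
- case=> -[x y] xy.
  by rewrite /= /pullback_map /= (oleft_iso fo) (oright_iso ho).
Qed.

Lemma span_prodA X Y Z :
  over_iso (span_prod X (span_prod Y Z)) (span_prod (span_prod X Y) Z).
Proof.
pose A := {p : X * span_prod Y Z | fibered p}.
pose B := {p : span_prod X Y * Z | fibered p}.
have F1 (p : A) : fibered ((val p).1, (val (val p).2).1).
  by case: p => -[x [[y z] yz]].
have F2 (p : A) :
    fibered (mk_pullback (F1 p), (val (val p).2).2).
  by case: p => -[x [[y z] yz]] H; exact: yz.
have G1 (p : B) : fibered ((val (val p).1).2, (val p).2).
  by case: p => -[[[x y] xy] z].
have G2 (p : B) :
    fibered ((val (val p).1).1, mk_pullback (G1 p)).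
  by case: p => -[[[x y] xy] z] H; exact: xy.
exists (fun p : A => mk_pullback (F2 p)); split.
- exists (fun p : B => mk_pullback (G2 p)).
    case=> -[x [[y z] yz]] xyz; apply: val_inj => /=; congr pair.
    exact: val_inj.
  case=> -[[[x y] xy] z] xyz; apply: val_inj => /=; congr pair.
  exact: val_inj.
- move=> g [[x [[y z] yz]] xyz]; apply: val_inj; rewrite /= /pact /=.
  by congr pair; apply: val_inj.
- by case=> -[x [[y z] yz]] xyz.
Qed.

Lemma span_prod1l X : over_iso (span_prod span_one X) X.
Proof.
have GP (x : X) : fibered (oleft x : span_one, x) by rewrite /fibered /oright /=.
exists (fun p : {p : span_one * X | fibered p} => (val p).2); split=> //.
- exists (fun x : X => mk_pullback (GP x)) => //.
  case=> -[w x] wx; apply: val_inj => /=; congr pair.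
  by move/eqP: wx.
- case=> -[w x] /= wx; move/eqP: (wx); rewrite /pullback_map /oright /oleft /=.
  by move=> ->; case: (omap x).
Qed.

Lemma span_prod1r X : over_iso (span_prod X span_one) X.
Proof.
have GP (x : X) : fibered (x, oright x : span_one) by rewrite /fibered /oleft /=.
exists (fun p : {p : X * span_one | fibered p} => (val p).1); split=> //.
- exists (fun x : X => mk_pullback (GP x)) => //.
  case=> -[x w] wx; apply: val_inj => /=; congr pair.
  by move/eqP: wx.
- case=> -[x w] /= wx; move/eqP: (wx); rewrite /pullback_map /oright /oleft /=.
  by move=> <-; case: (omap x).
Qed.

Lemma span_prodDl X Y Z : over_iso (span_prod (sum_over X Y) Z)
  (sum_over (span_prod X Z) (span_prod Y Z)).
Proof.
pose A := {p : (X + Y) * Z | fibered (p : sum_over X Y * Z)}.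
pose f (p : A) : span_prod X Z + span_prod Y Z :=
  match p with
  | exist (inl x, z) xz => inl (mk_pullback (p := (x, z)) xz)
  | exist (inr y, z) yz => inr (mk_pullback (p := (y, z)) yz)
  end.
pose f1 (q : span_prod X Z + span_prod Y Z) : A :=
  match q with
  | inl (exist (x, z) xz) => exist _ (inl x, z) xz
  | inr (exist (y, z) yz) => exist _ (inr y, z) yz
  end.
exists f; split.
- by exists f1; [case=> -[[x|y] z] xz|case=> -[[x z] xz]].
- by move=> g [[[x|y] z] xz]; rewrite /=; congr (_ _); apply: val_inj.
- by case=> -[[x|y] z] xz.
Qed.

Lemma span_prodDr X Y Z : over_iso (span_prod X (sum_over Y Z))
  (sum_over (span_prod X Y) (span_prod X Z)).
Proof.
pose A := {p : X * (Y + Z) | fibered (p : X * sum_over Y Z)}.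
pose f (p : A) : span_prod X Y + span_prod X Z :=
  match p with
  | exist (x, inl y) xy => inl (mk_pullback (p := (x, y)) xy)
  | exist (x, inr z) xz => inr (mk_pullback (p := (x, z)) xz)
  end.
pose f1 (q : span_prod X Y + span_prod X Z) : A :=
  match q with
  | inl (exist (x, y) xy) => exist _ (x, inl y) xy
  | inr (exist (x, z) xz) => exist _ (x, inr z) xz
  end.
exists f; split.
- by exists f1; [case=> -[x [y|z]] xy|case=> -[[x z] xz]].
- by move=> g [[x [y|z]] xz]; rewrite /=; congr (_ _); apply: val_inj.
- by case=> -[x [y|z]] xz.
Qed.

Definition span_product : over_product TT :=
  OverProduct span_prod_iso span_prodA span_prod1l span_prod1r
    span_prodDl span_prodDr.

Definition span_alg (k : comPzRingType) := groth_alg k span_product.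

Section MkSpan.
Variables (X : gset gT) (f g : X -> T).
Hypotheses (fJ : forall h x, f (gsact h x) = gsact h (f x))
  (gJ : forall h x, g (gsact h x) = gsact h (g x)).
Lemma mk_span_subproof h x : (f (gsact h x), g (gsact h x)) =
  gsact h ((f x, g x) : TT).
Proof. by rewrite fJ gJ. Qed.
Definition mk_span : gset_over TT := @GSetOver gT TT X (fun x => (f x, g x)) mk_span_subproof.
End MkSpan.
End Spans.

Section GroupAlgebra.
Variables (gT : finGroupType) (k : comPzRingType).

Definition groupalg := {ffun gT -> k}.
HB.instance Definition _ := GRing.Zmodule.on groupalg.

Definition coef (a : groupalg) (g : gT) : k := (a : {ffun gT -> k}) g.
Definition gelt (g : gT) : groupalg := [ffun h => (h == g)%:R].

Section Action.
Variable X : gset gT.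
Implicit Types (u v : {ffun X -> k}) (a b : groupalg).

Definition conv (a : groupalg) u : {ffun X -> k} :=
  [ffun y => \sum_g coef a g * u (gsact g^-1%g y)].

Lemma convDl u : {morph conv^~ u : a b / a + b}.
Proof.
move=> a b; apply/ffunP=> y; rewrite !ffunE -big_split.
by apply: eq_bigr => g _; rewrite /coef ffunE mulrDl.
Qed.
Lemma convDr a : {morph conv a : u v / u + v}.
Proof.
move=> u v; apply/ffunP=> y; rewrite !ffunE -big_split.
by apply: eq_bigr => g _; rewrite ffunE mulrDr.
Qed.
Lemma conv_gelt (c : k) x u (y : X) :
  conv [ffun h => c * (h == x)%:R] u y = c * u (gsact x^-1%g y).
Proof.
rewrite ffunE (bigD1 x) //= /coef ffunE eqxx mulr1 big1 ?addr0 // => g gx.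
by rewrite ffunE (negPf gx) mulr0 mul0r.
Qed.
End Action.

Definition regL (g x : gT) := (g * x)%g.
Definition reg_gset : gset gT :=
  @GSet gT gT regL (@mul1g gT) (fun g h x => esym (mulgA g h x)).

Definition ga_conv (a b : groupalg) : groupalg := conv (X := reg_gset) a b.

Lemma convA (X : gset gT) a b (u : {ffun X -> k}) :
  conv a (conv b u) = conv (ga_conv a b) u.
Proof.
apply/ffunP=> y; rewrite !ffunE.
under eq_bigr => g _ do rewrite ffunE big_distrr.
under [RHS]eq_bigr => g _ do rewrite /ga_conv /coef ffunE big_distrl.
rewrite [RHS]exchange_big; apply: eq_bigr => g _ /=.
rewrite (reindex_inj (mulgI g^-1%g)) /=; apply: eq_bigr => x _.
by rewrite mulrA /regL -gsactM invMg invgK -mulgA mulgV mulg1.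
Qed.

Lemma conv1 (X : gset gT) (u : {ffun X -> k}) : conv (gelt 1%g) u = u.
Proof.
apply/ffunP=> y; rewrite -[RHS]mul1r -[y in RHS](gsact1 y) -{2}invg1 -conv_gelt.
by congr (conv _ u y); apply/ffunP=> x; rewrite !ffunE mul1r.
Qed.

Lemma conv_r1 : right_id (gelt 1%g) ga_conv.
Proof.
move=> a; apply/ffunP=> y; rewrite ffunE (bigD1 y) //= ffunE /regL mulVg eqxx.
rewrite mulr1 big1 ?addr0 // => g gy; rewrite ffunE.
by rewrite -(inj_eq (mulgI g)) mulKVg mulg1 eq_sym (negPf gy) mulr0.
Qed.

HB.instance Definition _ := GRing.Zmodule_isPzRing.Build groupalg
  (@convA reg_gset) (@conv1 reg_gset) conv_r1
  (fun a b c => convDl (X := reg_gset) c a b) (convDr (X := reg_gset)).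

Definition gp_inK (c : k) : groupalg := [ffun h => c * (h == 1%g)%:R].
Lemma gp_inKD : {morph gp_inK : a b / a + b}.
Proof. by move=> a b; apply/ffunP=> h; rewrite !ffunE mulrDl. Qed.
Lemma gp_inKl c (X : gset gT) (u : {ffun X -> k}) y :
  conv (gp_inK c) u y = c * u y.
Proof. by rewrite conv_gelt invg1 gsact1. Qed.
Lemma gp_inKM : {morph gp_inK : a b / a * b}.
Proof.
by move=> a b; apply/ffunP=> h; rewrite [RHS]gp_inKl !ffunE mulrA.
Qed.
Lemma gp_inK1 : gp_inK 1 = 1.
Proof. by apply/ffunP=> h; rewrite !ffunE mul1r. Qed.
Lemma gp_inKC c (a : groupalg) : gp_inK c * a = a * gp_inK c.
Proof.
apply/ffunP=> y; rewrite [LHS]gp_inKl; have /ffunP/(_ y) := conv_r1 a.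
rewrite ffunE => <-; rewrite big_distrr [RHS]ffunE; apply: eq_bigr => g _.
by rewrite !ffunE mulrCA.
Qed.
HB.instance Definition _ := isKAlg.Build k groupalg
  gp_inKD gp_inKM gp_inK1 gp_inKC.

Section PermutationModule.
Variable X : gset gT.

Definition permmod := {ffun X -> k}.
HB.instance Definition _ := GRing.Zmodule.on permmod.
HB.instance Definition _ := GRing.Zmodule_isLmodule.Build groupalg permmod
  (@convA X) (@conv1 X) (@convDr X) (@convDl X).

Definition pt (x : X) : permmod := [ffun y => (y == x)%:R].
End PermutationModule.
End GroupAlgebra.

(* Sums over the sets of representatives [G/L] and [J\H/K] are taken over the *)
(* cosets, with repr as a fixed element of each of them. *)
Definition dcosets (gT : finGroupType) (J H K : {set gT}) : {set {set gT}} :=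
  [set ((J :* x) * K)%g | x in H].

Section MackeyAlgebra.
Variables (gT : finGroupType) (k : comPzRingType).
Implicit Types (g h : gT) (H K L J : {group gT}).

Definition subpair := {p : {group gT} * {group gT} | p.2 \subset p.1}.

Inductive mgen := GenT of subpair | GenR of subpair | GenC of gT & {group gT}.

(* Generators as morphisms from a source to a target subgroup; a product x * y *)
(* is composable when the source of x is the target of y. *)
Definition mtgt (x : mgen) : {group gT} :=
  match x with
  | GenT p => (val p).1 | GenR p => (val p).2 | GenC g H => (H :^ g^-1)%G
  end.
Definition msrc (x : mgen) : {group gT} :=
  match x with
  | GenT p => (val p).2 | GenR p => (val p).1 | GenC g H => H
  end.

Notation F := (freealg k mgen).

(* t^H_K and r^H_K, with the value 0 when K is not a subgroup of H. *)
Definition free_t H K : F := oapp (fun p => fgen k (GenT p)) 0 (insub (H, K)).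
Definition free_r H K : F := oapp (fun p => fgen k (GenR p)) 0 (insub (H, K)).
Definition free_c g H : F := fgen k (GenC g H).

Inductive mackey_rel : F -> F -> Prop :=
| MackeyTR H : mackey_rel (free_t H H) (free_r H H)
| MackeyTC h H of h \in H : mackey_rel (free_t H H) (free_c h H)
| MackeyTT H K L of L \subset K & K \subset H :
    mackey_rel (free_t H K * free_t K L) (free_t H L)
| MackeyRR H K L of L \subset K & K \subset H :
    mackey_rel (free_r K L * free_r H K) (free_r H L)
| MackeyCC g g' H :
    mackey_rel (free_c g' (H :^ g^-1)%G * free_c g H) (free_c (g' * g)%g H)
| MackeyCT g H K of K \subset H :
    mackey_rel (free_c g H * free_t H K)
      (free_t (H :^ g^-1)%G (K :^ g^-1)%G * free_c g K)
| MackeyCR g H K of K \subset H :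
    mackey_rel (free_c g K * free_r H K)
      (free_r (H :^ g^-1)%G (K :^ g^-1)%G * free_c g H)
| MackeyRT H J K of J \subset H & K \subset H :
    mackey_rel (free_r H J * free_t H K)
      (\sum_(D in dcosets J H K) let x := repr D in
         free_t J (J :&: K :^ x^-1)%G * free_c x (J :^ x :&: K)%G *
         free_r K (J :^ x :&: K)%G)
| Mackey1 : mackey_rel (\sum_(H : {group gT}) free_t H H) 1
| Mackey0 (x y : mgen) of msrc x != mtgt y :
    mackey_rel (fgen k x * fgen k y) 0.

Definition mackey := algquot mackey_rel.
HB.instance Definition _ := KAlg.on mackey.

Definition mt H K : mackey := quot mackey_rel (free_t H K).
Definition mr H K : mackey := quot mackey_rel (free_r H K).
Definition mc g H : mackey := quot mackey_rel (free_c g H).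

Inductive cohom_rel : mackey -> mackey -> Prop :=
| CohomRel H K of K \subset H :
    cohom_rel (mt H K * mr H K) (mt H H *+ #|H : K|%g).

Definition comackey := algquot cohom_rel.
HB.instance Definition _ := KAlg.on comackey.

Definition to_comackey : mackey -> comackey := quot cohom_rel.
HB.instance Definition _ := KAlgMorphism.on to_comackey.

Definition zeta_formula L (a : gT) : mackey :=
  \sum_(U : {group gT}) \sum_(D in dcosets L [set: gT] U) let w := repr D in
    mt U (L :^ w :&: U)%G * mc (w^-1 * a * w)%g (L :^ w :&: U)%G *
    mr U (L :^ w :&: U)%G.

Definition iota_formula (z : groupalg gT k) : comackey :=
  \sum_(H : {group gT}) \sum_(D in dcosets H [set: gT] H) let g := repr D in
    inK (\sum_(x in H) coef z (g * x)%g) *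
    to_comackey (mt H (H :&: H :^ g^-1)%G * mc g (H :&: H :^ g)%G *
                 mr H (H :&: H :^ g)%G).

Definition phi1_formula L (a : gT) : groupalg gT k :=
  \sum_(C in lcosets L [set: gT]) gelt k (repr C * a * (repr C)^-1)%g.

Definition yoshida := endalg (permmod k (omega gT)).
HB.instance Definition _ := KAlg.on yoshida.
End MackeyAlgebra.

(* For K^g <= H, the G-map G/K -> Omega_G, xK |-> xgH. *)
Section OmegaMaps.
Variables (gT : finGroupType) (H K : {group gT}) (g : gT).
Hypothesis sKH : (K :^ g)%g \subset H.

Definition coset_map (C : coset_gset K) : omega gT := om H (repr (val C) * g)%g.

Lemma coset_map_pt x : coset_map (coset_pt K x) = om H (x * g)%g.
Proof.
rewrite /coset_map /om; congr Tagged; apply: val_inj => /=.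
have: repr (x *: K)%g \in (x *: K)%g.
  by apply: (mem_repr x); rewrite lcoset_refl.
case/lcosetP=> y yK ->; rewrite -mulgA (conjgC y g) mulgA.
by rewrite lcosetM lcoset_id // (subsetP sKH) // memJ_conjg.
Qed.

Lemma coset_mapJ h C : coset_map (gsact h C) = gsact h (coset_map C).
Proof.
case: (coset_ptP C) => x ->; rewrite [gsact h _]coset_act_pt.
by rewrite !coset_map_pt om_actE mulgA.
Qed.
End OmegaMaps.

Section SpanGenerators.
Variable gT : finGroupType.
Implicit Types (g : gT) (H K : {group gT}).

Lemma conjs1 H K : K \subset H -> (K :^ 1)%g \subset H.
Proof. by rewrite conjsg1. Qed.

Definition span_t H K (sKH : K \subset H) : gset_over (prod_gset (omega gT) _) :=
  mk_span (coset_mapJ (conjs1 sKH)) (coset_mapJ (conjs1 (subxx K))).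
Definition span_r H K (sKH : K \subset H) : gset_over (prod_gset (omega gT) _) :=
  mk_span (coset_mapJ (conjs1 (subxx K))) (coset_mapJ (conjs1 sKH)).
Definition span_c g H : gset_over (prod_gset (omega gT) _) :=
  mk_span (@coset_mapJ _ (H :^ g^-1)%G H g^-1%g (subxx _))
    (coset_mapJ (conjs1 (subxx H))).

Lemma span_tE H K (s : K \subset H) x :
  @omap _ _ (span_t s) (coset_pt K x) = (om H x, om K x).
Proof. by rewrite /= !coset_map_pt ?conjs1 // mulg1. Qed.
Lemma span_rE H K (s : K \subset H) x :
  @omap _ _ (span_r s) (coset_pt K x) = (om K x, om H x).
Proof. by rewrite /= !coset_map_pt ?conjs1 // mulg1. Qed.
Lemma span_cE g H x :
  @omap _ _ (span_c g H) (coset_pt H x) = (om (H :^ g^-1)%G (x * g^-1)%g, om H x).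
Proof. by rewrite /= !coset_map_pt ?conjs1 ?subxx // mulg1. Qed.
End SpanGenerators.

HB.instance Definition _ (gT : finGroupType) (k : comPzRingType) :=
  KAlg.on (crossed_burnside gT k).
HB.instance Definition _ (gT : finGroupType) (T : gset gT)
  (k : comPzRingType) := KAlg.on (span_alg T k).

Definition crossed_cls (gT : finGroupType) (k : comPzRingType)
    (L : {group gT}) (a : gT) (aL : a \in 'C(L)%g) : crossed_burnside gT k :=
  cls k (crossed_product gT) (crossed_coset aL).
Definition span_cls (gT : finGroupType) (k : comPzRingType) (T : gset gT)
    (X : gset_over (prod_gset T T)) : span_alg T k :=
  cls k (span_product T) X.

(* Main.v *)
(* Everything is transported to spans of G-sets over Omega.  A span is the sum *)
(* of its orbits, and an orbit G/S with legs xS |-> xaH and xS |-> xbK is the *)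
(* image of the element t c_{a^-1 b} r of the Mackey algebra; as these elements *)
(* span that algebra, summing them over the orbits of a span inverts beta.  The *)
(* map (X,alpha) |-> (X x Omega, (x,w) |-> (alpha(x)^-1 w, w)) sends the crossed *)
(* Burnside ring into the center of the span algebra, and the formula for zeta *)
(* lists the orbits of G/L x Omega. *)
(* In the cohomological quotient, t c r depends up to an integer only on the *)
(* orbit of (aH,bK) in Omega x Omega, so that an endomorphism of k Omega is *)
(* recovered from its matrix; this inverts phi.  An endomorphism commuting with *)
(* all those that send the generator of the free summand kG to an arbitrary *)
(* vector is the action of an element of ZkG, and iota corresponds under phi to *)
(* z |-> action of the antipode of z. *)

(* The map beta is inverted by a normal form. By the Mackey formula, the span of the elements [mtcr]
   is stable under left multiplication by generators ([tcr_span_gen]); it contains 1, so it is the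
   whole Mackey algebra ([beta_inv_surj]). Since [beta_fun] sends [mpt k S p] to the transitive span
   G/S over p ([beta_mpt]), and a G-set over T is the sum of its orbits ([orbit_decomposition]),
   [beta_fun] and [beta_inv] are inverse to each other.

   The map phi is inverted by matrices. The entries of an endomorphism of k Omega are constant on
   the G-orbits of pairs of points. In the cohomological quotient, the elements t c r lying over a
   pair p are integer multiples of the one attached to the full stabilizer of p ([co_mtcr],
   [co_mpt]). So the elements [orbit_elt] span the quotient, and phi sends them to the indicator
   matrices of the orbits ([phi_psi], [psi_phi]).

   The right square commutes because phi is constructed by factoring p_L after beta through the
   quotient. For the left square, phi is injective, so it is enough to compare images under phi. One
   side becomes the action on k Omega of the span attached to a crossed G-set, which is the action
   of the antipode of its image under phi_1 ([pL_crossed_to_span]). The other is, by construction of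
   iota, the action of the same element ([phi_iota]). The explicit formulas for zeta and iota come
   from listing orbits by double cosets ([zeta_funE], [iota_funE]), and iota reaches the whole
   center by [central_homothety]. *)
Require Import Defs.
From HB Require Import structures.
Set Warnings "-notation-overridden,-ambiguous-paths".
From mathcomp Require Import all_boot all_order all_algebra.
From mathcomp Require Import boolp.
From mathcomp Require Import all_fingroup.

Set Implicit Arguments.
Unset Strict Implicit.
Unset Printing Implicit Defensive.

Import GRing.Theory.
Local Open Scope ring_scope.

(* The library's omap on options would otherwise hide the structure map. *)
Local Notation omap := (@Defs.omap _ _).

(** * Morphisms of algebras *)

Section KAlgMorphisms.
Variable k : comPzRingType.
Implicit Types A B C : kalgType k.

(** Kept as a predicate on plain functions, because most maps below are first defined as functions
    and only later shown to be morphisms; [kmor_kalg] packs them. *)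
Definition is_kmor A B (f : A -> B) : Prop :=
  [/\ {morph f : x y / x + y}, {morph f : x y / x * y}, f 1 = 1 &
      forall a : k, f (inK a) = inK a].

Lemma kmor0 A B (f : A -> B) : is_kmor f -> f 0 = 0.
Proof. by case=> fD _ _ _; apply: (addrI (f 0)); rewrite -fD !addr0. Qed.

Lemma kmor_sub A B (f : A -> B) : is_kmor f -> zmod_morphism f.
Proof.
by case=> fD _ _ _ x y; apply: (addIr (f y)); rewrite -fD !subrK.
Qed.

Lemma kmor_monoid A B (f : A -> B) : is_kmor f -> monoid_morphism f.
Proof. by case=> _ fM f1 _; split. Qed.

Lemma kmor_inK A B (f : A -> B) : is_kmor f -> forall a : k, f (inK a) = inK a.
Proof. by case. Qed.

Section Pack.
Variables (A B : kalgType k) (f : A -> B) (fP : is_kmor f).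
(** The proof argument stays in the term so that the structure instances, which depend on it, can be
    inferred from the head constant. *)
Definition kmor_fun of is_kmor f := f.
Local Notation g := (kmor_fun fP).
HB.instance Definition _ := GRing.isZmodMorphism.Build A B g (kmor_sub fP).
HB.instance Definition _ := GRing.isMonoidMorphism.Build A B g (kmor_monoid fP).
HB.instance Definition _ := isKMorphism.Build k A B g (kmor_inK fP).
Definition kmor_kalg : {kalg A -> B} := g.
Lemma kmor_kalgE x : kmor_kalg x = f x. Proof. by []. Qed.
End Pack.

Lemma kalg_kmor A B (f : {kalg A -> B}) : is_kmor f.
Proof.
split; [exact: rmorphD|exact: rmorphM|exact: rmorph1|].
by move=> a; rewrite kmorphK.
Qed.

Lemma kmor_comp A B C (f : B -> C) (g : A -> B) :
  is_kmor f -> is_kmor g -> is_kmor (f \o g).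
Proof.
move=> [fD fM f1 fK] [gD gM g1 gK]; split.
- by move=> x y /=; rewrite gD fD.
- by move=> x y /=; rewrite gM fM.
- by rewrite /= g1 f1.
- by move=> a; rewrite /= gK fK.
Qed.

Lemma kmor_can A B (f : A -> B) (g : B -> A) :
  cancel f g -> cancel g f -> is_kmor f -> is_kmor g.
Proof.
move=> fK gK [fD fM f1 fc]; split.
- by move=> x y; apply: (can_inj fK); rewrite fD !gK.
- by move=> x y; apply: (can_inj fK); rewrite fM !gK.
- by apply: (can_inj fK); rewrite f1 !gK.
- by move=> a; rewrite -[inK a]fc fK.
Qed.

Lemma kmor_val A : is_kmor (val : alg_center A -> A).
Proof. by split. Qed.

Lemma kmor_to_center A B (f : A -> B) : is_kmor f ->
  (forall x, f x \in @central k B) ->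
  exists F : {kalg A -> alg_center B}, forall x, val (F x) = f x.
Proof.
move=> [fD fM f1 fK] fc; pose F x := AlgCenter (fc x).
have FP : is_kmor F.
  by split=> [x y|x y||a]; apply: val_inj; rewrite /= ?fD ?fM ?f1 ?fK.
by exists (kmor_kalg FP).
Qed.

(** Surjectivity is what carries the center into the center: every element of the target is some f
    x, and f z commutes with it when z commutes with x. *)
Lemma kmor_on_centers A B (f : A -> B) : is_kmor f -> (forall y, exists x, f x = y) ->
  exists F : {kalg alg_center A -> alg_center B}, induced_on_centers f F.
Proof.
move=> fP fsurj; apply: (kmor_to_center (kmor_comp fP (kmor_val A))) => z.
apply/centralP=> y; case: (fsurj y) => x <- /=.
by case: fP => _ fM _ _; rewrite -!fM; have /centralP -> := valP z.
Qed.

Lemma kmor_sum A B (f : A -> B) I r (P : pred I) (F : I -> A) : is_kmor f ->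
  f (\sum_(i <- r | P i) F i) = \sum_(i <- r | P i) f (F i).
Proof. by move=> fP; rewrite -(kmor_kalgE fP) rmorph_sum. Qed.

(* Algebras are turned into modules in order to be targets of glift. *)
Definition kmod A : Type := A.
HB.instance Definition _ A := GRing.Zmodule.on (kmod A).

Section KMod.
Variable A : kalgType k.
Definition kscale (a : k) (x : kmod A) : kmod A := inK a * (x : A).
Lemma kscaleA a b x : kscale a (kscale b x) = kscale (a * b) x.
Proof. by rewrite /kscale inKM mulrA. Qed.
Lemma kscale1 : left_id 1 kscale.
Proof. by move=> x; rewrite /kscale inK1 mul1r. Qed.
Lemma kscaleDr : right_distributive kscale +%R.
Proof. by move=> a x y; apply: mulrDr. Qed.
Lemma kscaleDl x : {morph kscale^~ x : a b / a + b}.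
Proof. by move=> a b; rewrite /kscale inKD; apply: mulrDl. Qed.
HB.instance Definition _ := GRing.Zmodule_isLmodule.Build k (kmod A)
  kscaleA kscale1 kscaleDr kscaleDl.
End KMod.

Section FreeLift.
Variables (I : Type) (A : kalgType k) (F : I -> A).
Fixpoint aexp_eval (x : aexp k I) : A :=
  match x with
  | AGen i => F i
  | AConst a => inK a
  | AAdd x y => aexp_eval x + aexp_eval y
  | AMul x y => aexp_eval x * aexp_eval y
  end.

Lemma inK0 : inK 0 = 0 :> A.
Proof. by apply: (addrI (inK 0)); rewrite -inKD !addr0. Qed.
Lemma inKN1 : inK (-1) = -1 :> A.
Proof.
have : inK (-1) + inK 1 = 0 :> A by rewrite -inKD addNr inK0.
by rewrite inK1 => /eqP; rewrite addr_eq0 => /eqP.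
Qed.

Lemma aexp_eval_aeq x y : aeq x y -> aexp_eval x = aexp_eval y.
Proof.
elim=> {x y} //=.
- by move=> y x z _ -> _.
- by move=> x x' y y' _ -> _ ->.
- by move=> x x' y y' _ -> _ ->.
- by move=> x y z; rewrite addrA.
- by move=> x y; rewrite addrC.
- by move=> x; rewrite inK0 add0r.
- by move=> x; rewrite inKN1 mulN1r addNr inK0.
- by move=> x y z; rewrite mulrA.
- by move=> x; rewrite inK1 mul1r.
- by move=> x y z; rewrite mulrDl.
- by move=> x y z; rewrite mulrDr.
- by move=> a b; rewrite inKD.
- by move=> a b; rewrite inKM.
- by move=> a x; rewrite inKC.
Qed.

Definition free_lift (x : freealg k I) : A := aexp_eval (generic_quotient.repr x).

Lemma free_liftE x : free_lift (facls x) = aexp_eval x.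
Proof. exact/aexp_eval_aeq/facls_repr. Qed.

Lemma free_lift_gen i : free_lift (fgen k i) = F i.
Proof. exact: free_liftE. Qed.

Lemma free_lift_kmor : is_kmor free_lift.
Proof.
split.
- elim/fa_ind=> x; elim/fa_ind=> y; by rewrite fa_plusE !free_liftE.
- elim/fa_ind=> x; elim/fa_ind=> y.
  by rewrite [facls x * _]fa_mulE !free_liftE.
- by rewrite [LHS]free_liftE /= inK1.
- by move=> a; rewrite [LHS]free_liftE.
Qed.
End FreeLift.

Section QuotLift.
Variables (A B : kalgType k) (r : A -> A -> Prop) (f : A -> B).
Hypotheses (fP : is_kmor f) (fr : forall x y, r x y -> f x = f y).

Lemma cong_eq x y : cong r x y -> f x = f y.
Proof.
case: fP => fD fM _ _; elim=> {x y} //.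
- by move=> y x z _ -> _.
- by move=> x x' y y' _ e _ e'; rewrite !fD e e'.
- by move=> x x' y y' _ e _ e'; rewrite !fM e e'.
Qed.

Definition quot_lift (x : algquot r) : B := f (generic_quotient.repr x).
Lemma quot_liftE x : quot_lift (quot r x) = f x.
Proof. exact/cong_eq/quot_repr. Qed.

Lemma quot_lift_kmor : is_kmor quot_lift.
Proof.
case: (fP) => fD fM f1 fK; split.
- by elim/aq_ind=> x; elim/aq_ind=> y; rewrite aq_plusE !quot_liftE fD.
- elim/aq_ind=> x; elim/aq_ind=> y.
  by rewrite [quot r x * _]aq_mulE !quot_liftE fM.
- by rewrite [LHS]quot_liftE.
- by move=> a; rewrite [LHS]quot_liftE fK.
Qed.
End QuotLift.

Lemma quot_rel A (r : A -> A -> Prop) x y : r x y -> quot r x = quot r y.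
Proof. by move=> rxy; apply/algquotP; apply: CongBase. Qed.

End KAlgMorphisms.

(** * Algebra morphisms out of Grothendieck rings *)

Section GrothLift.
Variables (k : comPzRingType) (gT : finGroupType) (S : gset gT).
Variables (A : kalgType k) (F : gset_over S -> A).
Hypothesis F_iso : forall X Y, over_iso X Y -> F X = F Y.
Hypothesis F_sum : forall X Y, F (sum_over X Y) = F X + F Y.

Definition galg_lift (x : groth k S) : A := @glift gT k S (kmod A) F x.

Lemma galg_lift_cls X : galg_lift (gcls k X) = F X.
Proof. exact: (@glift_gcls _ _ _ (kmod A)). Qed.
Lemma galg_lift0 : galg_lift 0 = 0.
Proof. exact: (@glift0 _ _ _ (kmod A)). Qed.
Lemma galg_liftD x y : galg_lift (x + y) = galg_lift x + galg_lift y.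
Proof. exact: (@gliftD _ _ _ (kmod A)). Qed.
Lemma galg_liftZ a x : galg_lift (a *: x) = inK a * galg_lift x.
Proof. exact: (@gliftZ _ _ _ (kmod A)). Qed.

Variable M : over_product S.
Hypothesis F_prod : forall X Y, F (oprod M X Y) = F X * F Y.
Hypothesis F_one : F (oone M) = 1.

(** Both sides of multiplicativity are bilinear, so it reduces to classes of G-sets, where it is
    [F_prod]. The map from crossed G-sets to spans, phi_1 and p_L are all obtained this way. *)
Lemma galg_lift_kmor : is_kmor (galg_lift : groth_alg k M -> A).
Proof.
split; first exact: galg_liftD.
- move=> x y; change (galg_lift (ga_mul (M := M) x y) = galg_lift x * galg_lift y).
  elim/groth_ind: x => [X||x x' Hx Hx'|a x Hx].
  + elim/groth_ind: y => [Y||y y' Hy Hy'|a y Hy].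
    * by rewrite ga_mulgg !galg_lift_cls.
    * by rewrite ga_mul0r galg_lift0 mulr0.
    * by rewrite ga_mulDr !galg_liftD mulrDr Hy Hy'.
    * by rewrite ga_mulZr !galg_liftZ Hy mulrA inKC -mulrA.
  + by rewrite ga_mul0l galg_lift0 mul0r.
  + by rewrite ga_mulDl !galg_liftD mulrDl Hx Hx'.
  + by rewrite ga_mulZl !galg_liftZ Hx mulrA.
- by rewrite [LHS]galg_lift_cls.
- by move=> a; rewrite [LHS]galg_liftZ galg_lift_cls F_one mulr1.
Qed.
End GrothLift.

(** * Orbits and transversals *)

Section Orbits.
Variable gT : finGroupType.
Implicit Types (X : gset gT) (S : {group gT}).

Definition gorb X (x : X) : {set X} := [set gsact g x | g in [set: gT]].
(** The result of [pick] depends only on the orbit, so the condition [gcanon y == y] selects exactly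
    one point in each orbit. *)
Definition gcanon X (x : X) : X := odflt x [pick y in gorb x].

Lemma gorbP X (x y : X) : reflect (exists g, y = gsact g x) (y \in gorb x).
Proof.
apply: (iffP imsetP) => [[g _ ->]|[g ->]]; first by exists g.
by exists g; rewrite ?inE.
Qed.

Lemma gorb_refl X (x : X) : x \in gorb x.
Proof. by apply/gorbP; exists 1%g; rewrite gsact1. Qed.

Lemma gorbJ X g (x : X) : gorb (gsact g x) = gorb x.
Proof.
apply/setP=> y; apply/gorbP/gorbP => -[h ->].
  by exists (h * g)%g; rewrite gsactM.
by exists (h * g^-1)%g; rewrite gsactM gsactK.
Qed.

Lemma gcanon_orb X (x : X) : gcanon x \in gorb x.
Proof. by rewrite /gcanon; case: pickP => //= /(_ x); rewrite gorb_refl. Qed.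

Lemma gcanonJ X g (x : X) : gcanon (gsact g x) = gcanon x.
Proof.
rewrite /gcanon gorbJ; case: pickP => [y _|/(_ x)] //.
by rewrite /= gorb_refl.
Qed.

Lemma gcanonK X (x : X) : gcanon (gcanon x) = gcanon x.
Proof. by case/gorbP: (gcanon_orb x) => g e; rewrite {1}e gcanonJ. Qed.

Lemma gcanon_eqP X (x y : X) : reflect (exists g, y = gsact g x) (gcanon x == gcanon y).
Proof.
apply: (iffP eqP) => [e|[g ->]]; last by rewrite gcanonJ.
case/gorbP: (gcanon_orb x) => g eg; case/gorbP: (gcanon_orb y) => h eh.
by exists (h^-1 * g)%g; rewrite gsactM -eg e eh gsactK.
Qed.

Definition gstab_set X (x : X) : {set gT} := [set g | gsact g x == x].
Lemma gstab_group_set X (x : X) : group_set (gstab_set x).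
Proof.
apply/group_setP; split=> [|g h]; rewrite !inE ?gsact1 // => /eqP gx /eqP hx.
by rewrite gsactM hx gx.
Qed.
Definition gstab X (x : X) : {group gT} := Group (gstab_group_set x).

Lemma gstabE X (x : X) g : (g \in gstab x) = (gsact g x == x).
Proof. by rewrite inE. Qed.

Lemma gstabJ X (x : X) g : gstab (gsact g x) = (gstab x :^ g^-1)%G.
Proof.
apply/val_inj/setP=> h /=; rewrite mem_conjgV !inE conjgE !gsactM.
by rewrite (can2_eq (gsactKV g) (gsactK g)).
Qed.

(** A system of orbit representatives given as an indexed family, since the sums to be matched are
    indexed by double cosets and not by points. *)
Definition gtransversal X (I : finType) (P : pred I) (x : I -> X) : Prop :=
  (forall y, exists2 i, P i & exists g, y = gsact g (x i)) /\
  (forall i j g, P i -> P j -> x j = gsact g (x i) -> i = j).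

Lemma gcanon_transversal X :
  @gtransversal X X (fun y => gcanon y == y) id.
Proof.
split=> [y|y z g /eqP cy /eqP cz ezy].
  exists (gcanon y); first by rewrite gcanonK.
  by apply/gcanon_eqP; rewrite gcanonK.
by rewrite -cy -cz ezy gcanonJ.
Qed.

(** Allows a sum over canonical points to be rewritten over whichever representatives a formula
    uses. *)
Lemma sum_transversal X (V : nmodType) (m : X -> V) (I : finType) (P : pred I)
    (x : I -> X) : (forall g y, m (gsact g y) = m y) -> gtransversal P x ->
  \sum_(y : X | gcanon y == y) m y = \sum_(i | P i) m (x i).
Proof.
move=> mJ [xs xi].
rewrite (partition_big (fun i => gcanon (x i)) (fun y => gcanon y == y)) /=; last first.
  by move=> i _; rewrite gcanonK.
apply: eq_bigr => y /eqP cy; case: (xs y) => i Pi [g ey].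
rewrite (big_pred1 i) => [|j]; first by rewrite ey mJ.
rewrite /= -cy; apply/andP/eqP => [[Pj /gcanon_eqP[h eh]]|->]; last first.
  by split=> //; apply/gcanon_eqP; exists g.
by apply: (xi j i (g^-1 * h)%g) => //; rewrite gsactM -eh ey gsactK.
Qed.

Section CosetOver.
Variables (T : gset gT) (S : {group gT}) (s : T).
Hypothesis Ss : S \subset gstab s.
Definition coset_over_map (C : coset_gset S) : T := gsact (repr (val C)) s.
Lemma coset_over_pt x : coset_over_map (coset_pt S x) = gsact x s.
Proof.
rewrite /coset_over_map /=; have: repr (x *: S)%g \in (x *: S)%g.
  by apply: (mem_repr x); rewrite lcoset_refl.
case/lcosetP=> y /(subsetP Ss); rewrite gstabE => /eqP ys ->.
by rewrite gsactM ys.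
Qed.
Lemma coset_overJ g C : coset_over_map (gsact g C) = gsact g (coset_over_map C).
Proof.
by case: (coset_ptP C) => x ->; rewrite [gsact g _]coset_act_pt !coset_over_pt gsactM.
Qed.
Definition coset_over : gset_over T := GSetOver coset_overJ.
End CosetOver.

Lemma coset_act_ptE S g x : gsact g (coset_pt S x : coset_gset S) = coset_pt S (g * x)%g.
Proof. exact: coset_act_pt. Qed.

Lemma coset_pt_eqP S x y : reflect (coset_pt S x = coset_pt S y) (x^-1 * y \in S)%g.
Proof.
rewrite -mem_lcoset; apply: (iffP lcoset_eqP) => [e|[->]//].
by apply: val_inj => /=; rewrite e.
Qed.

Lemma gstab_coset_pt S x : gstab (coset_pt S x : coset_gset S) = (S :^ x^-1)%G.
Proof.
apply/val_inj/setP=> g /=; rewrite mem_conjgV inE coset_act_ptE eq_sym.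
by rewrite conjgE; apply/eqP/idP => /coset_pt_eqP.
Qed.

Lemma coset_pt1_orb S (C : coset_gset S) : exists g, C = gsact g (coset_pt S 1%g : coset_gset S).
Proof. by case: (coset_ptP C) => x ->; exists x; rewrite coset_act_ptE mulg1. Qed.

Lemma gstab_omap (T : gset gT) (X : gset_over T) (x : X) : gstab x \subset gstab (omap x).
Proof. by apply/subsetP=> g; rewrite !gstabE -omapJ => /eqP ->. Qed.
End Orbits.

(** * Splitting a G-set over T into orbits *)

Section OrbitDecomposition.
Variables (gT : finGroupType) (k : comPzRingType) (T : gset gT).
Implicit Types (X : gset_over T) (S : {group gT}).

Section SubOver.
Variables (X : gset_over T) (Q : pred X).
Hypothesis QJ : forall g x, Q x -> Q (gsact g x).
Lemma sub_overJ g (u : sub_gset QJ) : omap (val (gsact g u)) = gsact g (omap (val u)).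
Proof. exact: omapJ. Qed.
Definition sub_over : gset_over T := GSetOver sub_overJ.
End SubOver.

Section Fibers.
Variables (X : gset_over T) (I : finType) (h : X -> I).
Hypothesis hJ : forall g x, h (gsact g x) = h x.

Lemma fiberJ (Q : pred I) g x : Q (h x) -> Q (h (gsact g x)).
Proof. by rewrite hJ. Qed.
Definition fiber (Q : pred I) : gset_over T := sub_over (fiberJ (Q := Q)).
Definition mk_fiber (Q : pred I) x (Qx : Q (h x)) : fiber Q := exist _ x Qx.

Lemma fiber_eq (Q Q' : pred I) : Q =1 Q' -> gcls k (fiber Q) = gcls k (fiber Q').
Proof. by move/funext=> ->. Qed.

Lemma fiberU (Q Q' : pred I) : (forall i, Q i -> ~~ Q' i) ->
  gcls k (fiber (predU Q Q')) = gcls k (fiber Q) + gcls k (fiber Q').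
Proof.
move=> QQ'; rewrite -gcls_sum; apply/gcls_iso/over_iso_sym.
have il x : Q (h x) -> predU Q Q' (h x) by move=> /= ->.
have ir x : Q' (h x) -> predU Q Q' (h x) by move=> /= ->; rewrite orbT.
pose f (p : fiber Q + fiber Q') : fiber (predU Q Q') :=
  match p with inl u => mk_fiber (il _ (valP u)) | inr u => mk_fiber (ir _ (valP u)) end.
exists f; split.
(* Injectivity and a count replace an explicit inverse, which would have to decide between two
   proofs of membership. *)
- apply: inj_card_bij => [[u|u] [v|v]|].
  + by case=> /val_inj ->.
  + by case=> e; move: (valP v) (QQ' _ (valP u)); rewrite /= e => ->.
  + by case=> e; move: (valP u) (QQ' _ (valP v)); rewrite /= e => ->.
  + by case=> /val_inj ->.
  rewrite card_sum /= !card_sig -!sum1_card.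
  rewrite (bigID (fun x => Q (h x))) /= leq_eqVlt; apply/orP; left; apply/eqP; congr addn.
    by apply: eq_bigl => x; rewrite !inE /=; case: (Q _) => //; rewrite andbF.
  apply: eq_bigl => x; rewrite !inE /=.
  by have := QQ' (h x); case: (Q _) => /= [/(_ isT) /negPf ->|_]; rewrite ?andbT.
- by move=> g [u|u]; apply: val_inj.
- by case=> u.
Qed.

(** The empty G-set is its own double, so its class c satisfies c + c = c. *)
Lemma fiber0 : gcls k (fiber pred0) = 0.
Proof.
by apply: (addrI (gcls k (fiber pred0))); rewrite addr0 -fiberU.
Qed.

Lemma fiberT (P : pred I) : (forall x, P (h x)) -> gcls k (fiber P) = gcls k X.
Proof.
move=> PX; apply: gcls_iso; exists (fun u : fiber P => val u); split=> //.
by exists (fun x => mk_fiber (PX x)) => // u; apply: val_inj.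
Qed.

(** Induction on the list of values in P, each step splitting off one fiber by [fiberU]. *)
Lemma gcls_fibers (P : pred I) : (forall x, P (h x)) ->
  gcls k X = \sum_(i | P i) gcls k (fiber (pred1 i)).
Proof.
move=> PX; rewrite -(fiberT PX) -big_enum /=.
have -> : gcls k (fiber P) = gcls k (fiber [in enum P]).
  by apply: fiber_eq => i; rewrite /= mem_enum.
elim: (enum P) (enum_uniq P) => [_|i r IH /= /andP[ir /IH e]].
  by rewrite big_nil -fiber0; apply: fiber_eq.
rewrite big_cons -e -fiberU; last by move=> j /eqP ->.
by apply: fiber_eq => j; rewrite /= inE.
Qed.
End Fibers.

(** The orbit-stabilizer theorem over T: the isomorphism is read from G/gstab x to X, sending the
    coset of y to y x. Transitivity makes the [pick] in its inverse succeed. *)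
Lemma one_orbit_iso X (x : X) : (forall y, exists g, y = gsact g x) ->
  over_iso X (coset_over (gstab_omap x)).
Proof.
move=> xt; apply: over_iso_sym.
pose f (C : coset_gset (gstab x)) : X := gsact (repr (val C)) x.
have fE y : f (coset_pt _ y) = gsact y x by apply: (coset_over_pt (s := x) (subxx _)).
exists f; split.
- pose f' (y : X) := coset_pt (gstab x) (odflt 1%g [pick g | y == gsact g x]).
  have f'K y : f (f' y) = y.
    rewrite fE; case: pickP => [g /eqP|/=] //.
    by case: (xt y) => g -> /(_ g); rewrite eqxx.
  exists f' => // C; case: (coset_ptP C) => z ->.
  rewrite fE; have := f'K (gsact z x); rewrite /f' fE => e.
  by apply/esym/coset_pt_eqP; rewrite gstabE gsactM e gsactK.
- move=> g C; case: (coset_ptP C) => y ->.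
  by rewrite coset_act_ptE !fE gsactM.
- move=> C; case: (coset_ptP C) => y ->.
  by rewrite fE omapJ /= coset_over_pt // gstab_omap.
Qed.

(* The class of G/S -> T, xS |-> x s, with the junk value 0 if S does not fix s. *)
Definition ccls S (s : T) : groth k T :=
  if @idP (S \subset gstab s) is ReflectT Ss then gcls k (coset_over Ss) else 0.

Lemma cclsE S s (Ss : S \subset gstab s) : ccls S s = gcls k (coset_over Ss).
Proof.
by rewrite /ccls; case: {-}_ / idP => // Ss'; rewrite (bool_irrelevance Ss Ss').
Qed.

(** Sending y to the index of the representative of its orbit is an invariant map, and each of its
    fibers is a single orbit; [gcls_fibers] and [one_orbit_iso] conclude. *)
Lemma orbit_decomposition X (I : finType) (P : pred I) (x : I -> X) :
  gtransversal P x -> gcls k X = \sum_(i | P i) ccls (gstab (x i)) (omap (x i)).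
Proof.
move=> [xs xi].
have xb y : exists i, P i && (y \in gorb (x i)).
  by case: (xs y) => i Pi ey; exists i; rewrite Pi; apply/gorbP.
pose h y := xchoose (xb y).
have hP y : P (h y) by case/andP: (xchooseP (xb y)).
have hy y : exists g, y = gsact g (x (h y)).
  by apply/gorbP; case/andP: (xchooseP (xb y)).
have hE i g : P i -> h (gsact g (x i)) = i.
  move=> Pi; case: (hy (gsact g (x i))) => g' e; apply/esym.
  apply: (xi _ _ (g'^-1 * g)%g) => //.
  by rewrite gsactM [X in _ = gsact _ X]e gsactK.
have hJ g y : h (gsact g y) = h y.
  by case: (hy y) => g' ey; rewrite {1}ey -gsactM hE.
rewrite (gcls_fibers hJ hP); apply: eq_bigr => i Pi.
have hi : pred1 i (h (x i)) by rewrite -[x i]gsact1 hE //=.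
rewrite (cclsE (gstab_omap (x i))); apply: gcls_iso.
have E : forall u : fiber hJ (pred1 i), exists g, u = gsact g (mk_fiber hJ hi).
  move=> u; case: (hy (val u)) => g; have /eqP -> := valP u => eu.
  by exists g; apply: val_inj.
apply: over_iso_trans (one_orbit_iso E) _.
have eS : gstab (mk_fiber hJ hi) = gstab (x i).
  by apply/val_inj/setP=> g; rewrite !inE.
move: (gstab_omap _); rewrite eS /= => Ss.
by rewrite (bool_irrelevance Ss (gstab_omap _)); apply: over_iso_refl.
Qed.

Lemma orbit_decomposition1 X (x : X) : (forall y, exists g, y = gsact g x) ->
  gcls k X = ccls (gstab x) (omap x).
Proof.
move=> xt; have tr : @gtransversal _ X unit predT (fun=> x).
  by split=> [y|[] []//]; exists tt.
by rewrite (orbit_decomposition tr) big_const card_unit /= addr0.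
Qed.

Lemma orbit_decomposition0 X : (X -> False) -> gcls k X = 0.
Proof.
move=> X0; have tr : @gtransversal _ X void predT (fun i : void => match i with end).
  by split=> [y|[]]; case: (X0 y).
by rewrite (orbit_decomposition tr) big1 // => -[].
Qed.

(** Both sides are the G-set G/S, seen from the base points gS and S; the stabilizer of gS is g S
    g^-1. *)
Lemma cclsJ S s g : S \subset gstab s -> ccls (S :^ g^-1)%G (gsact g s) = ccls S s.
Proof.
move=> Ss; rewrite (cclsE Ss).
rewrite (orbit_decomposition1 (X := coset_over Ss) (x := coset_pt S g : coset_gset S)).
  by rewrite gstab_coset_pt /= coset_over_pt.
move=> C; case: (coset_ptP C) => y ->; exists (y * g^-1)%g.
by rewrite coset_act_ptE mulgKV.
Qed.

Lemma ccls_sum X :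
  gcls k X = \sum_(x : X | gcanon x == x) ccls (gstab x) (omap x).
Proof. exact/orbit_decomposition/gcanon_transversal. Qed.

End OrbitDecomposition.

Lemma gsact_coset_pt1 (gT : finGroupType) (S : {group gT}) g :
  (gsact g (coset_pt S 1%g : coset_gset S) == coset_pt S 1%g) = (g \in S).
Proof. by rewrite -gstabE gstab_coset_pt /= invg1 conjsg1. Qed.

(** * Representatives of double cosets *)

Section DoubleCosets.
Variable gT : finGroupType.
Implicit Types (J H K : {group gT}).

Lemma dcosetP J K (x y : gT) :
  reflect (exists j, exists2 k, j \in J /\ k \in K & y = (j * x * k)%g) (y \in (J :* x) * K)%g.
Proof.
apply: (iffP mulsgP) => [[z k /rcosetP[j jJ ->] kK ->]|[j [k [jJ kK] ->]]].
  by exists j; exists k.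
by exists (j * x)%g k => //; apply/rcosetP; exists j.
Qed.

Lemma dcoset_repr J K (x : gT) :
  exists j, exists2 k, j \in J /\ k \in K & repr ((J :* x) * K)%g = (j * x * k)%g.
Proof.
apply/dcosetP; apply: (mem_repr x); apply/dcosetP.
by exists 1%g; exists 1%g => //; rewrite mulg1 mul1g.
Qed.

Lemma dcoset_eq J K (x j k : gT) : j \in J -> k \in K ->
  ((J :* (j * x * k)) * K = (J :* x) * K)%g.
Proof.
move=> jJ kK; apply/setP=> y; apply/dcosetP/dcosetP=> -[j' [k' [j'J k'K] ->]].
  by exists (j' * j)%g; exists (k * k')%g; rewrite ?groupM // !mulgA.
exists (j' * j^-1)%g; exists (k^-1 * k')%g; first by rewrite !groupM ?groupV.
by rewrite !mulgA mulgKV mulgK.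
Qed.

Lemma dcosets_repr J H K (D : {set gT}) : J \subset H -> K \subset H ->
  D \in dcosets J H K -> repr D \in H /\ D = ((J :* repr D) * K)%g.
Proof.
move=> /subsetP sJ /subsetP sK /imsetP[x xH ->].
case: (dcoset_repr J K x) => j [k [jJ kK] e].
split; rewrite e; last by rewrite dcoset_eq.
by apply: groupM (sK _ kK); apply: groupM (sJ _ jJ) xH.
Qed.

Lemma dcosets_transversal J H K x : x \in H ->
  exists2 D, D \in dcosets J H K &
    exists j, exists2 k, j \in J /\ k \in K & x = (j * repr D * k)%g.
Proof.
move=> xH; exists ((J :* x) * K)%g; first exact: imset_f.
case: (dcoset_repr J K x) => j [k [jJ kK] ->].
by exists j^-1%g; exists k^-1%g; rewrite ?groupV // !mulgA mulVg mul1g mulgK.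
Qed.
End DoubleCosets.

Section Omega.
Variable gT : finGroupType.
Implicit Types (H K S : {group gT}) (x y g : gT).
Local Notation Om := (omega gT).

Lemma om_tag H K x y : om H x = om K y -> H = K.
Proof. by move/(congr1 (fun w : Om => tag w)). Qed.

Lemma om_inj H x y : om H x = om H y -> coset_pt H x = coset_pt H y.
Proof. by move/eqP; rewrite -tag_eqE /tag_eq eqxx tagged_asE => /eqP. Qed.

Lemma om_eqP H x y : reflect (om H x = om H y) (x^-1 * y \in H)%g.
Proof.
apply: (iffP (coset_pt_eqP H x y)) => [|/om_inj//].
by rewrite /om => ->.
Qed.

Lemma omP (w : Om) : exists H x, w = om H x.
Proof. by case: w => H C; exists H; case: (coset_ptP C) => x ->; exists x. Qed.

Lemma gstab_om H x : gstab (om H x) = (H :^ x^-1)%G.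
Proof.
apply/val_inj/setP=> g /=; rewrite mem_conjgV inE om_actE eq_sym conjgE.
by apply/eqP/om_eqP.
Qed.

Lemma gstab_pair (X Y : gset gT) (s : X) (t : Y) :
  gstab ((s, t) : prod_gset X Y) = (gstab s :&: gstab t)%G.
Proof. by apply/val_inj/setP=> g; rewrite /= !inE xpair_eqE. Qed.

Lemma gstab_val (X : gset gT) (P : pred X) (PJ : forall g (x : X), P x -> P (gsact g x))
  (u : sub_gset PJ) : gstab u = gstab (val u).
Proof. by apply/val_inj/setP=> g; rewrite /= !inE -(inj_eq val_inj). Qed.

Lemma sub_gstab_om S H K x y : S \subset gstab ((om H x, om K y) : prod_gset Om Om) =
  (S :^ x \subset H)%g && (S :^ y \subset K)%g.
Proof. by rewrite gstab_pair !gstab_om subsetI -!sub_conjg. Qed.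
End Omega.

(** * Products with a transitive span *)

Section SpanProducts.
Variables (gT : finGroupType) (k : comPzRingType) (T : gset gT).
Local Notation TT := (prod_gset T T).
Local Notation B := (span_alg T k).
Implicit Types (S : {group gT}) (s t w : T) (A : gset_over TT).

Definition pcls S (p : TT) : B := ccls k S p.

Lemma span_clsM (X Y : gset_over TT) :
  span_cls k X * span_cls k Y = span_cls k (span_prod X Y).
Proof. exact: (@ga_mulgg _ _ _ (span_product T)). Qed.

(** Since the right leg of A is injective, a point of the fiber product is determined by its
    component in G/S. So the fiber product is one orbit, that of (a, S), and the stabilizer of this
    point is S: an element of S fixes the right leg of a, hence a. *)
Lemma pcls_mull A (a : A) S w : injective (@oright _ _ A) ->
  S \subset gstab ((oright a, w) : TT) ->
  span_cls k A * pcls S (oright a, w) = pcls S (oleft a, w).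
Proof.
move=> rinj Ss; rewrite /pcls (cclsE k Ss).
rewrite [LHS](span_clsM A (coset_over Ss)).
have e C : @oleft _ _ (coset_over Ss) (coset_pt S C) = gsact C (oright a).
  by rewrite /oleft [omap _]coset_over_pt.
have e' C : @oright _ _ (coset_over Ss) (coset_pt S C) = gsact C w.
  by rewrite /oright [omap _]coset_over_pt.
have fp : @fibered _ _ A (coset_over Ss) (a, coset_pt S 1%g).
  by rewrite /fibered /= e gsact1.
rewrite [LHS](orbit_decomposition1 _ (x := mk_pullback fp)) /=.
  rewrite /pullback_map /= e' gsact1; congr (ccls k _ _); apply/val_inj/setP=> g.
  rewrite /= !inE -(inj_eq val_inj) /= xpair_eqE [X in _ && X]gsact_coset_pt1.
  apply/andP/idP => [[]//|gS]; split=> //; apply/eqP/rinj; rewrite orightJ.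
  by move/(subsetP Ss): gS; rewrite gstab_pair inE !gstabE => /andP[/eqP].
case=> -[a' C] /=; case: (coset_ptP C) => y {C}-> ey.
exists y; apply: val_inj => /=; congr pair; last by rewrite [RHS]coset_act_pt mulg1.
by apply: rinj; move/eqP: ey => /= ->; rewrite e orightJ.
Qed.

(** The mirror image of [pcls_mull]. *)
Lemma pcls_mulr A (a : A) S w : injective (@oleft _ _ A) ->
  S \subset gstab ((w, oleft a) : TT) ->
  pcls S (w, oleft a) * span_cls k A = pcls S (w, oright a).
Proof.
move=> linj Ss; rewrite /pcls (cclsE k Ss).
rewrite [LHS](span_clsM (coset_over Ss) A).
have e C : @oright _ _ (coset_over Ss) (coset_pt S C) = gsact C (oleft a).
  by rewrite /oright [omap _]coset_over_pt.
have e' C : @oleft _ _ (coset_over Ss) (coset_pt S C) = gsact C w.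
  by rewrite /oleft [omap _]coset_over_pt.
have fp : @fibered _ _ (coset_over Ss) A (coset_pt S 1%g, a).
  by rewrite /fibered /= e gsact1.
rewrite [LHS](orbit_decomposition1 _ (x := mk_pullback fp)) /=.
  rewrite /pullback_map /= e' gsact1; congr (ccls k _ _); apply/val_inj/setP=> g.
  rewrite /= !inE -(inj_eq val_inj) /= xpair_eqE andbC [X in _ && X]gsact_coset_pt1.
  apply/andP/idP => [[]//|gS]; split=> //; apply/eqP/linj; rewrite oleftJ.
  by move/(subsetP Ss): gS; rewrite gstab_pair inE !gstabE => /andP[_ /eqP].
case=> -[C a'] /=; case: (coset_ptP C) => y {C}-> ey.
exists y; apply: val_inj => /=; congr pair; first by rewrite [RHS]coset_act_pt mulg1.
by apply: linj; move/eqP: ey => /= <-; rewrite e oleftJ.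
Qed.

Lemma pclsJ S (p : TT) g : S \subset gstab p ->
  pcls (S :^ g^-1)%G (gsact g p) = pcls S p.
Proof. exact: cclsJ. Qed.
End SpanProducts.

(** * The Mackey algebra and spans *)

Section Beta.
Variables (gT : finGroupType) (k : comPzRingType).
Local Notation Om := (omega gT).
Local Notation OO := (prod_gset Om Om).
Local Notation B := (span_alg Om k).
Local Notation pcls := (@pcls gT k Om).
Implicit Types (H K L J S : {group gT}) (x y g : gT).

Definition gen_span (x : mgen gT) : gset_over OO :=
  match x with
  | GenT p => span_t (valP p)
  | GenR p => span_r (valP p)
  | GenC g H => span_c g H
  end.

Definition beta_gen (x : mgen gT) : B := span_cls k (gen_span x).

Definition beta_free : freealg k (mgen gT) -> B := free_lift beta_gen.

Lemma beta_free_kmor : is_kmor beta_free. Proof. exact: free_lift_kmor. Qed.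

Lemma beta_free_t H K (sKH : K \subset H) :
  beta_free (free_t k H K) = span_cls k (span_t sKH).
Proof.
rewrite /free_t (@insubT _ (fun p : {group gT} * {group gT} => p.2 \subset p.1) _ (H, K) sKH) /=.
rewrite /beta_free free_lift_gen /=; congr (span_cls k (span_t _)); exact: bool_irrelevance.
Qed.

Lemma beta_free_r H K (sKH : K \subset H) :
  beta_free (free_r k H K) = span_cls k (span_r sKH).
Proof.
rewrite /free_r (@insubT _ (fun p : {group gT} * {group gT} => p.2 \subset p.1) _ (H, K) sKH) /=.
rewrite /beta_free free_lift_gen /=; congr (span_cls k (span_r _)); exact: bool_irrelevance.
Qed.

Lemma beta_free_c g H : beta_free (free_c k g H) = span_cls k (span_c g H).
Proof. exact: free_lift_gen. Qed.

Lemma span_clsE (X : gset_over OO) (x : X) : (forall y : X, exists g, y = gsact g x) ->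
  span_cls k X = pcls (gstab x) (omap x).
Proof. exact: orbit_decomposition1. Qed.

Lemma conjGV1 S : (S :^ 1^-1)%G = S.
Proof. by apply: val_inj; rewrite /= invg1 conjsg1. Qed.

Lemma beta_t H K : K \subset H -> beta_free (free_t k H K) = pcls K (om H 1%g, om K 1%g).
Proof.
move=> sKH; rewrite (beta_free_t sKH) (span_clsE (x := coset_pt K 1%g : span_t sKH)).
  by rewrite span_tE gstab_coset_pt conjGV1.
exact: coset_pt1_orb.
Qed.

Lemma beta_r H K : K \subset H -> beta_free (free_r k H K) = pcls K (om K 1%g, om H 1%g).
Proof.
move=> sKH; rewrite (beta_free_r sKH) (span_clsE (x := coset_pt K 1%g : span_r sKH)).
  by rewrite span_rE gstab_coset_pt conjGV1.
exact: coset_pt1_orb.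
Qed.

Lemma beta_c g H : beta_free (free_c k g H) = pcls H (om (H :^ g^-1)%G g^-1%g, om H 1%g).
Proof.
rewrite beta_free_c (span_clsE (x := coset_pt H 1%g : span_c g H)).
  by rewrite span_cE gstab_coset_pt conjGV1 mul1g.
exact: coset_pt1_orb.
Qed.

Lemma coset_inj (X : Type) K (f : coset_gset K -> X) :
  (forall x y, f (coset_pt K x) = f (coset_pt K y) -> coset_pt K x = coset_pt K y) ->
  injective f.
Proof.
by move=> fi C D; case: (coset_ptP C) => x ->; case: (coset_ptP D) => y -> /fi.
Qed.

Lemma omap_left (X : gset_over OO) (x : X) s t : omap x = (s, t) -> oleft x = s.
Proof. by rewrite /oleft => ->. Qed.
Lemma omap_right (X : gset_over OO) (x : X) s t : omap x = (s, t) -> oright x = t.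
Proof. by rewrite /oright => ->. Qed.

(** With [gen_span_tgt], this makes the fiber product of two non-composable generators empty, as
    their legs land in different components of Omega. *)
Lemma gen_span_src (x : mgen gT) (u : gen_span x) : tag (oright u) = msrc x.
Proof.
by case: x u => [p|p|g H] u; case: (coset_ptP u) => y ->;
  rewrite (omap_right (span_tE _ _)) || rewrite (omap_right (span_rE _ _)) ||
  rewrite (omap_right (span_cE _ _ _)).
Qed.

Lemma gen_span_tgt (x : mgen gT) (u : gen_span x) : tag (oleft u) = mtgt x.
Proof.
by case: x u => [p|p|g H] u; case: (coset_ptP u) => y ->;
  rewrite (omap_left (span_tE _ _)) || rewrite (omap_left (span_rE _ _)) ||
  rewrite (omap_left (span_cE _ _ _)).
Qed.

Lemma beta_t_mull H K S x w : K \subset H -> S \subset gstab ((om K x, w) : OO) ->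
  beta_free (free_t k H K) * pcls S (om K x, w) = pcls S (om H x, w).
Proof.
move=> sKH Ss; rewrite (beta_free_t sKH).
have r y : @oright _ _ (span_t sKH) (coset_pt K y) = om K y.
  exact/omap_right/span_tE.
have l y : @oleft _ _ (span_t sKH) (coset_pt K y) = om H y.
  exact/omap_left/span_tE.
rewrite -r -l pcls_mull ?r //.
by apply: coset_inj => y z; rewrite !r => /om_inj.
Qed.

Lemma beta_c_mull g H S x w : S \subset gstab ((om H x, w) : OO) ->
  beta_free (free_c k g H) * pcls S (om H x, w) =
  pcls S (om (H :^ g^-1)%G (x * g^-1)%g, w).
Proof.
move=> Ss; rewrite beta_free_c.
have r y : @oright _ _ (span_c g H) (coset_pt H y) = om H y.
  exact/omap_right/span_cE.
have l y : @oleft _ _ (span_c g H) (coset_pt H y) = om (H :^ g^-1)%G (y * g^-1)%g.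
  exact/omap_left/span_cE.
rewrite -r -l pcls_mull ?r //.
by apply: coset_inj => y z; rewrite !r => /om_inj.
Qed.

Lemma beta_r_mulr H K S x w : K \subset H -> S \subset gstab ((w, om K x) : OO) ->
  pcls S (w, om K x) * beta_free (free_r k H K) = pcls S (w, om H x).
Proof.
move=> sKH Ss; rewrite (beta_free_r sKH).
have r y : @oright _ _ (span_r sKH) (coset_pt K y) = om H y.
  exact/omap_right/span_rE.
have l y : @oleft _ _ (span_r sKH) (coset_pt K y) = om K y.
  exact/omap_left/span_rE.
rewrite -r -l pcls_mulr ?l //.
by apply: coset_inj => y z; rewrite !l => /om_inj.
Qed.

Lemma beta_c_mulr g H S x w :
  S \subset gstab ((w, om (H :^ g^-1)%G x) : OO) ->
  pcls S (w, om (H :^ g^-1)%G x) * beta_free (free_c k g H) =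
  pcls S (w, om H (x * g)%g).
Proof.
move=> Ss; rewrite beta_free_c.
have r y : @oright _ _ (span_c g H) (coset_pt H y) = om H y.
  exact/omap_right/span_cE.
have l y : @oleft _ _ (span_c g H) (coset_pt H y) = om (H :^ g^-1)%G (y * g^-1)%g.
  exact/omap_left/span_cE.
rewrite -r -{1}(mulgK g x) -l pcls_mulr ?l ?mulgK //.
apply: coset_inj => y z; rewrite !l => /om_inj/coset_pt_eqP h.
apply/coset_pt_eqP; move: h; rewrite /= mem_conjgV conjgE invMg !mulgA invgK.
by rewrite mulVg mul1g mulgKV.
Qed.

Lemma conjGVM S g h : ((S :^ h^-1) :^ g^-1)%G = (S :^ (g * h)^-1)%G.
Proof. by apply: val_inj; rewrite /= -conjsgM invMg. Qed.

(** Starting from the span G/L of c, the factors t and r only replace its left and right legs. *)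
Lemma beta_tcr H K g L : L \subset K -> (L :^ g^-1)%g \subset H ->
  beta_free (free_t k H (L :^ g^-1)%G * free_c k g L * free_r k K L) =
  pcls L (om H g^-1%g, om K 1%g).
Proof.
move=> sLK sLH; have [_ fM _ _] := beta_free_kmor.
by rewrite !fM beta_c beta_t_mull ?beta_r_mulr // sub_gstab_om ?conjsg1 ?subxx ?sLH.
Qed.

(** The orbits of the fiber product of G/J and G/K over G/H are represented by the points (J, xK),
    with x running over J\H/K; the stabilizer of such a point is the intersection of J with x K
    x^-1. *)
Lemma beta_Mackey H J K : J \subset H -> K \subset H ->
  beta_free (free_r k H J) * beta_free (free_t k H K) =
  \sum_(D in dcosets J H K)
     pcls (J :&: K :^ (repr D)^-1)%G (om J 1%g, om K (repr D)).
Proof.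
move=> sJH sKH; rewrite (beta_free_t sKH) (beta_free_r sJH) span_clsM.
set X := span_prod _ _.
have r y : @oright _ _ (span_r sJH) (coset_pt J y) = om H y.
  exact/omap_right/span_rE.
have l y : @oleft _ _ (span_t sKH) (coset_pt K y) = om H y.
  exact/omap_left/span_tE.
have fP x y : (x^-1 * y \in H)%g ->
    @fibered _ _ (span_r sJH) (span_t sKH) (coset_pt J x, coset_pt K y).
  by rewrite /fibered /= r l => h; apply/eqP/om_eqP.
have f1 : @fibered _ _ (span_r sJH) (span_t sKH) (coset_pt J 1, coset_pt K 1)%g.
  by apply: fP; rewrite mulVg.
(* The pair lies in the fiber product as soon as [repr D] is in H, which holds for the double cosets
   summed over; the default point of [insubd] only makes x total. *)
pose x (D : {set gT}) : X := insubd (mk_pullback f1) (coset_pt J 1%g, coset_pt K (repr D)).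
have xE D : D \in dcosets J H K -> val (x D) = (coset_pt J 1%g, coset_pt K (repr D)).
  case/(dcosets_repr sJH sKH) => DH _; rewrite insubdK //.
  by apply: fP; rewrite invg1 mul1g.
have tr : gtransversal [in dcosets J H K] x.
  split=> [y|D D' g DD DD' /(congr1 val)].
    case: y => -[C1 C2] e.
    case: (coset_ptP C1) => a eC1; case: (coset_ptP C2) => b eC2; subst C1 C2.
    have abH : (a^-1 * b \in H)%g.
      by move/eqP: e; rewrite /= r l => /om_eqP.
    case: (dcosets_transversal J K abH) => D DD [j [c [jJ cK] ee]].
    exists D => //; exists (a * j)%g; apply: val_inj.
    rewrite [RHS]/= xE //= /pact /= !coset_act_pt; congr pair.
      by apply/coset_pt_eqP; rewrite mulg1 mulKg.
    have -> : b = (a * j * repr D * c)%g by rewrite -[b](mulKVg a) ee !mulgA.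
    by apply/esym/coset_pt_eqP; rewrite mulKg.
  rewrite [RHS]/= !xE //= /pact /= !coset_act_pt mulg1 => e.
  have /coset_pt_eqP := congr1 fst e; rewrite invg1 mul1g => gJ.
  have /coset_pt_eqP := congr1 snd e; rewrite /= => cK.
  have eD' : repr D' = (g * repr D * ((repr D')^-1 * (g * repr D))^-1)%g.
    by rewrite invMg invgK mulKVg.
  case: (dcosets_repr sJH sKH DD) => _ ->; case: (dcosets_repr sJH sKH DD') => _ ->.
  by rewrite eD' dcoset_eq // groupV.
rewrite /span_cls [LHS](orbit_decomposition _ tr); apply: eq_bigr => D DD.
have -> : omap (x D) = (om J 1%g, om K (repr D)).
  rewrite /= /pullback_map xE //=; congr pair; first exact/omap_left/span_rE.
  exact/omap_right/span_tE.
rewrite gstab_val xE //; congr (ccls k _ _).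
by rewrite gstab_pair !gstab_coset_pt conjGV1.
Qed.

(* Every relation but the Mackey formula composes two spans of which one has *)
(* an injective leg, so that only one orbit arises. *)
Lemma beta_rel (u v : freealg k (mgen gT)) :
  mackey_rel u v -> beta_free u = beta_free v.
Proof.
have [fD fM f1 fK] := beta_free_kmor.
have s1 S H : S \subset H -> (S :^ 1)%g \subset H by rewrite conjsg1.
have sc S H g : S \subset H -> (S :^ g \subset (H :^ g))%g by rewrite conjSg.
have K1 S g : ((S :^ g^-1) :^ g)%g = S :> {set gT} by rewrite -conjsgM mulVg conjsg1.
case=> {u v}.
- by move=> H; rewrite beta_t ?beta_r.
- move=> h H hH; rewrite beta_t // beta_c; congr (pcls _ (_, _)).
  have -> : (H :^ h^-1)%G = H by apply: val_inj; rewrite /= conjGid ?groupV.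
  by apply/om_eqP; rewrite invg1 mul1g groupV.
- move=> H K L sLK sKH; have sLH := subset_trans sLK sKH.
  by rewrite fM (beta_t sLK) (beta_t sLH) beta_t_mull // sub_gstab_om !s1.
- move=> H K L sLK sKH; have sLH := subset_trans sLK sKH.
  by rewrite fM (beta_r sLK) (beta_r sLH) beta_r_mulr // sub_gstab_om !s1.
- move=> g g' H; rewrite fM (beta_c g H) beta_c_mull; last by rewrite sub_gstab_om s1 //= subxx.
  by rewrite (beta_c (g' * g)) conjGVM -invMg.
- move=> g H K sKH; rewrite !fM (beta_t sKH) (beta_c g K) beta_c_mull ?sub_gstab_om ?s1 //.
  by rewrite mul1g beta_t_mull ?sub_gstab_om /= ?K1 ?s1 ?sc.
- move=> g H K sKH; rewrite !fM (beta_r sKH) beta_c_mull ?sub_gstab_om ?s1 //.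
  rewrite beta_r ?sc // beta_c_mulr ?sub_gstab_om ?s1 ?sc // !mul1g.
  (* The two spans are G/K seen from different base points; translating by g matches their legs. *)
  rewrite -(@pclsJ _ _ _ K _ g) ?sub_gstab_om ?s1 ?K1 //=.
  - by rewrite /= /pact !om_actE mulgV mulg1.
  - by rewrite subxx.
- move=> H J K sJH sKH; rewrite fM beta_Mackey // (kmor_sum _ _ _ beta_free_kmor).
  apply: eq_bigr => D DD /=; set x := repr D; set M := (J :^ x :&: K)%G.
  have eM : (J :&: K :^ x^-1)%G = (M :^ x^-1)%G.
    by apply: val_inj; rewrite /= conjIg conjsgK.
  have sM : (M :^ x^-1)%G \subset J by rewrite -eM subsetIl.
  rewrite eM beta_tcr ?subsetIr //.
  rewrite -(@pclsJ _ _ _ M _ x) ?sub_gstab_om ?s1 ?subsetIr //=.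
    by rewrite /pact !om_actE mulgV mulg1.
  by rewrite sM.
- rewrite f1 (kmor_sum _ _ _ beta_free_kmor).
  (* The unit is the diagonal span on Omega, whose orbits are the components G/H. *)
  rewrite [1](@orbit_decomposition _ k _ (span_one Om) {group gT} predT
    (fun H => om H 1%g)).
    by apply: eq_bigr => H _; rewrite beta_t // gstab_om conjGV1.
  split=> [w|H K g _ _]; last by rewrite om_actE => /om_tag.
  by case: (omP w) => H [x ->]; exists H => //; exists x; rewrite om_actE mulg1.
- move=> x y xy; rewrite fM /beta_free !free_lift_gen /beta_gen span_clsM.
  rewrite (kmor0 (free_lift_kmor beta_gen)); apply: orbit_decomposition0 => -[[u v] /eqP e].
  by move: xy; rewrite -(gen_span_src u) -(gen_span_tgt v) [oright u]e eqxx.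
Qed.
End Beta.

(** * The elements t c r of the Mackey algebra *)

Section MackeyBasis.
Variables (gT : finGroupType) (k : comPzRingType).
Local Notation Om := (omega gT).
Local Notation OO := (prod_gset Om Om).
Local Notation B := (span_alg Om k).
Local Notation M := (mackey gT k).
Local Notation mt := (mt k).
Local Notation mr := (mr k).
Local Notation mc := (mc k).
Implicit Types (H K L J S : {group gT}) (x y g h : gT).

Lemma mquotM (u v : freealg k (mgen gT)) :
  quot (@mackey_rel gT k) u * quot (@mackey_rel gT k) v = quot (@mackey_rel gT k) (u * v).
Proof. exact: aq_mulE. Qed.

Lemma mTR H : mt H H = mr H H.
Proof. exact/quot_rel/MackeyTR. Qed.
Lemma mTC h H : h \in H -> mt H H = mc h H.
Proof. by move=> hH; apply/quot_rel/MackeyTC. Qed.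
Lemma mTT H K L : L \subset K -> K \subset H -> mt H K * mt K L = mt H L.
Proof. by move=> *; rewrite [LHS]mquotM; apply/quot_rel/MackeyTT. Qed.
Lemma mRR H K L : L \subset K -> K \subset H -> mr K L * mr H K = mr H L.
Proof. by move=> *; rewrite [LHS]mquotM; apply/quot_rel/MackeyRR. Qed.
Lemma mCC g g' H : mc g' (H :^ g^-1)%G * mc g H = mc (g' * g)%g H.
Proof. by rewrite [LHS]mquotM; apply/quot_rel/MackeyCC. Qed.
Lemma mCT g H K : K \subset H ->
  mc g H * mt H K = mt (H :^ g^-1)%G (K :^ g^-1)%G * mc g K.
Proof. by move=> *; rewrite [LHS]mquotM [RHS]mquotM; apply/quot_rel/MackeyCT. Qed.
Lemma mCR g H K : K \subset H ->
  mc g K * mr H K = mr (H :^ g^-1)%G (K :^ g^-1)%G * mc g H.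
Proof. by move=> *; rewrite [LHS]mquotM [RHS]mquotM; apply/quot_rel/MackeyCR. Qed.
Lemma mRT H J K : J \subset H -> K \subset H ->
  mr H J * mt H K = \sum_(D in dcosets J H K) let x := repr D in
    mt J (J :&: K :^ x^-1)%G * mc x (J :^ x :&: K)%G * mr K (J :^ x :&: K)%G.
Proof.
move=> sJ sK; rewrite [LHS]mquotM (quot_rel (MackeyRT k sJ sK)) rmorph_sum.
by apply: eq_bigr => D _ /=; rewrite -!mquotM.
Qed.
Lemma m1 : \sum_(H : {group gT}) mt H H = 1.
Proof. by rewrite -rmorph_sum; apply/quot_rel/Mackey1. Qed.
Definition mgenq (x : mgen gT) : M := quot (@mackey_rel gT k) (fgen k x).
Lemma mgenT H K (sKH : K \subset H) :
  mt H K = mgenq (GenT (exist _ (H, K) sKH)).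
Proof.
by rewrite /Defs.mt /free_t
  (@insubT _ (fun p : {group gT} * {group gT} => p.2 \subset p.1) _ (H, K) sKH).
Qed.
Lemma mgenR H K (sKH : K \subset H) :
  mr H K = mgenq (GenR (exist _ (H, K) sKH)).
Proof.
by rewrite /Defs.mr /free_r
  (@insubT _ (fun p : {group gT} * {group gT} => p.2 \subset p.1) _ (H, K) sKH).
Qed.
Lemma m0 (x y : mgen gT) : msrc x != mtgt y -> mgenq x * mgenq y = 0.
Proof.
move=> xy; rewrite [LHS]mquotM (quot_rel (Mackey0 k xy)).
exact: (rmorph0 (quot (@mackey_rel gT k))).
Qed.

(* With S <= K and gSg^-1 <= H, the elements mtcr H K g S span the Mackey algebra. *)
Definition mtcr H K g S : M := mt H (S :^ g^-1)%G * mc g S * mr K S.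

(** As c_{h,H} = t^H_H for h in H, conjugating t^H by h does not change it, and this absorbs c_h.
    With [mtcr_conjr], it makes [mtcr] independent of the representatives of the cosets it is built
    from. *)
Lemma mtcr_conjl H K g S h : h \in H -> (S :^ g^-1)%g \subset H ->
  mtcr H K (h * g) S = mtcr H K g S.
Proof.
move=> hH sSH; rewrite /mtcr -mCC.
have -> : (S :^ (h * g)^-1)%G = ((S :^ g^-1) :^ h^-1)%G by rewrite conjGVM.
have eH : (H :^ h^-1)%G = H by apply: val_inj; rewrite /= conjGid ?groupV.
have := mCT h sSH; rewrite eH -(mTC hH) mTT // => e.
by rewrite !mulrA -e.
Qed.

Lemma mtcr_conjr H K g S h : h \in K -> S \subset K ->
  mtcr H K (g * h) (S :^ h)%G = mtcr H K g S.
Proof.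
move=> hK sSK; rewrite /mtcr.
have -> : ((S :^ h) :^ (g * h)^-1)%G = (S :^ g^-1)%G.
  by apply: val_inj; rewrite /= -conjsgM invMg mulKVg.
have eS : ((S :^ h) :^ h^-1)%G = S by apply: val_inj; rewrite /= conjsgK.
have eK : (K :^ h^-1)%G = K by apply: val_inj; rewrite /= conjGid ?groupV.
have sShK : (S :^ h)%G \subset K by rewrite /= -(conjGid hK) conjSg.
have := mCR h sShK; rewrite eS eK -(mTC hK) mTR mRR // => e.
have := mCC h g (S :^ h)%G; rewrite eS => <-.
by rewrite -!mulrA e.
Qed.

(** The preimage under beta of the transitive span G/S over p. The elements a and b are chosen in
    the two cosets of p; [mptE] shows that any others give the same element when S fixes p. *)
Definition mpt S (p : OO) : M :=
  let a := repr (val (tagged p.1)) in let b := repr (val (tagged p.2)) in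
  mtcr (tag p.1) (tag p.2) (a^-1 * b) (S :^ b)%G.

Lemma repr_lcoset H x : exists2 h, h \in H & repr (x *: H)%g = (x * h)%g.
Proof.
by apply/lcosetP; apply: (mem_repr x); rewrite lcoset_refl.
Qed.

Lemma mptE S H K x y : S \subset gstab ((om H x, om K y) : OO) ->
  mpt S (om H x, om K y) = mtcr H K (x^-1 * y) (S :^ y)%G.
Proof.
rewrite sub_gstab_om => /andP[sSH sSK]; rewrite /mpt /=.
case: (repr_lcoset H x) => h hH ->; case: (repr_lcoset K y) => c cK ->.
have -> : ((x * h)^-1 * (y * c) = h^-1 * (x^-1 * y) * c)%g by rewrite invMg !mulgA.
have -> : (S :^ (y * c))%G = ((S :^ y) :^ c)%G by apply: val_inj; rewrite /= conjsgM.
rewrite mtcr_conjr // mtcr_conjl ?groupV //=.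
by rewrite -conjsgM invMg invgK mulKVg.
Qed.

(** Translating both cosets by g cancels in a^-1 b and in the conjugate of S by b. This invariance
    is what allows [mpt] to be summed over orbits. *)
Lemma mptJ S (p : OO) g : S \subset gstab p ->
  mpt (S :^ g^-1)%G (gsact g p) = mpt S p.
Proof.
case: p => w w'; case: (omP w) => H [x ->]; case: (omP w') => K [y ->] Sp.
have e : ((S :^ g^-1) :^ (g * y))%g = (S :^ y)%g.
  by rewrite -conjsgM mulKg.
rewrite [gsact g _]/= /pact !om_actE (mptE Sp) mptE; last first.
  move: Sp; rewrite !sub_gstab_om /= => /andP[sx sy].
  by rewrite -!conjsgM !mulKg sx.
congr (mtcr _ _ _ _); last exact: val_inj.
by rewrite invMg -mulgA mulKg.
Qed.
End MackeyBasis.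

(** * Additive invariants defined orbit by orbit *)

Section OrbitSums.
Variables (gT : finGroupType) (k : comPzRingType) (T : gset gT) (A : kalgType k).
Variable m : {group gT} -> T -> A.
Hypothesis mJ : forall (S : {group gT}) p g, S \subset gstab p ->
  m (S :^ g^-1)%G (gsact g p) = m S p.
Implicit Types X Y : gset_over T.

(** By [mJ] the summand is constant on each orbit, where stabilizers are conjugate, so the choice of
    canonical points is immaterial. *)
Definition orbit_sum X : A := \sum_(x : X | gcanon x == x) m (gstab x) (omap x).

Lemma orbit_sum_transversal X (I : finType) (P : pred I) (x : I -> X) :
  gtransversal P x -> orbit_sum X = \sum_(i | P i) m (gstab (x i)) (omap (x i)).
Proof.
apply: (@sum_transversal _ X _ (fun x => m (gstab x) (omap x))) => g y.
by rewrite gstabJ omapJ mJ // gstab_omap.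
Qed.

Lemma orbit_sum_iso X Y : over_iso X Y -> orbit_sum X = orbit_sum Y.
Proof.
case=> f [[f' fK f'K] fJ fo].
have tr : gtransversal (fun x : X => gcanon x == x) f.
  case: (gcanon_transversal X) => Xs Xi; split=> [y|x x' g cx cx' e].
    case: (Xs (f' y)) => x cx [g e]; exists x => //; exists g.
    by rewrite -fJ -e f'K.
  by apply: (Xi x x' g) => //; apply: (can_inj fK); rewrite e fJ.
rewrite (orbit_sum_transversal tr); apply: eq_bigr => x _.
congr (m _ _); last by rewrite fo.
by apply/val_inj/setP=> g; rewrite /= !inE -fJ (can_eq fK).
Qed.

Lemma orbit_sum_sum X Y : orbit_sum (sum_over X Y) = orbit_sum X + orbit_sum Y.
Proof.
have tr : @gtransversal _ (sum_over X Y) (X + Y)%type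
    (fun p => match p with inl x => gcanon x == x | inr y => gcanon y == y end) id.
  case: (gcanon_transversal X) => Xs Xi; case: (gcanon_transversal Y) => Ys Yi.
  split=> [[x|y]|[x|y] [x'|y'] g c c'] //=.
  - by case: (Xs x) => z cz [g ->]; exists (inl z) => //; exists g.
  - by case: (Ys y) => z cz [g ->]; exists (inr z) => //; exists g.
  - by case=> e; congr inl; apply: (Xi x x' g).
  - by case=> e; congr inr; apply: (Yi y y' g).
rewrite (orbit_sum_transversal tr) big_sumType /=; congr (_ + _).
  by apply: eq_bigr => x _; congr (m _ _); apply/val_inj/setP=> g; rewrite /= !inE.
by apply: eq_bigr => x _; congr (m _ _); apply/val_inj/setP=> g; rewrite /= !inE.
Qed.

Definition orbit_lift : groth k T -> A := galg_lift orbit_sum.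

Lemma orbit_lift_cls X : orbit_lift (gcls k X) = orbit_sum X.
Proof. exact: galg_lift_cls orbit_sum_iso orbit_sum_sum _. Qed.

Lemma orbit_lift_ccls (S : {group gT}) s : S \subset gstab s -> orbit_lift (ccls k S s) = m S s.
Proof.
move=> Ss; rewrite (cclsE k Ss) orbit_lift_cls.
have tr : @gtransversal _ (coset_over Ss) unit predT (fun=> coset_pt S 1%g).
  by split=> [y|[] []//]; exists tt => //; apply: coset_pt1_orb.
rewrite (orbit_sum_transversal tr) big_const card_unit /= addr0.
by rewrite gstab_coset_pt /= coset_over_pt // gsact1 conjGV1.
Qed.
End OrbitSums.

(** * The inverse of beta *)

Section BetaBijective.
Variables (gT : finGroupType) (k : comPzRingType).
Local Notation Om := (omega gT).
Local Notation OO := (prod_gset Om Om).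
Local Notation B := (span_alg Om k).
Local Notation M := (mackey gT k).
Local Notation pcls := (@pcls gT k Om).
Implicit Types (H K L J S : {group gT}) (x y g h : gT).

Definition beta_fun : M -> B := quot_lift (@beta_free gT k).

Lemma beta_quot u : beta_fun (quot (@mackey_rel gT k) u) = beta_free u.
Proof. exact: (quot_liftE (beta_free_kmor _ _) (@beta_rel gT k)). Qed.

Lemma beta_kmor : is_kmor beta_fun.
Proof. exact: (quot_lift_kmor (beta_free_kmor _ _) (@beta_rel gT k)). Qed.

Lemma beta_mtcr H K g S : S \subset K -> (S :^ g^-1)%g \subset H ->
  beta_fun (mtcr k H K g S) = pcls S (om H g^-1%g, om K 1%g).
Proof.
have [_ fM _ _] := beta_kmor; have [_ gM _ _] := beta_free_kmor gT k.
by move=> *; rewrite /mtcr !fM /mt /mc /mr !beta_quot -!gM; apply: beta_tcr.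
Qed.

Lemma beta_mpt S (p : OO) : S \subset gstab p -> beta_fun (mpt k S p) = pcls S p.
Proof.
case: p => w w'; case: (omP w) => H [x ->]; case: (omP w') => K [y ->] Sp.
rewrite mptE //; move: (Sp); rewrite sub_gstab_om => /andP[sx sy].
have e : ((S :^ y) :^ (x^-1 * y)^-1)%g = (S :^ x)%g.
  by rewrite -conjsgM invMg invgK mulKVg.
rewrite beta_mtcr ?e // -(@pclsJ _ _ _ S _ y^-1%g) //= /pact !om_actE invgK mulVg.
by rewrite invMg invgK.
Qed.

Definition beta_inv : B -> M := orbit_lift (@mpt gT k).

Lemma beta_inv_pcls S (p : OO) : S \subset gstab p -> beta_inv (pcls S p) = mpt k S p.
Proof. exact/orbit_lift_ccls/mptJ. Qed.

Lemma beta_inv_cls (X : gset_over OO) :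
  beta_inv (span_cls k X) = orbit_sum (@mpt gT k) X.
Proof. exact/orbit_lift_cls/mptJ. Qed.

Lemma beta_inv0 : beta_inv 0 = 0.
Proof. exact: galg_lift0 (orbit_sum_iso (@mptJ gT k)) (orbit_sum_sum (@mptJ gT k)). Qed.
Lemma beta_invD u v : beta_inv (u + v) = beta_inv u + beta_inv v.
Proof. exact: galg_liftD (orbit_sum_iso (@mptJ gT k)) (orbit_sum_sum (@mptJ gT k)) _ _. Qed.
Lemma beta_invZ a (u : groth k OO) : beta_inv (a *: u) = inK a * beta_inv u.
Proof. exact: galg_liftZ (orbit_sum_iso (@mptJ gT k)) (orbit_sum_sum (@mptJ gT k)) _ _. Qed.

Lemma beta_invK : cancel beta_inv beta_fun.
Proof.
have [fD fM f1 fK] := beta_kmor.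
elim/groth_ind=> [X||u v eu ev|a u eu].
- rewrite [beta_inv _]beta_inv_cls (kmor_sum _ _ _ beta_kmor) [RHS]ccls_sum.
  by apply: eq_bigr => x _; rewrite beta_mpt // gstab_omap.
- by rewrite beta_inv0 (kmor0 beta_kmor).
- by rewrite beta_invD fD eu ev.
- by rewrite beta_invZ fM fK eu ga_inKE.
Qed.

Definition tcr_span (u : M) := exists v, beta_inv v = u.

Lemma tcr_span0 : tcr_span 0.
Proof. by exists 0; rewrite beta_inv0. Qed.
Lemma tcr_spanD u v : tcr_span u -> tcr_span v -> tcr_span (u + v).
Proof. by case=> u' <- [v' <-]; exists (u' + v'); rewrite beta_invD. Qed.
Lemma tcr_spanZ a u : tcr_span u -> tcr_span (inK a * u).
Proof. by case=> u' <-; exists (a *: (u' : groth k OO)); rewrite beta_invZ. Qed.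
Lemma tcr_span_sum I r (P : pred I) (F : I -> M) :
  (forall i, P i -> tcr_span (F i)) -> tcr_span (\sum_(i <- r | P i) F i).
Proof. by move=> PF; elim/big_ind: _ => //; [exact: tcr_span0|exact: tcr_spanD]. Qed.

Lemma tcr_span_mtcr H K g S : S \subset K -> (S :^ g^-1)%g \subset H ->
  tcr_span (mtcr k H K g S).
Proof.
move=> sSK sSH; exists (pcls S (om H g^-1%g, om K 1%g)).
have Ss : S \subset gstab ((om H g^-1%g, om K 1%g) : OO).
  by rewrite sub_gstab_om sSH conjsg1.
rewrite beta_inv_pcls // mptE // invgK mulg1; congr mtcr.
by apply: val_inj; rewrite /= conjsg1.
Qed.

(** A generator t merges with the t on the left, a generator c passes through it and merges with the
    middle c, and a generator r meets it in the Mackey formula. A non-composable generator gives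
    0. *)
Lemma tcr_span_gen (x : mgen gT) H K g S : S \subset K -> (S :^ g^-1)%g \subset H ->
  tcr_span (mgenq k x * mtcr k H K g S).
Proof.
move=> sSK sSH; case: (eqVneq (msrc x) H) => [e|xH]; last first.
  by rewrite /mtcr (mgenT k sSH) !mulrA m0 // !mul0r; apply: tcr_span0.
subst H; case: x sSH => [[[H' H] /= sH]|[[H J] /= sJ]|g' H] /= sSH.
- rewrite -mgenT /mtcr !mulrA mTT //.
  by apply: tcr_span_mtcr => //; apply: subset_trans sH.
- rewrite -mgenR /mtcr !mulrA mRT // !mulr_suml; apply: tcr_span_sum => D _.
  (* The r produced by the Mackey formula is carried to the right across c_g. This replaces N by its
     conjugate N^g inside S, and c_x then meets c_g and gives c_{xg}. *)
  set x := repr D; set S' := (S :^ g^-1)%G; set N := (J :^ x :&: S')%G.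
  have sNg : (N :^ g)%G \subset S.
    by rewrite /= sub_conjg; apply: subsetIr.
  have eN : ((N :^ g) :^ g^-1)%G = N by apply: val_inj; rewrite /= conjsgK.
  have eCR : mc k g (N :^ g)%G * mr k S (N :^ g)%G = mr k S' N * mc k g S.
    by rewrite -[N in RHS]eN; apply: mCR.
  have eCC : mc k x N * mc k g (N :^ g)%G = mc k (x * g)%g (N :^ g)%G.
    by rewrite -[N in mc k x N]eN; apply: mCC.
  have eN' : (J :&: S' :^ x^-1)%G = ((N :^ g) :^ (x * g)^-1)%G.
    by apply: val_inj; rewrite /= invMg -[RHS]conjsgM mulKVg conjIg conjsgK.
  rewrite /= -/x -/S' -/N -(mulrA _ (Defs.mr k S' N)) -eCR.
  rewrite -!mulrA mRR // (mulrA (Defs.mc k x N)) eCC eN' mulrA.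
  apply: tcr_span_mtcr; first exact: subset_trans sNg sSK.
  by rewrite -[(_ :^ _)%g]/(gval ((N :^ g) :^ (x * g)^-1)%G) -eN' subsetIl.
- rewrite -/(Defs.mc k g' H) /mtcr !mulrA mCT // -(mulrA _ (Defs.mc k g' _)) mCC.
  by rewrite conjGVM; apply: tcr_span_mtcr; rewrite //= invMg conjsgM conjSg.
Qed.

(** The image of [beta_inv] is stable under left multiplication by generators, hence, by induction
    on formal expressions, by every element; as it contains 1, it contains u = u 1. *)
Lemma beta_inv_surj u : exists v, beta_inv v = u.
Proof.
have gP (x : mgen gT) v : tcr_span v -> tcr_span (mgenq k x * v).
  case=> z <-; rewrite /beta_inv; elim/groth_ind: z => [X||z z' Hz Hz'|a z Hz].
  - rewrite [orbit_lift _ _]beta_inv_cls mulr_sumr; apply: tcr_span_sum => y _.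
    move: (gstab_omap y); case: (omap y) => w w'.
    case: (omP w) => H [b ->]; case: (omP w') => K [c ->] Sy.
    rewrite mptE //; move: Sy; rewrite sub_gstab_om => /andP[sb sc].
    by apply: tcr_span_gen => //; rewrite /= -conjsgM invMg invgK mulKVg.
  - by rewrite [orbit_lift _ _]beta_inv0 mulr0; apply: tcr_span0.
  - by rewrite [orbit_lift _ _]beta_invD mulrDr; apply: tcr_spanD.
  - by rewrite [orbit_lift _ _]beta_invZ mulrA -inKC -mulrA; apply: tcr_spanZ.
have s1 : tcr_span 1.
  rewrite -m1; apply: tcr_span_sum => H _.
  have := @tcr_span_mtcr H H 1%g H; rewrite invg1 conjsg1 subxx => /(_ isT isT).
  by rewrite /mtcr conjGV1 -(mTC k (group1 H)) -mTR !mTT.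
have uP (e : aexp k (mgen gT)) v : tcr_span v ->
    tcr_span (quot (@mackey_rel gT k) (facls e) * v).
  elim: e v => [x|a|e IHe e' IHe'|e IHe e' IHe'] v sv.
  - exact: gP.
  - exact: tcr_spanZ.
  - rewrite -fa_plusE (raddfD (quot (@mackey_rel gT k))) mulrDl.
    by apply: tcr_spanD; [apply: IHe|apply: IHe'].
  - by rewrite -[facls _]fa_mulE -mquotM -mulrA; apply: IHe; apply: IHe'.
rewrite -[u]mulr1; elim/aq_ind: u => f; elim/fa_ind: f => e; exact: uP.
Qed.

Lemma beta_funK : cancel beta_fun beta_inv.
Proof. by move=> u; case: (beta_inv_surj u) => v <-; rewrite beta_invK. Qed.
End BetaBijective.

(** * Crossed G-sets *)

Section CrossedSpans.
Variables (gT : finGroupType) (k : comPzRingType) (T : gset gT).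
Local Notation TT := (prod_gset T T).
Local Notation B := (span_alg T k).
Local Notation Bc := (crossed_burnside gT k).
Local Notation Gc := (conj_gset gT).
Implicit Types (X Y : gset_over Gc) (Z : gset_over TT).
Implicit Types (H K L J S : {group gT}).

Definition grade X (x : X) : gT := omap x.

Lemma gradeJ X g (x : X) : grade (gsact g x) = (g * grade x * g^-1)%g.
Proof. by rewrite /grade omapJ. Qed.

Section CrossedSpan.
Variable X : gset_over Gc.
Definition twist (p : prod_gset X T) : T := gsact (grade p.1)^-1%g p.2.
Lemma twistJ g p : twist (gsact g p) = gsact g (twist p).
Proof.
by rewrite /twist /= gradeJ -!gsactM !invMg invgK -!mulgA mulVg mulg1.
Qed.
(* With grade p.1 in place of its inverse, zeta would send [L,a] to a sum of *)
(* elements with c_{w^-1 a^-1 w}. *)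
Definition crossed_span : gset_over (prod_gset T T) :=
  @mk_span gT T (prod_gset X T) twist snd twistJ (fun _ _ => erefl).
End CrossedSpan.

Local Notation cspan := crossed_span.

Lemma crossed_span_iso X Y : over_iso X Y -> over_iso (cspan X) (cspan Y).
Proof.
case=> f [[f' fK f'K] fJ fo]; exists (fun p : X * T => (f p.1, p.2)); split.
- by exists (fun p : Y * T => (f' p.1, p.2)) => -[x w] /=; rewrite ?fK ?f'K.
- by move=> g [x w]; rewrite /= /pact /= fJ.
- by case=> x w; rewrite /= /twist /grade /= fo.
Qed.

Lemma crossed_span_sum X Y :
  over_iso (cspan (sum_over X Y)) (sum_over (cspan X) (cspan Y)).
Proof.
exists (fun p : (X + Y) * T =>
  match p.1 with inl x => inl (x, p.2) | inr y => inr (y, p.2) end); split.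
- exists (fun q : (X * T) + (Y * T) => match q with
    inl p => (inl p.1, p.2) | inr p => (inr p.1, p.2) end).
    by case=> -[].
  by case=> -[].
- by move=> g [[x|y] z].
- by case=> [[x|y] z].
Qed.

Lemma crossed_span_one : over_iso (cspan (crossed_one gT)) (span_one T).
Proof.
exists (fun p : unit * T => p.2); split=> //.
- by exists (fun w : T => (tt, w)); [case=> -[]|].
- by case=> -[] w; rewrite /= /twist /grade /= invg1 gsact1.
Qed.

(* The two factors appear in the opposite order in the composed span, whence the *)
(* move y |-> (grade x) y. *)
Lemma crossed_span_prod X Y :
  over_iso (cspan (crossed_prod X Y)) (span_prod (cspan X) (cspan Y)).
Proof.
have fP (p : X * Y * T) : let y := gsact (grade p.1.1) p.1.2 in
    @fibered _ _ (cspan X) (cspan Y)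
      ((p.1.1, gsact (grade y)^-1%g p.2), (y, p.2)).
  by rewrite /fibered.
exists (fun p : X * Y * T => mk_pullback (fP p)); split.
- exists (fun q : span_prod (cspan X) (cspan Y) =>
    (((val q).1.1, gsact (grade (val q).1.1)^-1%g (val q).2.1), (val q).2.2)).
    by case=> -[x y] w /=; rewrite gsactK.
  case=> -[[x w'] [y w]] e; apply: val_inj => /=; rewrite gsactKV; congr (_, _, _).
  exact/esym/(eqP e).
- move=> g [[x y] w]; apply: val_inj; rewrite /= /pact /=.
  have ey : gsact (grade (gsact g x)) (gsact g y) = gsact g (gsact (grade x) y).
    by rewrite gradeJ -!gsactM mulgKV.
  by rewrite ey; congr (_, _, _); apply: (@twistJ Y g (gsact (grade x) y, w)).
- case=> -[x y] w; rewrite /= /pullback_map /= /oleft /oright /= /twist /=.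
  congr (_, _); rewrite -[LHS]gsactM gradeJ -!invMg; congr (gsact _^-1%g _).
  by rewrite mulgKV.
Qed.

(** A point ((x, w), z) of the left side has w equal to the left leg of z, so both sides are copies
    of X times Z. The legs agree once z is replaced by its translate by the inverse of the grade of
    x. *)
Lemma crossed_span_central X Z :
  over_iso (span_prod (cspan X) Z) (span_prod Z (cspan X)).
Proof.
have fP (p : span_prod (cspan X) Z) : @fibered _ _ Z (cspan X)
    (gsact (grade (val p).1.1)^-1%g (val p).2, ((val p).1.1, oright (val p).2)).
  by rewrite /fibered orightJ.
have gP (p : span_prod Z (cspan X)) :
    let z := gsact (grade (val p).2.1) (val p).1 in
    @fibered _ _ (cspan X) Z (((val p).2.1, oleft z), z).
  by rewrite /fibered.
exists (fun p => mk_pullback (fP p)); split.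
- exists (fun p => mk_pullback (gP p)).
    case=> -[[x w] z] e; apply: val_inj => /=; rewrite gsactKV; congr (_, _, _).
    exact/esym/(eqP e).
  case=> -[z [x w]] e; apply: val_inj => /=; rewrite gsactK; congr (_, (_, _)).
  by rewrite orightJ (eqP e) /= /oleft /= /twist /= -[LHS]gsactM mulgV gsact1.
- move=> g [[[x w] z] e]; apply: val_inj; rewrite /= /pact /= orightJ; congr (_, _).
  by rewrite gradeJ -!gsactM !invMg invgK -!mulgA mulVg mulg1.
- case=> -[[x w] z] e; rewrite /= /pullback_map /= oleftJ; congr (_, _).
  by rewrite -(eqP e).
Qed.

Definition crossed_to_span : Bc -> B := galg_lift (fun X => span_cls k (cspan X)).

Lemma crossed_to_span_iso X Y : over_iso X Y ->
  span_cls k (cspan X) = span_cls k (cspan Y).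
Proof. by move=> XY; apply/gcls_iso/crossed_span_iso. Qed.
Lemma crossed_to_span_sum X Y :
  span_cls k (cspan (sum_over X Y)) = span_cls k (cspan X) + span_cls k (cspan Y).
Proof. by rewrite -[RHS]gcls_sum; apply/gcls_iso/crossed_span_sum. Qed.

Lemma crossed_to_span_kmor : is_kmor crossed_to_span.
Proof.
apply: galg_lift_kmor; [exact: crossed_to_span_iso|exact: crossed_to_span_sum| |].
- by move=> X Y; rewrite span_clsM; apply/gcls_iso/crossed_span_prod.
- exact/gcls_iso/crossed_span_one.
Qed.

Lemma crossed_to_span_cls X :
  crossed_to_span (gcls k X) = span_cls k (cspan X).
Proof. exact: galg_lift_cls crossed_to_span_iso crossed_to_span_sum _. Qed.

Lemma crossed_to_span_central b : crossed_to_span b \in @central k B.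
Proof.
have [fD fM f1 fK] := crossed_to_span_kmor.
apply/centralP => v; elim/groth_ind: b => [X||b b' Hb Hb'|a b Hb].
- rewrite crossed_to_span_cls; elim/groth_ind: v => [Z||v v' Hv Hv'|a v Hv].
  + apply: etrans (span_clsM k (cspan X) Z) _; apply/esym.
    apply: etrans (span_clsM k Z (cspan X)) _.
    exact/esym/gcls_iso/crossed_span_central.
  + by rewrite mulr0 mul0r.
  + by rewrite [LHS]mulrDr [RHS]mulrDl Hv Hv'.
  + by rewrite -(ga_inKE (M := span_product T)) mulrA -inKC -!mulrA Hv.
- by rewrite (kmor0 crossed_to_span_kmor) mul0r mulr0.
- by rewrite fD mulrDl mulrDr Hb Hb'.
- by rewrite -(ga_inKE (M := crossed_product gT)) fM fK -mulrA Hb !mulrA inKC.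
Qed.

End CrossedSpans.

Lemma om_act_om (gT : finGroupType) g (H : {group gT}) x :
  om_act g (om H x) = om H (g * x)%g.
Proof. exact: om_actE. Qed.

(** * The map zeta and its formula *)

Section Zeta.
Variables (gT : finGroupType) (k : comPzRingType).
Local Notation Om := (omega gT).
Local Notation OO := (prod_gset Om Om).
Local Notation B := (span_alg Om k).
Local Notation M := (mackey gT k).
Local Notation Bc := (crossed_burnside gT k).
Local Notation cspan := (crossed_span Om).
Implicit Types (H K L J S : {group gT}).

Definition zeta_fun : Bc -> M := @beta_inv gT k \o @crossed_to_span gT k Om.

Lemma zeta_kmor : is_kmor zeta_fun.
Proof.
apply: kmor_comp (@crossed_to_span_kmor gT k Om).
exact: kmor_can (@beta_funK gT k) (@beta_invK gT k) (beta_kmor gT k).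
Qed.

Lemma zeta_central b : zeta_fun b \in @central k M.
Proof.
apply/centralP => u; apply: (can_inj (@beta_funK gT k)).
have [_ fM _ _] := beta_kmor gT k; rewrite !fM /zeta_fun /= beta_invK.
by have /centralP -> := @crossed_to_span_central gT k Om b.
Qed.

(** The orbits of the product of G/L with Omega are represented by the points (L, wU), with w in
    L\G/U. The legs at this point are a^-1 w U and w U, so the middle factor of [mpt] is c with
    (a^-1 w)^-1 w = w^-1 a w. *)
Lemma zeta_funE L (a : gT) (aL : a \in 'C(L)%g) :
  zeta_fun (crossed_cls k aL) = zeta_formula k L a.
Proof.
rewrite /zeta_fun /= [crossed_to_span _ _]crossed_to_span_cls beta_inv_cls.
pose x (p : {group gT} * {set gT}) : cspan (crossed_coset aL) :=
  (coset_pt L 1%g, om p.1 (repr p.2)).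
have tr : gtransversal (fun p : {group gT} * {set gT} => p.2 \in dcosets L [set: gT] p.1) x.
  split=> [[C w]|[U D] [U' D'] g /= DD DD'].
    case: (coset_ptP C) => b {C}->; case: (omP w) => U [y {w}->].
    have := @dcosets_transversal _ L [set: gT]%G U (b^-1 * y)%g (in_setT _).
    case=> D DD [j [c [jL cU] e]]; exists (U, D) => //; exists (b * j)%g.
    rewrite /x [RHS]/= /pact /= coset_act_pt om_act_om; congr pair.
      by apply/coset_pt_eqP; rewrite mulg1 mulKg.
    have -> : y = (b * j * repr D * c)%g by rewrite -[LHS](mulKVg b) e !mulgA.
    by apply/esym/om_eqP; rewrite mulKg.
  rewrite /x [RHS]/= /pact /= coset_act_pt mulg1 om_act_om => e.
  have /coset_pt_eqP := congr1 fst e; rewrite invg1 mul1g => gL.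
  have eU : U' = U by have /om_tag := congr1 snd e.
  subst U'; congr pair; have /om_eqP := congr1 snd e; rewrite /= => cU.
  have eD' : repr D' = (g * repr D * ((repr D')^-1 * (g * repr D))^-1)%g.
    by rewrite invMg invgK mulKVg.
  case: (dcosets_repr (H := [set: gT]%G) (subsetT _) (subsetT _) DD) => _ ->.
  case: (dcosets_repr (H := [set: gT]%G) (subsetT _) (subsetT _) DD') => _ ->.
  by rewrite eD' dcoset_eq // groupV.
rewrite (orbit_sum_transversal (@mptJ gT k) tr) /zeta_formula pair_big_dep.
apply: eq_bigr => -[U D] _; cbv zeta beta; rewrite [(U, D).1]/= [(U, D).2]/=.
set w := repr D; set S := (L :^ w :&: U)%G.
have eS : gstab (x (U, D)) = (S :^ w^-1)%G.
  rewrite /x gstab_pair gstab_coset_pt gstab_om /= conjGV1.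
  by apply: val_inj; rewrite /= conjIg conjsgK.
have eo : omap (x (U, D)) = (om U (a^-1 * w)%g, om U w).
  have ea : grade (coset_pt L 1%g : crossed_coset aL) = a.
    by apply: etrans (trans_map_pt aL 1%g) _; apply: conjL1.
  rewrite -om_actE; apply: (congr1 (fun b => (gsact b^-1%g (om U w), om U w)) ea).
have sx : gstab (x (U, D)) \subset gstab ((om U (a^-1 * w)%g, om U w) : OO).
  by rewrite -eo; apply: gstab_omap.
rewrite eo mptE // eS invMg invgK /mtcr.
have -> : ((S :^ w^-1) :^ w)%G = S by apply: val_inj; rewrite /= -conjsgM mulVg conjsg1.
(* Since a centralizes L, its conjugate w^-1 a w centralizes L^w and therefore normalizes S. *)
suff -> : (S :^ (w^-1 * a * w)^-1)%G = S by [].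
apply/val_inj/normP; rewrite groupV; apply: (subsetP (cent_sub _)).
apply: (subsetP (centS (subsetIl (L :^ w)%g U))); rewrite centJ.
by rewrite -mulgA -conjgE memJ_conjg.
Qed.
End Zeta.

Lemma big_sig_val (V : nmodType) (I : finType) (P Q : pred I) (F : I -> V) :
  \sum_(u : {x | P x} | Q (val u)) F (val u) = \sum_(x | P x && Q x) F x.
Proof.
rewrite (reindex_omap (fun u : {x | P x} => val u) insub) => [|x /andP[Px _]].
  by apply: eq_bigl => u; rewrite valK eqxx andbT (valP u).
by rewrite insubT.
Qed.

(** * Coordinates in the group algebra and in permutation modules *)

Section GroupAlgebraFacts.
Variables (gT : finGroupType) (k : comPzRingType).
Local Notation kG := (groupalg gT k).
Implicit Types (a b : kG) (g h x y : gT).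

Lemma groupalgP a b : (forall g, coef a g = coef b g) -> a = b.
Proof. by move=> ab; apply/ffunP. Qed.

Lemma gcoefD a b g : coef (a + b) g = coef a g + coef b g.
Proof. exact: ffunE. Qed.

Lemma gcoef0 g : coef (0 : kG) g = 0.
Proof. exact: ffunE. Qed.

Lemma gcoef_sum I r (P : pred I) (F : I -> kG) g :
  coef (\sum_(i <- r | P i) F i) g = \sum_(i <- r | P i) coef (F i) g.
Proof. by elim/big_rec2: _ => [|i y1 y2 _ <-]; rewrite ?gcoef0 ?gcoefD. Qed.

Lemma gcoef_gelt x g : coef (gelt k x) g = (g == x)%:R.
Proof. exact: ffunE. Qed.

Lemma gcoefM a b g : coef (a * b) g = \sum_x coef a x * coef b (x^-1 * g)%g.
Proof. exact: ffunE. Qed.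

Lemma permmodP (X : gset gT) (u v : permmod k X) :
  (forall w, (u : {ffun X -> k}) w = (v : {ffun X -> k}) w) -> u = v.
Proof. by move=> uv; apply/ffunP. Qed.

Lemma permmod_scaleE (X : gset gT) a (u : permmod k X) (w : X) :
  (a *: u : {ffun X -> k}) w = \sum_g coef a g * (u : {ffun X -> k}) (gsact g^-1%g w).
Proof. exact: ffunE. Qed.

Lemma permmod_addE (X : gset gT) (u v : permmod k X) (w : X) :
  (u + v : {ffun X -> k}) w = (u : {ffun X -> k}) w + (v : {ffun X -> k}) w.
Proof. exact: ffunE. Qed.

Lemma permmod0E (X : gset gT) (w : X) : (0 : permmod k X) w = 0 :> k.
Proof. exact: ffunE. Qed.

Lemma ptE (X : gset gT) (w w' : X) : (pt k w : {ffun X -> k}) w' = (w' == w)%:R.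
Proof. exact: ffunE. Qed.

Lemma permmod_sumE (X : gset gT) I r (P : pred I) (F : I -> permmod k X) (w : X) :
  (\sum_(i <- r | P i) F i : {ffun X -> k}) w =
  \sum_(i <- r | P i) (F i : {ffun X -> k}) w.
Proof. by elim/big_rec2: _ => [|i y1 y2 _ <-]; rewrite ?permmod0E ?permmod_addE. Qed.

Lemma gelt_scale (X : gset gT) g (u : permmod k X) (w : X) :
  (gelt k g *: u : {ffun X -> k}) w = (u : {ffun X -> k}) (gsact g^-1%g w).
Proof.
rewrite permmod_scaleE (bigD1 g) //= gcoef_gelt eqxx mul1r big1 ?addr0 // => h hg.
by rewrite gcoef_gelt (negPf hg) mul0r.
Qed.

Lemma gelt_scale_pt (X : gset gT) g (w : X) :
  gelt k g *: (pt k w : permmod k X) = pt k (gsact g w).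
Proof.
apply: permmodP => w'; rewrite gelt_scale !ptE.
by rewrite (can2_eq (gsactKV g) (gsactK g)).
Qed.

Lemma gcoef_geltM g a h : coef (gelt k g * a) h = coef a (g^-1 * h)%g.
Proof.
rewrite gcoefM (bigD1 g) //= gcoef_gelt eqxx mul1r big1 ?addr0 // => x hg.
by rewrite gcoef_gelt (negPf hg) mul0r.
Qed.

Lemma gcoefM_gelt g a h : coef (a * gelt k g) h = coef a (h * g^-1)%g.
Proof.
rewrite gcoefM (bigD1 (h * g^-1)%g) //= gcoef_gelt invMg invgK mulgKV eqxx mulr1.
rewrite big1 ?addr0 // => x hg; rewrite gcoef_gelt; case: eqP => [e|_]; last by rewrite mulr0.
by rewrite -e invMg invgK mulKVg eqxx in hg.
Qed.

Lemma geltM g h : gelt k g * gelt k h = gelt k (g * h)%g.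
Proof.
apply: groupalgP => x; rewrite gcoef_geltM !gcoef_gelt; congr (_%:R).
by rewrite (can2_eq (mulKVg g) (mulKg g)).
Qed.

Lemma gelt1 : gelt k (1 : gT)%g = 1.
Proof. by []. Qed.

Lemma inK_scale (X : gset gT) (c : k) (u : permmod k X) (w : X) :
  ((inK c : kG) *: u : {ffun X -> k}) w = c * (u : {ffun X -> k}) w.
Proof. exact: gp_inKl. Qed.

Lemma permmod_expand (X : gset gT) (u : permmod k X) :
  u = \sum_w (inK ((u : {ffun X -> k}) w) : kG) *: (pt k w : permmod k X).
Proof.
apply: permmodP => w; rewrite permmod_sumE (bigD1 w) //= inK_scale ptE eqxx mulr1.
rewrite big1 ?addr0 // => w' ww'; rewrite inK_scale ptE eq_sym (negPf ww') mulr0 //.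
Qed.

(** The anti-automorphism induced by inversion in G. It accounts for the inverse in the action of
    c_{g,H}, which sends xH to the coset of x g^-1. *)
Definition antipode a : kG := [ffun g => coef a g^-1%g].

Lemma gcoef_antipode a g : coef (antipode a) g = coef a g^-1%g.
Proof. exact: ffunE. Qed.
Lemma antipodeK : involutive antipode.
Proof. by move=> a; apply: groupalgP => g; rewrite !gcoef_antipode invgK. Qed.
Lemma antipodeD a b : antipode (a + b) = antipode a + antipode b.
Proof. by apply: groupalgP => g; rewrite !(gcoef_antipode, gcoefD). Qed.
Lemma antipode_inK c : antipode (inK c) = inK c.
Proof.
by apply: groupalgP => g; rewrite gcoef_antipode /coef !ffunE eq_invg1.
Qed.
Lemma antipodeM a b : antipode (a * b) = antipode b * antipode a.
Proof.
apply: groupalgP => y; rewrite gcoef_antipode !gcoefM (reindex_inj (mulgI y^-1%g)) /=.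
by apply: eq_bigr => x _; rewrite !gcoef_antipode !invMg !invgK mulgK mulrC.
Qed.
Lemma antipode_central a : a \in @central k kG -> antipode a \in @central k kG.
Proof.
move=> /centralP ac; apply/centralP => b.
by rewrite -[b]antipodeK -!antipodeM ac.
Qed.
End GroupAlgebraFacts.

(** * The map phi_1 *)

Section Phi1.
Variables (gT : finGroupType) (k : comPzRingType).
Local Notation kG := (groupalg gT k).
Local Notation Gc := (conj_gset gT).
Implicit Types (X Y : gset_over Gc).

Definition grade_sum X : kG := \sum_(x : X) gelt k (grade x).

Lemma grade_sum_iso X Y : over_iso X Y -> grade_sum X = grade_sum Y.
Proof.
case=> f [fb _ fo]; rewrite /grade_sum (reindex f) /=; last exact: onW_bij.
by apply: eq_bigr => x _; rewrite /grade fo.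
Qed.

Lemma grade_sum_sum X Y : grade_sum (sum_over X Y) = grade_sum X + grade_sum Y.
Proof. by rewrite /grade_sum big_sumType. Qed.

Definition phi1_fun : crossed_burnside gT k -> kG := galg_lift grade_sum.

Lemma phi1_kmor : is_kmor phi1_fun.
Proof.
apply: galg_lift_kmor; [exact: grade_sum_iso|exact: grade_sum_sum| |].
- move=> X Y; rewrite /grade_sum mulr_suml.
  under [RHS]eq_bigr => x _ do rewrite mulr_sumr.
  by rewrite pair_bigA /=; apply: eq_bigr => -[x y] _; rewrite geltM.
- by rewrite /grade_sum (big_pred1 tt) => [|[]].
Qed.

Lemma phi1_cls X : phi1_fun (gcls k X) = grade_sum X.
Proof. exact: galg_lift_cls grade_sum_iso grade_sum_sum _. Qed.

(** The grade is equivariant, so conjugating the sum of the grades by y only permutes the points of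
    X. *)
Lemma phi1_central b : phi1_fun b \in @central k kG.
Proof.
have [fD fM f1 fK] := phi1_kmor.
apply/centralP => v; elim/groth_ind: b => [X||b b' Hb Hb'|a b Hb].
- rewrite phi1_cls /grade_sum mulr_suml mulr_sumr; apply: groupalgP => y.
  rewrite !gcoef_sum (reindex_inj (can_inj (gsactK y))) /=; apply: eq_bigr => x _.
  rewrite gcoef_geltM gcoefM_gelt gradeJ; congr (coef v _).
  by rewrite !invMg invgK mulgA mulgKV.
- by rewrite (kmor0 phi1_kmor) mul0r mulr0.
- by rewrite fD mulrDl mulrDr Hb Hb'.
- by rewrite -(ga_inKE (M := crossed_product gT)) fM fK -mulrA Hb !mulrA inKC.
Qed.

Lemma phi1_funE (L : {group gT}) (a : gT) (aL : a \in 'C(L)%g) :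
  phi1_fun (crossed_cls k aL) = phi1_formula k L a.
Proof.
rewrite [phi1_fun _]phi1_cls /phi1_formula /grade_sum.
rewrite [LHS](big_sig_val _ predT (fun C => gelt k (conjL (repr C) a))).
by apply: eq_bigl => C; rewrite andbT.
Qed.
End Phi1.

(** * Yoshida's algebra *)

Section SpanToEnd.
Variables (gT : finGroupType) (k : comPzRingType) (T : gset gT).
Local Notation TT := (prod_gset T T).
Local Notation kG := (groupalg gT k).
Local Notation kT := (permmod k T).
Local Notation E := (endalg kT).
Implicit Types (X Y : gset_over TT) (u v : kT) (f : E).

Definition pmval u (w : T) : k := (u : {ffun T -> k}) w.

Lemma pmvalP u v : (forall w, pmval u w = pmval v w) -> u = v.
Proof. exact: permmodP. Qed.
Lemma pmvalD u v w : pmval (u + v) w = pmval u w + pmval v w.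
Proof. exact: permmod_addE. Qed.
Lemma pmval0 w : pmval 0 w = 0.
Proof. exact: permmod0E. Qed.
Lemma pmval_pt w w' : pmval (pt k w) w' = (w' == w)%:R.
Proof. exact: ptE. Qed.
Lemma pmvalZ (a : kG) u w : pmval (a *: u) w = \sum_g coef a g * pmval u (gsact g^-1%g w).
Proof. exact: permmod_scaleE. Qed.
Lemma pmvalZ_gelt g u w : pmval (gelt k g *: u) w = pmval u (gsact g^-1%g w).
Proof. exact: gelt_scale. Qed.
Lemma pmvalZ_inK c u w : pmval ((inK c : kG) *: u) w = c * pmval u w.
Proof. exact: inK_scale. Qed.
Lemma pmval_sum I r (P : pred I) (F : I -> kT) w :
  pmval (\sum_(i <- r | P i) F i) w = \sum_(i <- r | P i) pmval (F i) w.
Proof. exact: permmod_sumE. Qed.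

(** The action of a span by pulling back along the right leg and summing along the left leg, written
    on coordinates; [pL_pt] recovers its effect on basis points. *)
Definition span_act X u : kT := [ffun w => \sum_(x : X | oleft x == w) pmval u (oright x)].

Lemma pmval_span_act X u w :
  pmval (span_act X u) w = \sum_(x : X | oleft x == w) pmval u (oright x).
Proof. exact: ffunE. Qed.

Lemma span_act_linear X : linear (span_act X).
Proof.
move=> a u v; apply: pmvalP => w; rewrite pmvalD !pmval_span_act pmvalZ.
under eq_bigr => x _ do rewrite pmvalD pmvalZ.
rewrite big_split /=; congr (_ + _); rewrite exchange_big /=.
apply: eq_bigr => g _; rewrite pmval_span_act mulr_sumr.
rewrite (reindex_inj (can_inj (gsactK g))) /=; apply: eq_big => [x|x _].
  by rewrite oleftJ (can2_eq (gsactK g) (gsactKV g)).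
by rewrite orightJ gsactK.
Qed.
HB.instance Definition _ X :=
  GRing.isLinear.Build kG kT kT *:%R (span_act X) (@span_act_linear X).
Definition span_end X : E := (span_act X : {linear kT -> kT}).

Lemma endfun_span_end X u : endfun (span_end X) u = span_act X u.
Proof. by []. Qed.

Lemma span_end_iso X Y : over_iso X Y -> span_end X = span_end Y.
Proof.
case=> f [fb fJ fo]; apply: endP => u; rewrite !endfun_span_end.
apply: pmvalP => w; rewrite !pmval_span_act [RHS](reindex f) /=; last exact: onW_bij.
by apply: eq_big => x; rewrite ?(oleft_iso fo) ?(oright_iso fo).
Qed.

Lemma endfunD f g u : endfun (f + g) u = endfun f u + endfun g u.
Proof. by []. Qed.
Lemma endfun0 u : endfun (0 : E) u = 0.
Proof. by []. Qed.
Lemma endfunM f g u : endfun (f * g) u = endfun f (endfun g u).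
Proof. by []. Qed.
Lemma endfun1 u : endfun (1 : E) u = u.
Proof. by []. Qed.
Lemma endfun_inK c u : endfun (inK c : E) u = (inK c : kG) *: u.
Proof. by []. Qed.
Lemma endfunZ f (a : kG) u : endfun f (a *: u) = a *: endfun f u.
Proof. exact: linearZ. Qed.
Lemma endfun_sum f I r (P : pred I) (F : I -> kT) :
  endfun f (\sum_(i <- r | P i) F i) = \sum_(i <- r | P i) endfun f (F i).
Proof. exact: raddf_sum. Qed.

Lemma span_end_sum X Y : span_end (sum_over X Y) = span_end X + span_end Y.
Proof.
apply: endP => u; rewrite endfunD !endfun_span_end; apply: pmvalP => w.
by rewrite pmvalD !pmval_span_act big_sumType; congr (_ + _); apply: eq_big.
Qed.

Lemma span_end_prod X Y : span_end (span_prod X Y) = span_end X * span_end Y.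
Proof.
apply: endP => u; rewrite endfunM !endfun_span_end; apply: pmvalP => w.
rewrite !pmval_span_act.
rewrite [LHS](big_sig_val (@fibered _ _ X Y) (fun p => oleft p.1 == w)
   (fun p => pmval u (oright p.2))).
under [RHS]eq_bigr => x _ do rewrite pmval_span_act.
rewrite pair_big_dep /=; apply: eq_bigl => -[x y] /=.
by rewrite andbC; congr (_ && _); apply: eq_sym.
Qed.

Lemma span_end_one : span_end (span_one T) = 1.
Proof.
apply: endP => u; rewrite endfun1 endfun_span_end; apply: pmvalP => w.
by rewrite pmval_span_act (big_pred1 w).
Qed.

Definition pL_fun : span_alg T k -> E := galg_lift span_end.

Lemma pL_kmor : is_kmor pL_fun.
Proof.
apply: galg_lift_kmor; [exact: span_end_iso|exact: span_end_sum| |].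
- exact: span_end_prod.
- exact: span_end_one.
Qed.

Lemma pL_cls X : pL_fun (span_cls k X) = span_end X.
Proof. exact: galg_lift_cls span_end_iso span_end_sum _. Qed.

Lemma pL_pt X w : endfun (pL_fun (span_cls k X)) (pt k w) =
  \sum_(x : X | oright x == w) pt k (oleft x).
Proof.
rewrite pL_cls endfun_span_end; apply: pmvalP => w'; rewrite pmval_span_act pmval_sum.
rewrite [LHS]big_mkcond [RHS]big_mkcond; apply: eq_bigr => x _.
by rewrite !pmval_pt (eq_sym w'); do 2!case: (_ == _).
Qed.

(** The matrix coefficient in row [q.1] and column [q.2]. Commutation with G makes it constant on
    orbits of pairs ([entryJ]). *)
Definition entry f (q : TT) : k := pmval (endfun f (pt k q.2)) q.1.

Lemma entryP f g : (forall q, entry f q = entry g q) -> f = g.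
Proof.
move=> fg; apply: endP => u; rewrite (permmod_expand u) !endfun_sum.
apply: eq_bigr => w _; rewrite !endfunZ; congr (_ *: _).
by apply: pmvalP => w'; apply: (fg (w', w)).
Qed.

Lemma entryD f g q : entry (f + g) q = entry f q + entry g q.
Proof. by rewrite /entry endfunD pmvalD. Qed.
Lemma entry0 q : entry 0 q = 0.
Proof. by rewrite /entry endfun0 pmval0. Qed.
Lemma entry_inK c f q : entry (inK c * f) q = c * entry f q.
Proof. by rewrite /entry endfunM endfun_inK pmvalZ_inK. Qed.
Lemma entry_sum I r (P : pred I) (F : I -> E) q :
  entry (\sum_(i <- r | P i) F i) q = \sum_(i <- r | P i) entry (F i) q.
Proof. by elim/big_rec2: _ => [|i y1 y2 _ <-]; rewrite ?entry0 ?entryD. Qed.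
Lemma entryMn f n q : entry (f *+ n) q = entry f q *+ n.
Proof. by elim: n => [|n IH]; rewrite ?mulr0n ?entry0 // !mulrS entryD IH. Qed.
Lemma entryJ f g q : entry f (gsact g q) = entry f q.
Proof.
case: q => w w'; rewrite /entry /= -gelt_scale_pt endfunZ pmvalZ_gelt.
by rewrite gsactK.
Qed.

Lemma entry_span_end X q : entry (span_end X) q = #|[set x : X | omap x == q]|%:R.
Proof.
rewrite -sum1_card natr_sum; under [RHS]eq_bigl => x do rewrite inE.
case: q => w w'; rewrite /entry endfun_span_end pmval_span_act /=.
under eq_bigr => x _ do rewrite pmval_pt.
rewrite [LHS]big_mkcond [RHS]big_mkcond; apply: eq_bigr => x _.
rewrite /oleft /oright; case: (omap x) => a b; rewrite xpair_eqE /=.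
by do 2!case: (_ == _).
Qed.

(** The entry counts the cosets xS with x p = q. If q = y p, these are the cosets of S contained in
    the coset of y modulo the stabilizer of p. *)
Lemma entry_pcls (S : {group gT}) (p q : TT) : S \subset gstab p ->
  entry (pL_fun (pcls k S p)) q = (if q \in gorb p then #|gstab p : S|%g else 0%N)%:R.
Proof.
move=> Sp; rewrite /pcls (cclsE k Sp) [pL_fun _]pL_cls entry_span_end; congr (_%:R).
case: ifPn => [/gorbP[y ->]|nq]; last first.
  apply: eq_card0 => C; apply/negP; rewrite inE => /eqP e; case/negP: nq.
  by rewrite -e; apply/gorbP; exists (repr (val C)).
(* Translation by y^-1 carries the cosets lying over y p to those contained in the stabilizer of
   p. *)
rewrite -card_lcosets; pose f (C : coset_gset S) := (y^-1%g *: val C)%g.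
have fi : injective f by move=> C D /(can_inj (lcosetK _)) /val_inj.
rewrite -(card_image fi); apply: eq_card => A; apply/imageP/lcosetsP.
  case=> C; rewrite inE => /eqP e ->; case: (coset_ptP C) e => x -> e.
  exists (y^-1 * x)%g; last by rewrite /f /= lcosetM.
  rewrite gstabE gsactM; rewrite [Defs.omap _]coset_over_pt // in e.
  by rewrite e gsactK.
case=> g; rewrite gstabE => /eqP gp ->; exists (coset_pt S (y * g)%g).
  by rewrite inE [Defs.omap _]coset_over_pt // gsactM gp.
by rewrite /f /= lcosetM lcosetK.
Qed.
End SpanToEnd.

(** * The cohomological Mackey algebra as an algebra of matrices *)

Section Yoshida.
Variables (gT : finGroupType) (k : comPzRingType).
Local Notation Om := (omega gT).
Local Notation OO := (prod_gset Om Om).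
Local Notation B := (span_alg Om k).
Local Notation M := (mackey gT k).
Local Notation coM := (comackey gT k).
Local Notation Y := (yoshida gT k).
Local Notation pcls := (@pcls gT k Om).
Local Notation co := (@to_comackey gT k).
Implicit Types (H K L J S N : {group gT}) (x y g h : gT) (f : Y) (p q : OO).

Definition pL_beta : M -> Y := @pL_fun gT k Om \o @beta_fun gT k.

Lemma pL_beta_kmor : is_kmor pL_beta.
Proof. exact: kmor_comp (pL_kmor k Om) (beta_kmor gT k). Qed.

Lemma mt_mr_mtcr H K : K \subset H -> mt k H K * mr k H K = mtcr k H H 1 K.
Proof.
by move=> sKH; rewrite /mtcr conjGV1 -(mTC k (group1 K)) mTT.
Qed.

Lemma entry_mt_mr H K q : K \subset H ->
  entry (pL_beta (mt k H K * mr k H K)) q =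
  (if q \in gorb ((om H 1%g, om H 1%g) : OO) then #|H : K|%g else 0%N)%:R.
Proof.
move=> sKH; rewrite mt_mr_mtcr // /pL_beta /= beta_mtcr //; last by rewrite invg1 conjsg1.
rewrite invg1 entry_pcls; last by rewrite sub_gstab_om conjsg1 sKH.
by rewrite gstab_pair !gstab_om conjGV1 /= setIid.
Qed.

(** By [entry_mt_mr], the matrix of t^H_K r^H_K is |H:K| times the indicator of the orbit of (H, H).
    The case K = H gives t^H_H, written as t^H_H r^H_H. *)
Lemma pL_beta_cohom (u v : M) : cohom_rel u v -> pL_beta u = pL_beta v.
Proof.
case=> {u v} H K sKH; apply: entryP => q; rewrite entry_mt_mr //.
have -> : mt k H H = mt k H H * mr k H H by rewrite -mTR mTT.
have -> (u : M) n : pL_beta (u *+ n) = pL_beta u *+ n.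
  elim: n => [|n IH]; first exact: kmor0 pL_beta_kmor.
  by rewrite !mulrS; have [-> _ _ _] := pL_beta_kmor; rewrite IH.
rewrite entryMn entry_mt_mr // indexgg.
by case: ifP => _; rewrite ?mul0rn //= -mulrnA mul1n.
Qed.

Definition phi_fun : coM -> Y := quot_lift pL_beta.

Lemma phi_co u : phi_fun (co u) = pL_fun (beta_fun u).
Proof. exact: (quot_liftE pL_beta_kmor pL_beta_cohom). Qed.

Lemma phi_kmor : is_kmor phi_fun.
Proof. exact: (quot_lift_kmor pL_beta_kmor pL_beta_cohom). Qed.

Lemma co_kmor : is_kmor co.
Proof. exact: kalg_kmor. Qed.

(** Factor t through g N g^-1 and r through N, then move the inner t across c_g: the product t^N_S
    r^N_S appears in the middle, and the cohomological relation makes it |N:S| t^N_N. *)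
Lemma co_mtcr H K g S N : S \subset N -> N \subset K -> (N :^ g^-1)%g \subset H ->
  co (mtcr k H K g S) = inK (#|N : S|%g)%:R * co (mtcr k H K g N).
Proof.
move=> sSN sNK sNH; have [_ cM _ _] := co_kmor.
have sSg : ((S :^ g^-1)%G \subset (N :^ g^-1)%G) by rewrite /= conjSg.
have e : mtcr k H K g S =
      mt k H (N :^ g^-1)%G * mc k g N * (mt k N S * mr k N S) * mr k K N.
  rewrite /mtcr -(mTT k sSg sNH) -(mRR k sSN sNK).
  by rewrite -(mulrA (mt k H _) (mt k _ (S :^ g^-1)%G)) -(mCT k g sSN) !mulrA.
rewrite e !cM.
have -> : co (mt k N S) * co (mr k N S) = inK (#|N : S|%g)%:R * co (mt k N N).
  rewrite -cM [LHS](quot_rel (CohomRel k sSN)).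
  elim: #|N : S|%g => [|n IH]; first by rewrite !mulr0n inK0 mul0r; apply: kmor0 co_kmor.
  have [cD _ _ _] := co_kmor.
  by rewrite !mulrS inKD inK1 mulrDl mul1r -IH; apply: cD.
have R c (t' c' t'' r' : coM) : t' * c' * (inK c * t'') * r' = inK c * (t' * c' * (t'' * r')).
  by rewrite (mulrA (t' * c') (inK c)) -(inKC c (t' * c')) !mulrA.
by rewrite R -[co (mt k N N) * _]cM mTR mRR // -!cM.
Qed.

(* Yoshida's isomorphism sends orbit_elt q to the endomorphism whose matrix is *)
(* the indicator function of the orbit of q. *)
Definition orbit_elt q : coM := co (mpt k (gstab q) q).

Lemma orbit_eltJ g q : orbit_elt (gsact g q) = orbit_elt q.
Proof. by rewrite /orbit_elt gstabJ mptJ. Qed.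

(** This is [co_mtcr] with N the full stabilizer of p, everything being conjugated by a
    representative of the second coset; c is an index. *)
Lemma co_mpt S p : S \subset gstab p -> exists c, co (mpt k S p) = inK c * orbit_elt p.
Proof.
case: p => w w'; case: (omP w) => H [x {w}->]; case: (omP w') => K [y {w'}->] Sp.
rewrite /orbit_elt !mptE //; set N := gstab _.
have : N \subset gstab ((om H x, om K y) : OO) by [].
rewrite sub_gstab_om => /andP[Nx Ny].
exists (#|(N :^ y)%G : (S :^ y)%G|%g)%:R; apply: co_mtcr => //=; first by rewrite conjSg.
by rewrite -conjsgM invMg invgK mulKVg.
Qed.

(** The inverse of phi: f is the combination, weighted by its entries, of the indicator matrices of
    the orbits, and each of these is lifted to [orbit_elt]. *)
Definition psi_fun f : coM := \sum_(q : OO | gcanon q == q) inK (entry f q) * orbit_elt q.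

Lemma psi_transversal f (I : finType) (P : pred I) (x : I -> OO) :
  gtransversal P x -> psi_fun f = \sum_(i | P i) inK (entry f (x i)) * orbit_elt (x i).
Proof.
apply: (@sum_transversal _ OO _ (fun q => inK (entry f q) * orbit_elt q)) => g q.
by rewrite entryJ orbit_eltJ.
Qed.

Lemma psiD f f' : psi_fun (f + f') = psi_fun f + psi_fun f'.
Proof.
by rewrite /psi_fun -big_split; apply: eq_bigr => q _; rewrite entryD inKD mulrDl.
Qed.
Lemma psi0 : psi_fun 0 = 0.
Proof. by rewrite /psi_fun big1 // => q _; rewrite entry0 inK0 mul0r. Qed.
Lemma psi_inK c f : psi_fun (inK c * f) = inK c * psi_fun f.
Proof.
rewrite /psi_fun mulr_sumr; apply: eq_bigr => q _.
by rewrite entry_inK inKM mulrA.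
Qed.

Lemma phi_orbit_elt p : phi_fun (orbit_elt p) = pL_fun (pcls (gstab p) p).
Proof. by rewrite phi_co beta_mpt. Qed.

Lemma entry_orbit p q :
  entry (pL_fun (pcls (gstab p) p)) q = (gcanon p == gcanon q)%:R.
Proof.
rewrite entry_pcls // indexgg.
have -> : q \in gorb p = (gcanon p == gcanon q) by apply/gorbP/gcanon_eqP.
by case: eqP.
Qed.

Lemma entry_gcanon f q : entry f (gcanon q) = entry f q.
Proof. by case/gorbP: (gcanon_orb q) => g ->; rewrite entryJ. Qed.

Lemma phi_psi : cancel psi_fun phi_fun.
Proof.
have [fD fM f1 fK] := phi_kmor.
move=> f; apply: entryP => q; rewrite /psi_fun (kmor_sum _ _ _ phi_kmor) entry_sum.
under eq_bigr => p _ do rewrite fM fK phi_orbit_elt entry_inK entry_orbit.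
rewrite (bigD1 (gcanon q)) /=; last by rewrite gcanonK.
rewrite big1 => [|p /andP[/eqP cp /negPf pq]]; last by rewrite cp pq mulr0.
by rewrite addr0 gcanonK eqxx mulr1 entry_gcanon.
Qed.

Lemma psi_orbit p : psi_fun (pL_fun (pcls (gstab p) p)) = orbit_elt p.
Proof.
rewrite /psi_fun (bigD1 (gcanon p)) /=; last by rewrite gcanonK.
rewrite big1 => [|q /andP[/eqP cq /negPf pq]]; last first.
  by rewrite entry_orbit cq eq_sym pq inK0 mul0r.
rewrite addr0 entry_orbit gcanonK eqxx inK1 mul1r.
by case/gorbP: (gcanon_orb p) => g ->; rewrite orbit_eltJ.
Qed.

(** By [beta_inv_surj] the Mackey algebra is spanned by elements [mpt]; in the quotient these become
    multiples of [orbit_elt], which lies in the image by [psi_orbit]. *)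
Lemma psi_surj e : exists f, psi_fun f = e.
Proof.
have [cD cM c1 cK] := co_kmor.
elim/aq_ind: e => u; rewrite -/(co u); case: (beta_inv_surj u) => v {u}<-.
elim/groth_ind: v => [X||v v' [f e] [f' e']|a v [f e]].
- rewrite [beta_inv _]beta_inv_cls /orbit_sum (kmor_sum _ _ _ co_kmor).
  elim/big_ind: _ => [|_ _ [f <-] [f' <-]|x _]; first by exists 0; apply: psi0.
    by exists (f + f'); apply: psiD.
  case: (co_mpt (gstab_omap x)) => c ->; rewrite -psi_orbit -psi_inK.
  by eexists.
- by exists 0; rewrite psi0 beta_inv0 (kmor0 co_kmor).
- by exists (f + f'); rewrite psiD e e' beta_invD cD.
- by exists (inK a * f); rewrite psi_inK e beta_invZ cM cK.
Qed.

Lemma psi_phi : cancel phi_fun psi_fun.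
Proof. by move=> e; case: (psi_surj e) => f <-; rewrite phi_psi. Qed.

(** * The center of the cohomological Mackey algebra *)
Definition homothety_fun (a : groupalg gT k) (u : permmod k Om) : permmod k Om :=
  antipode a *: u.

Section Homothety.
Variable z : alg_center (groupalg gT k).
Lemma homothety_linear : linear (homothety_fun (val z)).
Proof.
move=> a u v; rewrite /homothety_fun scalerDr !scalerA; congr (_ *: _ + _).
by have /centralP -> := antipode_central (valP z).
Qed.
HB.instance Definition _ := GRing.isLinear.Build (groupalg gT k) _ _ *:%R
  (homothety_fun (val z)) homothety_linear.
Definition homothety_end : Y := (homothety_fun (val z) : {linear _ -> _}).
End Homothety.

Lemma homothety_endE z u : endfun (homothety_end z) u = antipode (val z) *: u.
Proof. by []. Qed.

(** The antipode reverses products, but here the factors are central and commute. *)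
Lemma homothety_kmor : is_kmor homothety_end.
Proof.
split.
- move=> a b; apply: endP => u.
  by rewrite endfunD !homothety_endE -scalerDl -antipodeD.
- move=> a b; apply: endP => u; rewrite endfunM !homothety_endE scalerA -antipodeM.
  by congr (antipode _ *: _); have /centralP ac := valP a; apply: ac.
- by apply: endP => u; rewrite endfun1 homothety_endE -(inK1 (k := k)) antipode_inK inK1 scale1r.
- by move=> c; apply: endP => u; rewrite endfun_inK homothety_endE antipode_inK.
Qed.

Lemma homothety_central z : homothety_end z \in @central k Y.
Proof.
by apply/centralP => f; apply: endP => u; rewrite !endfunM !homothety_endE endfunZ.
Qed.

Definition base_pt : permmod k Om := pt k (om 1%G 1%g).
(** The projection of k Omega onto its free summand k(G/1), identified with kG. *)
Definition restr (u : permmod k Om) : groupalg gT k := [ffun g => pmval u (om 1%G g)].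

Lemma gcoef_restr u g : coef (restr u) g = pmval u (om 1%G g).
Proof. exact: ffunE. Qed.

Lemma restrZ a u : restr (a *: u) = a * restr u.
Proof.
apply: groupalgP => g; rewrite gcoef_restr pmvalZ gcoefM; apply: eq_bigr => h _.
by rewrite om_actE gcoef_restr.
Qed.

Lemma restrD u v : restr (u + v) = restr u + restr v.
Proof. by apply: groupalgP => g; rewrite gcoefD !gcoef_restr pmvalD. Qed.

Lemma restr_base_pt : restr base_pt = 1.
Proof.
apply: groupalgP => g; rewrite -gelt1 gcoef_restr pmval_pt gcoef_gelt; congr ((nat_of_bool _)%:R).
apply/eqP/eqP => [/om_eqP|-> //]; rewrite mulg1 => /set1gP e.
by rewrite -[g]invgK e invg1.
Qed.

Section Transvection.
Variable v : permmod k Om.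
(** The endomorphism sending [base_pt] to v and vanishing on the other summands. *)
Definition send_base (u : permmod k Om) : permmod k Om := restr u *: v.
Lemma send_base_linear : linear send_base.
Proof. by move=> a u u'; rewrite /send_base restrD restrZ scalerDl scalerA. Qed.
HB.instance Definition _ := GRing.isLinear.Build (groupalg gT k) _ _ *:%R
  send_base send_base_linear.
Definition send_base_end : Y := (send_base : {linear _ -> _}).
Lemma send_base_endE u : endfun send_base_end u = restr u *: v.
Proof. by []. Qed.
End Transvection.

(* A central endomorphism commutes with the maps sending the generator of the *)
(* free summand kG to an arbitrary vector, so it is a homothety. *)
Lemma central_homothety f : f \in @central k Y -> exists z, homothety_end z = f.
Proof.
move=> /centralP fc; pose c := restr (endfun f base_pt).
have fE v : endfun f v = c *: v.
  have := congr1 (fun F : Y => endfun F base_pt) (fc (send_base_end v)).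
  by rewrite !endfunM !send_base_endE restr_base_pt scale1r.
have cc : c \in @central k (groupalg gT k).
  apply/centralP => a; have : endfun f (a *: base_pt) = a *: endfun f base_pt.
    exact: endfunZ.
  rewrite !fE !scalerA => /(congr1 restr); by rewrite !restrZ restr_base_pt !mulr1.
exists (AlgCenter (antipode_central cc)); apply: endP => u.
by rewrite homothety_endE fE /= antipodeK.
Qed.

Lemma homothety_inj : injective homothety_end.
Proof.
move=> z z' /(congr1 (fun F : Y => restr (endfun F base_pt))).
rewrite !homothety_endE !restrZ restr_base_pt !mulr1 => e.
by apply: val_inj; rewrite -[LHS]antipodeK e antipodeK.
Qed.

Definition iota_fun : alg_center (groupalg gT k) -> coM := psi_fun \o homothety_end.

Lemma phi_iota z : phi_fun (iota_fun z) = homothety_end z.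
Proof. exact: phi_psi. Qed.

Lemma iota_kmor : is_kmor iota_fun.
Proof. exact: kmor_comp (kmor_can psi_phi phi_psi phi_kmor) homothety_kmor. Qed.

Lemma iota_central z : iota_fun z \in @central k coM.
Proof.
have [fD fM f1 fK] := phi_kmor.
apply/centralP => e; apply: (can_inj psi_phi); rewrite !fM phi_iota.
by have /centralP -> := homothety_central z.
Qed.

Lemma iota_inj : injective iota_fun.
Proof. by move=> z z' /(congr1 phi_fun); rewrite !phi_iota => /homothety_inj. Qed.

Lemma iota_onto e : e \in @central k coM -> exists z, iota_fun z = e.
Proof.
move=> /centralP ec; have [fD fM f1 fK] := phi_kmor.
case: (@central_homothety (phi_fun e)) => [|z ez].
  by apply/centralP => f; rewrite -[f]phi_psi -!fM ec.
by exists z; apply: (can_inj psi_phi); rewrite phi_iota.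
Qed.

(** The equality g x K = H in Omega forces K = H and puts g^-1 in xH, while the antipode turns the
    coefficient at g into that of z at g^-1. *)
Lemma entry_homothety z H K x :
  entry (homothety_end z) (om H 1%g, om K x) =
  if K == H then \sum_(y in H) coef (val z) (x * y)%g else 0.
Proof.
rewrite /entry homothety_endE pmvalZ /= (reindex_inj invg_inj) /=.
under eq_bigr => y _.
  rewrite gcoef_antipode !invgK om_act_om mulg1 pmval_pt.
  over.
case: eqP => [->{K}|HK]; last first.
  rewrite big1 // => y _; case: eqP => [/om_tag e|_]; last by rewrite mulr0.
  by case: HK.
rewrite (reindex_inj (mulgI x)) /= [RHS]big_mkcond; apply: eq_bigr => y _.
rewrite eq_sym (sameP eqP (om_eqP H x (x * y)%g)) mulKg.
by case: ifP => _; rewrite ?mulr1 ?mulr0.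
Qed.

(** The orbits of pairs are represented by (H, xK) with x in H\G/K. By [entry_homothety] only K = H
    contributes, and the stabilizer of (H, xH) is the intersection of H with x H x^-1. *)
Lemma iota_funE z : iota_fun z = iota_formula (val z).
Proof.
pose x (t : {group gT} * ({group gT} * {set gT})) : OO :=
  (om t.1 1%g, om t.2.1 (repr t.2.2)).
have tr : gtransversal (fun t : {group gT} * ({group gT} * {set gT}) =>
    t.2.2 \in dcosets t.1 [set: gT] t.2.1) x.
  split=> [[w w']|[H [K D]] [H' [K' D']] g /= DD DD'].
    case: (omP w) => H [b {w}->]; case: (omP w') => K [y {w'}->].
    have := @dcosets_transversal _ H [set: gT]%G K (b^-1 * y)%g (in_setT _).
    case=> D DD [j [c [jH cK] e]]; exists (H, (K, D)) => //; exists (b * j)%g.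
    rewrite /x [RHS]/= /pact /= !om_act_om; congr pair.
      by apply/om_eqP; rewrite mulg1 mulKg.
    have -> : y = (b * j * repr D * c)%g by rewrite -[LHS](mulKVg b) e !mulgA.
    by apply/esym/om_eqP; rewrite mulKg.
  rewrite /x [RHS]/= /pact /= !om_act_om mulg1 => e.
  have eH : H' = H by have /om_tag := congr1 fst e.
  have eK : K' = K by have /om_tag := congr1 snd e.
  subst H' K'; have /om_eqP := congr1 fst e; rewrite invg1 mul1g => gH.
  congr (_, (_, _)); have /om_eqP := congr1 snd e; rewrite /= => cK.
  have eD' : repr D' = (g * repr D * ((repr D')^-1 * (g * repr D))^-1)%g.
    by rewrite invMg invgK mulKVg.
  case: (dcosets_repr (H := [set: gT]%G) (subsetT _) (subsetT _) DD) => _ ->.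
  case: (dcosets_repr (H := [set: gT]%G) (subsetT _) (subsetT _) DD') => _ ->.
  by rewrite eD' dcoset_eq // groupV.
rewrite /iota_fun /= (psi_transversal _ tr) /iota_formula.
transitivity (\sum_(H : {group gT})
    \sum_(t : {group gT} * {set gT} | t.2 \in dcosets H [set: gT] t.1)
    inK (entry (homothety_end z) (x (H, t))) * orbit_elt (x (H, t))).
  by rewrite pair_big_dep; apply: eq_big => [[]|[]].
apply: eq_bigr => H _.
transitivity (\sum_(K : {group gT}) \sum_(D in dcosets H [set: gT] K)
    inK (entry (homothety_end z) (x (H, (K, D)))) * orbit_elt (x (H, (K, D)))).
  by rewrite pair_big_dep; apply: eq_big => [[]|[]].
rewrite (bigD1 H) //= [X in _ + X]big1 ?addr0 => [|K KH]; last first.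
  by apply: big1 => D _; rewrite /x /= entry_homothety (negPf KH) inK0 mul0r.
apply: eq_bigr => D _; rewrite /x /= entry_homothety eqxx; congr (_ * _).
rewrite /orbit_elt mptE // invg1 mul1g; congr co.
set w := repr D.
have eS : gstab ((om H 1%g, om H w) : OO) = (H :&: H :^ w^-1)%G.
  by apply: val_inj; rewrite gstab_pair !gstab_om conjGV1.
have eSw : ((H :&: H :^ w^-1) :^ w)%G = (H :&: H :^ w)%G.
  by apply: val_inj; rewrite /= conjIg -conjsgM mulVg conjsg1 setIC.
rewrite eS eSw /mtcr; congr (mt k H _ * _ * _).
by apply: val_inj; rewrite -eSw /= conjsgK.
Qed.
End Yoshida.

(** * The left square and the values of phi *)

Section Diagram.
Variables (gT : finGroupType) (k : comPzRingType).
Local Notation Om := (omega gT).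
Local Notation kG := (groupalg gT k).
Local Notation Y := (yoshida gT k).
Local Notation co := (@to_comackey gT k).

(** The span of a crossed G-set X sends a point w to the sum over x in X of the translates of w by
    the inverse of the grade of x, which is the action of the antipode of the sum of the grades. *)
Lemma pL_crossed_to_span (T : gset gT) (b : crossed_burnside gT k) u :
  endfun (pL_fun (@crossed_to_span gT k T b)) u = antipode (phi1_fun b) *: u.
Proof.
have [pD pM _ pK] := pL_kmor k T; have [cD cM _ cK] := crossed_to_span_kmor k T.
have [fD fM _ fK] := phi1_kmor gT k.
elim/groth_ind: b => [X||b b' Hb Hb'|a b Hb].
- rewrite crossed_to_span_cls pL_cls phi1_cls endfun_span_end; apply: pmvalP => w.
  rewrite pmval_span_act pmvalZ (reindex_inj invg_inj) /=.
  under [RHS]eq_bigr => g _ do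
    rewrite gcoef_antipode !invgK /grade_sum gcoef_sum mulr_suml.
  rewrite [RHS]exchange_big -(pair_big_dep predT
    (fun x w' => twist (x, w') == w) (fun _ w' => pmval u w')) /=.
  apply: eq_bigr => x _.
  (* For a given x, only this w' is twisted to w. *)
  rewrite (big_pred1 (gsact (grade x) w)) => [|w']; last first.
    by rewrite /twist /= (can2_eq (gsactKV _) (gsactK _)).
  rewrite (bigD1 (grade x)) //= gcoef_gelt eqxx mul1r big1 ?addr0 // => g gx.
  by rewrite gcoef_gelt (negPf gx) mul0r.
- have a0 : antipode (0 : kG) = 0 by apply: groupalgP => g; rewrite gcoef_antipode !gcoef0.
  rewrite (kmor0 (crossed_to_span_kmor k T)) (kmor0 (pL_kmor k T)).
  by rewrite (kmor0 (phi1_kmor gT k)) a0 scale0r.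
- by rewrite cD pD fD endfunD Hb Hb' antipodeD scalerDl.
- rewrite -(ga_inKE (M := crossed_product gT)) cM cK pM pK fM fK endfunM Hb.
  by rewrite endfun_inK scalerA antipodeM antipode_inK inKC.
Qed.

Section PhiValues.
Implicit Types (H K L : {group gT}).

Lemma beta_mt H K (sKH : K \subset H) : beta_fun (mt k H K) = span_cls k (span_t sKH).
Proof. by rewrite beta_quot beta_free_t. Qed.
Lemma beta_mr H K (sKH : K \subset H) : beta_fun (mr k H K) = span_cls k (span_r sKH).
Proof. by rewrite beta_quot beta_free_r. Qed.
Lemma beta_mc g H : beta_fun (mc k g H) = span_cls k (span_c g H).
Proof. by rewrite beta_quot beta_free_c. Qed.

Lemma phi_mt H K L x : K \subset H ->
  endfun (phi_fun (co (mt k H K))) (pt k (om L x)) = if L == K then pt k (om H x) else 0.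
Proof.
move=> sKH; rewrite phi_co (beta_mt sKH) pL_pt.
have r y : @oright _ _ (span_t sKH) (coset_pt K y) = om K y by exact/omap_right/span_tE.
have l y : @oleft _ _ (span_t sKH) (coset_pt K y) = om H y by exact/omap_left/span_tE.
case: eqP => [->|LK]; last first.
  rewrite big_pred0 // => C; case: (coset_ptP C) => y ->; rewrite r.
  by apply/eqP => /om_tag /esym.
rewrite (big_pred1 (coset_pt K x)) ?l // => C; case: (coset_ptP C) => y -> /=; rewrite r.
by apply/eqP/eqP => [/om_inj|e]; last by rewrite /om e.
Qed.

Lemma phi_mc g H L x :
  endfun (phi_fun (co (mc k g H))) (pt k (om L x)) =
  if L == H then pt k (om (H :^ g^-1)%G (x * g^-1)%g) else 0.
Proof.
rewrite phi_co beta_mc pL_pt.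
have r y : @oright _ _ (span_c g H) (coset_pt H y) = om H y by exact/omap_right/span_cE.
have l y : @oleft _ _ (span_c g H) (coset_pt H y) = om (H :^ g^-1)%G (y * g^-1)%g.
  exact/omap_left/span_cE.
case: eqP => [->|LH]; last first.
  rewrite big_pred0 // => C; case: (coset_ptP C) => y ->; rewrite r.
  by apply/eqP => /om_tag /esym.
rewrite (big_pred1 (coset_pt H x)) ?l // => C; case: (coset_ptP C) => y -> /=; rewrite r.
by apply/eqP/eqP => [/om_inj|e]; last by rewrite /om e.
Qed.

(** The points of G/K above xH are the cosets xhK with hK in H/K, so translation by x identifies
    them with [lcosets K H]. *)
Lemma phi_mr H K L x : K \subset H ->
  endfun (phi_fun (co (mr k H K))) (pt k (om L x)) =
  if L == H then \sum_(C in lcosets K H) pt k (om K (x * repr C)%g) else 0.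
Proof.
move=> sKH; rewrite phi_co (beta_mr sKH) pL_pt.
have r y : @oright _ _ (span_r sKH) (coset_pt K y) = om H y by exact/omap_right/span_rE.
have l y : @oleft _ _ (span_r sKH) (coset_pt K y) = om K y by exact/omap_left/span_rE.
case: eqP => [->|LH]; last first.
  rewrite big_pred0 // => C; case: (coset_ptP C) => y ->; rewrite r.
  by apply/eqP => /om_tag /esym.
pose h' (C : coset_gset K) : {set gT} := (x^-1%g *: val C)%g.
rewrite (reindex_onto (fun C : {set gT} => coset_pt K (x * repr C)%g : coset_gset K) h') /=.
  apply: eq_big => [C|C _]; last by rewrite l.
  rewrite r eq_sym (sameP eqP (om_eqP _ _ _)) mulKg /h' /= lcosetM lcosetK.
  apply/andP/lcosetsP => [[cH /eqP eC]|[y yH ->]]; first by exists (repr C).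
  have [c cK ->] := repr_lcoset K y; split; last by rewrite lcosetM lcoset_id.
  by rewrite groupM // (subsetP sKH).
move=> C _; case: (coset_ptP C) => y ->; rewrite /h' /= -lcosetM.
have [c cK ->] := repr_lcoset K (x^-1 * y)%g; apply/esym/coset_pt_eqP.
by rewrite !mulgA mulgK mulVg mul1g.
Qed.
End PhiValues.
End Diagram.

Theorem corollary4p4 (gT : finGroupType) (k : comPzRingType) :
  exists (zeta : {kalg crossed_burnside gT k -> alg_center (mackey gT k)})
    (beta : {kalg alg_center (mackey gT k) -> alg_center (span_alg (omega gT) k)})
    (phi1 : {kalg crossed_burnside gT k -> alg_center (groupalg gT k)})
    (p' : {kalg alg_center (mackey gT k) -> alg_center (comackey gT k)})
    (pL : {kalg alg_center (span_alg (omega gT) k) -> alg_center (yoshida gT k)})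
    (iota : {kalg alg_center (groupalg gT k) -> alg_center (comackey gT k)})
    (phi : {kalg alg_center (comackey gT k) -> alg_center (yoshida gT k)}),
  [/\ forall (L : {group gT}) (a : gT) (aL : a \in 'C(L)%g),
        val (zeta (crossed_cls k aL)) = zeta_formula k L a,
      forall (L : {group gT}) (a : gT) (aL : a \in 'C(L)%g),
        val (phi1 (crossed_cls k aL)) = phi1_formula k L a,
      bijective iota,
      forall z : alg_center (groupalg gT k),
        val (iota z) = iota_formula (val z) &
      induced_on_centers (@to_comackey gT k) p'] /\
  [/\ exists beta' : {kalg mackey gT k -> span_alg (omega gT) k},
        [/\ bijective beta',
            forall (H K : {group gT}) (sKH : K \subset H),
              beta' (mt k H K) = span_cls k (span_t sKH),
            forall (H K : {group gT}) (sKH : K \subset H),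
              beta' (mr k H K) = span_cls k (span_r sKH),
            forall (g : gT) (H : {group gT}),
              beta' (mc k g H) = span_cls k (span_c g H) &
            induced_on_centers beta' beta],
      exists pL' : {kalg span_alg (omega gT) k -> yoshida gT k},
        (forall (X : gset_over (prod_gset (omega gT) (omega gT))) (w : omega gT),
           endfun (pL' (span_cls k X)) (pt k w) =
             \sum_(x : X | oright x == w) pt k (oleft x)) /\
        induced_on_centers pL' pL &
      exists phi' : {kalg comackey gT k -> yoshida gT k},
        [/\ bijective phi',
            forall (H K L : {group gT}) (x : gT), K \subset H ->
              endfun (phi' (to_comackey (mt k H K))) (pt k (om L x)) =
                if L == K then pt k (om H x) else 0,
            forall (H K L : {group gT}) (x : gT), K \subset H ->
              endfun (phi' (to_comackey (mr k H K))) (pt k (om L x)) =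
                if L == H then
                  \sum_(C in lcosets K H) pt k (om K (x * repr C)%g)
                else 0,
            forall (g : gT) (H L : {group gT}) (x : gT),
              endfun (phi' (to_comackey (mc k g H))) (pt k (om L x)) =
                if L == H then pt k (om (H :^ g^-1)%G (x * g^-1)%g) else 0 &
            induced_on_centers phi' phi]] /\
  (forall b : crossed_burnside gT k, p' (zeta b) = iota (phi1 b)) /\
  (forall z : alg_center (mackey gT k), pL (beta z) = phi (p' z)).
Proof.
have [zeta zetaE] := kmor_to_center (zeta_kmor gT k) (@zeta_central gT k).
have [phi1 phi1E] := kmor_to_center (phi1_kmor gT k) (@phi1_central gT k).
have [iota iotaE] := kmor_to_center (iota_kmor gT k) (@iota_central gT k).
have [beta betaE] := kmor_on_centers (beta_kmor gT k)
  (fun v => ex_intro _ (beta_inv v) (beta_invK v)).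
have [p' p'E] := kmor_on_centers (co_kmor gT k)
  (fun e => ex_intro _ (generic_quotient.repr e) (quot_surj e)).
have [phi phiE] := kmor_on_centers (phi_kmor gT k)
  (fun f => ex_intro _ (psi_fun f) (phi_psi f)).
(* Needed for p_L to induce a map on centers: phi is onto, and phi after the quotient map is p_L
   after beta. *)
have pL_surj (f : yoshida gT k) : exists v, pL_fun v = f.
  rewrite -(phi_psi f) -(quot_surj (psi_fun f)).
  exists (beta_fun (generic_quotient.repr (psi_fun f))).
  by rewrite [RHS]phi_co.
have [pL pLE] := kmor_on_centers (pL_kmor k (omega gT)) pL_surj.
exists zeta, beta, phi1, p', pL, iota, phi.
split; [split|split; [split|split]].
- by move=> L a aL; rewrite zetaE zeta_funE.
- by move=> L a aL; rewrite phi1E phi1_funE.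
- have iota_surj e : exists z, iota z = e.
    have [z ez] := iota_onto (valP e).
    by exists z; apply: val_inj; rewrite iotaE.
  (* The inverse is obtained by choosing preimages; injectivity of [iota_fun] makes it two-sided. *)
  have [inv invK] := choice iota_surj; exists inv => // z.
  by apply: iota_inj; rewrite -!iotaE invK.
- by move=> z; rewrite iotaE iota_funE.
- exact: p'E.
- exists (kmor_kalg (beta_kmor gT k)); split.
  + exact: Bijective (@beta_funK gT k) (@beta_invK gT k).
  + exact: beta_mt.
  + exact: beta_mr.
  + exact: beta_mc.
  + exact: betaE.
- by exists (kmor_kalg (pL_kmor k (omega gT))); split; [exact: pL_pt|exact: pLE].
- exists (kmor_kalg (phi_kmor gT k)); split.
  + exact: Bijective (@psi_phi gT k) (@phi_psi gT k).
  + by move=> *; apply: phi_mt.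
  + by move=> *; apply: phi_mr.
  + by move=> *; apply: phi_mc.
  + exact: phiE.
(* The left square is tested after the injective map [phi_fun], where both sides act on k Omega by
   the antipode of phi_1(b). *)
- move=> b; apply: val_inj; rewrite p'E zetaE iotaE; apply: (can_inj (@psi_phi gT k)).
  rewrite phi_iota phi_co /zeta_fun /= beta_invK; apply: endP => u.
  by rewrite pL_crossed_to_span homothety_endE phi1E.
- by move=> z; apply: val_inj; rewrite pLE betaE phiE p'E phi_co.
Qed.
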